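(* Let $(s,t)\in\mathbb{C}\times\mathbb{C}$. If $|s|^2>|t|^2+1$, then the compact operator $T^{(s,t)}:F^2\to F^2$ belongs to the Schatten class $S_p$ for any $p>0$. Moreover, $$\|T^{(s,t)}\|_{S_p}^p\le\frac{2|s|}{p(|s|^2-|t|^2-1)(|s|^2-|t|^2)^{(p-2)/4}},\qquad 0<p\le2,$$ and $$\|T^{(s,t)}\|_{S_p}^p\ge\frac{2|s|}{p(|s|^2-|t|^2-1)(|s|^2-|t|^2)^{(p-2)/4}},\qquad p\ge2.$$
   Context: Let $d\lambda(z)=\frac1\pi e^{-|z|^2}\,dA(z)$ on $\mathbb{C}$. The Fock space $F^2$ is the Hilbert space of entire functions $f$ with $\int_{\mathbb{C}}|f|^2\,d\lambda<\infty$ and inner product $\langle f,g\rangle=\int_{\mathbb{C}}f\overline g\,d\lambda$. For $(s,t)\in\mathbb{C}^2$ with $s\ne0$, $$K^{(s,t)}(z,w)=\frac1{\sqrt s}\exp\left[\frac{tz^2-\overline{tw^2}+2z\overline w}{2s}\right],\qquad T^{(s,t)}f(z)=\int_{\mathbb{C}}K^{(s,t)}(z,w)f(w)\,d\lambda(w),$$ with principal square root ($\arg\in(-\pi,\pi]$). It is known that $T^{(s,t)}$ is compact on $F^2$ if and only if $|s|^2>|t|^2+1$. The singular values of a compact operator $T$ are the nonzero eigenvalues, listed in non-increasing order with multiplicity, of $|T|=(T^*T)^{1/2}$. For $0<p<\infty$, $T\in S_p$ means that the sequence $\{\lambda_n\}$ of singular values is in $\ell^p$, and then $\|T\|_{S_p}=\left(\sum_n\lambda_n^p\right)^{1/p}$.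 *)

(* Defs.v *)
From HB Require Import structures.
From mathcomp Require Import all_boot all_order all_algebra.
From mathcomp Require Import all_classical all_reals all_analysis.
From mathcomp Require Import complex.

Set Implicit Arguments.
Unset Strict Implicit.
Unset Printing Implicit Defensive.

Import Order.TTheory GRing.Theory Num.Theory.
Import numFieldNormedType.Exports Normc.

Local Open Scope classical_set_scope.
Local Open Scope complex_scope.
Local Open Scope ring_scope.

Section FockSpace.
Variable R : realType.
Local Notation C := R[i].

Definition cexp (z : C) : C :=
  (expR (complex.Re z) * cos (complex.Im z)) +i*
  (expR (complex.Re z) * sin (complex.Im z)).

(* [C] carries no sigma-algebra in the library, so integrals over the complex
   plane are taken over [R * R], the point [w] standing for [w.1 +i* w.2]. *)
Local Notation area := (@lebesgue_measure R \x @lebesgue_measure R)%E.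

Definition gauss_density (w : R * R) : R :=
  pi^-1 * expR (- (w.1 ^+ 2 + w.2 ^+ 2)).

Definition gauss_integral (g : C -> C) : C :=
  (\int[area]_w (complex.Re (g (w.1 +i* w.2)) * gauss_density w)) +i*
  (\int[area]_w (complex.Im (g (w.1 +i* w.2)) * gauss_density w)).

Definition entire (f : C -> C) : Prop :=
  forall z : C, derivable (f : C^o -> C^o) z 1.

Definition fock : set (C -> C) := [set f | entire f /\
  (\int[area]_w (normc (f (w.1 +i* w.2)) ^+ 2 * gauss_density w)%:E < +oo)%E].

Definition fock_ip (f g : C -> C) : C :=
  gauss_integral (fun z => f z * conjc (g z)).

Definition fock_norm (f : C -> C) : R := Num.sqrt (complex.Re (fock_ip f f)).

(* An operator on the Fock space is a map on all functions [C -> C] of which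
   only the values on [fock] matter. *)
Definition bounded_op (T : (C -> C) -> (C -> C)) : Prop :=
  [/\ forall f, fock f -> fock (T f),
      forall (c : C) f g, fock f -> fock g ->
        T (fun z => c * f z + g z) = (fun z => c * T f z + T g z) &
      exists M : R, forall f, fock f -> fock_norm (T f) <= M * fock_norm f].

Definition compact_op (T : (C -> C) -> (C -> C)) : Prop :=
  bounded_op T /\
  forall u : nat -> C -> C, (forall n, fock (u n) /\ fock_norm (u n) <= 1) ->
    exists (k : nat -> nat) (g : C -> C),
      [/\ {homo k : m n / (m < n)%N}, fock g &
          (fun n => fock_norm (fun z => T (u (k n)) z - g z)) @ \oo --> (0 : R)].

Definition is_adjoint (T S : (C -> C) -> (C -> C)) : Prop :=
  bounded_op S /\
  forall f g, fock f -> fock g -> fock_ip (T f) g = fock_ip f (S g).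

(* [A] is the positive square root of [T^* T]; in the order of [C],
   [0 <= x] also says that [x] is real. *)
Definition is_abs (T A : (C -> C) -> (C -> C)) : Prop :=
  [/\ bounded_op A,
      forall f, fock f -> 0 <= fock_ip (A f) f &
      exists2 S, is_adjoint T S & forall f, fock f -> A (A f) = S (T f)].

Definition fock_eigenspace (A : (C -> C) -> (C -> C)) (mu : R) : set (C -> C) :=
  [set f | fock f /\ A f = (fun z => mu%:C * f z)].

Definition has_dim (E : set (C -> C)) (k : nat) : Prop :=
  exists e : 'I_k -> C -> C, (forall i, E (e i)) /\
    forall f, E f ->
      exists! c : {ffun 'I_k -> C}, f = (fun z => \sum_(i < k) c i * e i z).

(* The eigenvalues of a positive operator are real and nonnegative, so the
   nonzero ones are positive. A finite list of singular values is continued by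
   zeros, which contribute nothing to the sums of p-th powers below. *)
Definition is_singular_values (T : (C -> C) -> (C -> C)) (lam : nat -> R)
    : Prop :=
  exists2 A, is_abs T A &
    [/\ forall n, 0 <= lam n,
        nonincreasing_seq lam &
        forall mu : R, 0 < mu ->
          exists2 k, has_dim (fock_eigenspace A mu) k &
            ([set n | lam n = mu] #= `I_k)%card].

Definition singular_values (T : (C -> C) -> (C -> C)) : nat -> R :=
  xget (fun=> 0) [set lam | is_singular_values T lam].

Definition schatten_sum (T : (C -> C) -> (C -> C)) (p : R) : \bar R :=
  (\sum_(0 <= n <oo) (singular_values T n `^ p)%:E)%E.

(* The second clause says that [singular_values T] is not the default value
   of [xget]. *)
Definition schatten_class (T : (C -> C) -> (C -> C)) (p : R) : Prop :=
  [/\ compact_op T, is_singular_values T (singular_values T) &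
      (schatten_sum T p < +oo)%E].

Definition schatten_norm (T : (C -> C) -> (C -> C)) (p : R) : \bar R :=
  (schatten_sum T p `^ p^-1)%E.

(* [sqrtc] is the principal square root: [0 <= Re (sqrtc s)], and
   [sqrtc (- a%:C) = 'i * (Num.sqrt a)%:C] for [0 <= a]. *)
Definition kernelST (s t z w : C) : C :=
  (sqrtc s)^-1 *
  cexp ((t * z ^+ 2 - conjc (t * w ^+ 2) + 2 * z * conjc w) / (2 * s)).

Definition opST (s t : C) (f : C -> C) : C -> C :=
  fun z => gauss_integral (fun w => kernelST s t z w * f w).

End FockSpace.

(* Main.v *)
(* The kernel is Gaussian, so the operator carries Gaussian-weighted Hermite polynomials
   to Gaussian-weighted Hermite polynomials.  With D = |s|^2 - |t|^2, X > 0 the root of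
   X^2 = (D - 1) X + |s|^2, g = X / (1 + X) and q = |s| / X, the orthonormal functions
     e_n = N_n^-1 H_n(c w, - conj gam) exp (gam w^2 / 2),  gam = - g t / conj s,
   are sent to q^(n + 1/2) times unimodular multiples of the analogous functions f_n for
   gam' = g t / s: both sides satisfy the same three-term recurrence.  Every kernel
   function of the operator lies in the closed span of the e_n, so
     T h = \sum_n q^(n + 1/2) <h, e_n> f_n,
   and the singular values are q^(n + 1/2), whose p-th powers sum to
   q^(p/2) / (1 - q^p).  Here q^-1 - q = (D - 1) / |s|.  The bounds follow from
   D >= q^-2 and Bernoulli's inequality for 1 - (q^2)^(p/2) against (p/2) (1 - q^2),
   whose direction changes at p = 2. *)

(* The number [X] and the ratio [g] are forced. Let [b = - t / conj s] be the Gaussian parameter of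
   the kernel in [w]. The pairings of the Hermite functions of [gam = g b] with the kernel obey a
   three-term recurrence whose leading coefficient is [1 - gam * conj b = (|s|^2 - g |t|^2) /
   |s|^2]. Calling the numerator [X], the image is again of Hermite type, with a parameter of the
   same modulus, as soon as [(1 - g) X = g]; eliminating [g] leaves the quadratic equation for [X].

   The obstacle is that a member of the Fock space is given by bare complex differentiability and
   square integrability. Differentiability of a given function enters through continuity, hence
   measurability and definiteness of the norm. The operator sees its argument only through pairings
   with its kernel functions, and an eigenvector for [mu > 0] satisfies [mu^2 f = DA (DA f)], so it
   is the sum of its own series. Functions built by the proof are entire because they reproduce
   themselves. *)
From HB Require Import structures.
From mathcomp Require Import all_boot all_order all_algebra.
From mathcomp Require Import all_classical all_reals all_analysis.
From mathcomp Require Import measurable_realfun complex ring lra.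
Require Import Defs.

Set Implicit Arguments.
Unset Strict Implicit.
Unset Printing Implicit Defensive.

Import Order.TTheory GRing.Theory Num.Theory.
Import numFieldNormedType.Exports Normc.

Local Open Scope classical_set_scope.
Local Open Scope complex_scope.
Local Open Scope ring_scope.

(** * Complex numbers and limits *)

Section ComplexBasics.
Variable R : realType.
Local Notation C := R[i].
Local Notation Re := (@complex.Re R).
Local Notation Im := (@complex.Im R).
Implicit Types (z w : C) (u v : nat -> C).

Lemma normc_ge0 z : 0 <= normc z.
Proof. by case: z => a b; exact: sqrtr_ge0. Qed.

Lemma normcD z w : normc (z + w) <= normc z + normc w.
Proof. exact: le_normcD. Qed.

Lemma normcB z w : normc (z - w) <= normc z + normc w.
Proof. by rewrite -(normcN w) normcD. Qed.

Lemma normc_sum (I : Type) (s : seq I) (F : I -> C) :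
  normc (\sum_(i <- s) F i) <= \sum_(i <- s) normc (F i).
Proof.
elim/big_ind2 : _ => [|x1 x2 y1 y2 h1 h2|//]; first by rewrite normc0.
by rewrite (le_trans (normcD _ _))// lerD.
Qed.

Lemma normcX z n : normc (z ^+ n) = normc z ^+ n.
Proof. by elim: n => [|n ih]; rewrite ?normc1 // !exprS normcM ih. Qed.

Lemma normcR (x : R) : normc x%:C = `|x|.
Proof. by rewrite /= expr0n /= addr0 sqrtr_sqr. Qed.

Lemma normc_nat n : normc (n%:R : C) = n%:R.
Proof. by rewrite -(rmorph_nat (real_complex R)) normcR ger0_norm. Qed.

Lemma conjcD z w : conjc (z + w) = conjc z + conjc w.
Proof. exact: rmorphD. Qed.

Lemma conjcN z : conjc (- z) = - conjc z.
Proof. exact: rmorphN. Qed.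

Lemma conjcM z w : conjc (z * w) = conjc z * conjc w.
Proof. exact: rmorphM. Qed.

Lemma conjcX z n : conjc (z ^+ n) = conjc z ^+ n.
Proof. exact: rmorphXn. Qed.

Lemma conjcV z : conjc z^-1 = (conjc z)^-1.
Proof. exact: fmorphV. Qed.

Lemma normc_conj z : normc (conjc z) = normc z.
Proof. by case: z => a b /=; rewrite sqrrN. Qed.

Lemma normc_Re z : `|Re z| <= normc z.
Proof.
case: z => a b /=; rewrite -sqrtr_sqr ler_wsqrtr// lerDl sqr_ge0 //.
Qed.

Lemma normc_Im z : `|Im z| <= normc z.
Proof.
case: z => a b /=; rewrite -sqrtr_sqr ler_wsqrtr// lerDr sqr_ge0 //.
Qed.

Lemma normc_le_ReIm z : normc z <= `|Re z| + `|Im z|.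
Proof.
rewrite [in normc z](complexE z) (le_trans (normcD _ _))// normcM !normcR.
by rewrite (_ : normc 'i = 1) ?mul1r //= expr0n /= add0r expr1n sqrtr1.
Qed.

Lemma sqr_normcE z : normc z ^+ 2 = Re z ^+ 2 + Im z ^+ 2.
Proof. by case: z => a b /=; rewrite sqr_sqrtr// addr_ge0 ?sqr_ge0. Qed.

Lemma normc_eq0 z : (normc z == 0) = (z == 0).
Proof. by apply/eqP/eqP => [/eq0_normc //|->]; rewrite normc0. Qed.

Lemma normc_gt0 z : (0 < normc z) = (z != 0).
Proof. by rewrite lt_neqAle normc_ge0 andbT eq_sym normc_eq0. Qed.

Lemma ReD z w : Re (z + w) = Re z + Re w. Proof. by case: z w => [? ?] []. Qed.
Lemma ImD z w : Im (z + w) = Im z + Im w. Proof. by case: z w => [? ?] []. Qed.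
Lemma ReN z : Re (- z) = - Re z. Proof. by case: z. Qed.
Lemma ImN z : Im (- z) = - Im z. Proof. by case: z. Qed.
Lemma ReM z w : Re (z * w) = Re z * Re w - Im z * Im w.
Proof. by case: z w => [? ?] []. Qed.
Lemma ImM z w : Im (z * w) = Re z * Im w + Im z * Re w.
Proof. by case: z w => [? ?] [? ?]. Qed.
Lemma Re_conj z : Re (conjc z) = Re z. Proof. by case: z. Qed.
Lemma Im_conj z : Im (conjc z) = - Im z. Proof. by case: z. Qed.

Lemma Re_sum (I : Type) (s : seq I) (F : I -> C) :
  Re (\sum_(i <- s) F i) = \sum_(i <- s) Re (F i).
Proof. by elim/big_rec2 : _ => [//|i x y _ <-]; rewrite ReD. Qed.

Lemma Im_sum (I : Type) (s : seq I) (F : I -> C) :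
  Im (\sum_(i <- s) F i) = \sum_(i <- s) Im (F i).
Proof. by elim/big_rec2 : _ => [//|i x y _ <-]; rewrite ImD. Qed.

Lemma eqC z w : Re z = Re w -> Im z = Im w -> z = w.
Proof. by case: z w => [? ?] [? ?] /= -> ->. Qed.

Lemma mul_conjE z : z * conjc z = (normc z ^+ 2)%:C.
Proof.
apply: eqC; rewrite ?ReM ?ImM ?Re_conj ?Im_conj /= ?sqr_normcE; ring.
Qed.

(** Convergence through the real modulus: limit arguments become squeezes between real sequences. *)
Definition ccvg u (l : C) := (fun n => normc (u n - l)) @ \oo --> (0 : R).

Lemma ccvg_squeeze u l (v : nat -> R) :
  (forall n, normc (u n - l) <= v n) -> v @ \oo --> (0 : R) -> ccvg u l.
Proof.
move=> uv v0; apply: (squeeze_cvgr (f := cst 0) (h := v)) => //.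
  by apply: nearW => n; rewrite normc_ge0 uv.
exact: cvg_cst.
Qed.

Lemma ccvg_cst l : ccvg (fun=> l) l.
Proof. by apply: (@ccvg_squeeze _ _ (cst 0)) => [n|]; [rewrite subrr normc0|exact: cvg_cst]. Qed.

Lemma ccvgD u v l m : ccvg u l -> ccvg v m -> ccvg (fun n => u n + v n) (l + m).
Proof.
move=> ul vm; apply: (@ccvg_squeeze _ _ (fun n => normc (u n - l) + normc (v n - m))).
  by move=> n; rewrite (_ : u n + v n - (l + m) = (u n - l) + (v n - m)) ?normcD //; ring.
by rewrite -[0]addr0; exact: cvgD.
Qed.

Lemma ccvgZ c u l : ccvg u l -> ccvg (fun n => c * u n) (c * l).
Proof.
move=> ul; apply: (@ccvg_squeeze _ _ (fun n => normc c * normc (u n - l))).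
  by move=> n; rewrite -mulrBr normcM.
by rewrite -[0](mulr0 (normc c)); exact: cvgMl_tmp.
Qed.

Lemma ccvg_Re u l : ccvg u l -> (Re \o u) @ \oo --> Re l.
Proof.
move=> ul; apply/subr_cvg0/norm_cvg0P.
apply: (squeeze_cvgr (f := cst 0) (h := fun n => normc (u n - l))) => //.
  by apply: nearW => n; rewrite normr_ge0/= -ReN -ReD normc_Re.
exact: cvg_cst.
Qed.

Lemma ccvg_Im u l : ccvg u l -> (Im \o u) @ \oo --> Im l.
Proof.
move=> ul; apply/subr_cvg0/norm_cvg0P.
apply: (squeeze_cvgr (f := cst 0) (h := fun n => normc (u n - l))) => //.
  by apply: nearW => n; rewrite normr_ge0/= -ImN -ImD normc_Im.
exact: cvg_cst.
Qed.

Lemma ReIm_ccvg u l : (Re \o u) @ \oo --> Re l -> (Im \o u) @ \oo --> Im l -> ccvg u l.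
Proof.
move=> hr hi; apply: (@ccvg_squeeze _ _
  (fun n => `|Re (u n) - Re l| + `|Im (u n) - Im l|)).
  by move=> n; rewrite -ReN -ImN -ReD -ImD normc_le_ReIm.
rewrite -[0]addr0; apply: cvgD; apply/norm_cvg0P; exact/subr_cvg0.
Qed.

Lemma ccvg_unique u l m : ccvg u l -> ccvg u m -> l = m.
Proof.
move=> ul um; apply: eqC.
  exact: (cvg_unique _ (ccvg_Re ul) (ccvg_Re um)).
exact: (cvg_unique _ (ccvg_Im ul) (ccvg_Im um)).
Qed.

Lemma ccvg_conj u l : ccvg u l -> ccvg (fun n => conjc (u n)) (conjc l).
Proof.
rewrite /ccvg => ul; rewrite (_ : (fun n => _) = (fun n => normc (u n - l)))//.
by apply/funext => n; rewrite -rmorphB normc_conj.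
Qed.

Lemma ccvg_normc u l : ccvg u l -> (fun n => normc (u n)) @ \oo --> normc l.
Proof.
move=> ul; apply/subr_cvg0/norm_cvg0P.
apply: (squeeze_cvgr (f := cst 0) (h := fun n => normc (u n - l))) => //.
  apply: nearW => n; rewrite normr_ge0/= ler_norml lerBlDl lerBrDl.
  apply/andP; split.
    have := normcD (l - u n) (u n); rewrite subrK -(normcN (l - _)) opprB; lra.
  by have := normcD (u n - l) l; rewrite subrK; lra.
exact: cvg_cst.
Qed.

Lemma ccvg_le u l (M : R) : ccvg u l -> (forall n, normc (u n) <= M) -> normc l <= M.
Proof.
by move=> /ccvg_normc ul uM; apply: (cvgr_to_le ul); exact: nearW.
Qed.

Lemma ccvg_eq u v l : (forall n, u n = v n) -> ccvg u l -> ccvg v l.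
Proof. by move=> uv; rewrite (_ : u = v)//; exact/funext. Qed.

Lemma ccvg_shiftS u l : ccvg (fun n => u n.+1) l -> ccvg u l.
Proof. by move=> h; rewrite /ccvg -cvg_shiftS. Qed.

Lemma ccvgS u l : ccvg u l -> ccvg (fun n => u n.+1) l.
Proof. by rewrite /ccvg -cvg_shiftS. Qed.

Lemma bounded_partial_sums_cvg (a : nat -> R) (M : R) :
  (forall k, 0 <= a k) -> (forall N, \sum_(k < N) a k <= M) ->
  exists l : R, (fun N => \sum_(k < N) a k : R) @ \oo --> l.
Proof.
move=> a0 aM; pose S N := \sum_(k < N) a k.
have ndS : nondecreasing_seq S.
  by apply/nondecreasing_seqP => n; rewrite /S big_ord_recr /= lerDl.
exists (limn S); apply: nondecreasing_is_cvgn => //.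
by exists M => _ [n _ <-].
Qed.

(** Adding [normc (a k)] to a coordinate of [a k] makes it non-negative, so each coordinate series
    is a difference of two bounded monotone ones. *)
Lemma abs_sum_cvg (a : nat -> C) (M : R) :
  (forall N, \sum_(k < N) normc (a k) <= M) ->
  exists l, ccvg (fun N => \sum_(k < N) a k) l.
Proof.
move=> aM.
have real (f : C -> R) : (forall z, `|f z| <= normc z) ->
    exists l : R, (fun N => \sum_(k < N) f (a k) : R) @ \oo --> l.
  move=> fn.
  have [l1 h1] : exists l : R, (fun N => \sum_(k < N) (f (a k) + normc (a k)) : R) @ \oo --> l.
    apply: (@bounded_partial_sums_cvg (fun k => f (a k) + normc (a k)) (2 * M)) => [k|N].
      by have := fn (a k); rewrite ler_norml => /andP[]; lra.
    rewrite (@le_trans _ _ (\sum_(k < N) (2 * normc (a k))))//.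
      apply: ler_sum => i _.
      by have := fn (a i); rewrite ler_norml => /andP[]; lra.
    by rewrite -mulr_sumr ler_pM2l.
  have [l2 h2] := bounded_partial_sums_cvg (fun k => normc_ge0 (a k)) aM.
  exists (l1 - l2).
  rewrite (_ : (fun N => _) = (fun N => \sum_(k < N) (f (a k) + normc (a k)) -
     \sum_(k < N) normc (a k))); first exact: cvgB.
  by apply/funext => N; rewrite big_split /= addrK.
have [x hx] := real _ normc_Re; have [y hy] := real _ normc_Im.
exists (x +i* y); apply: ReIm_ccvg => /=.
  by under [X in X @ _ --> _]funext do rewrite /= Re_sum.
by under [X in X @ _ --> _]funext do rewrite /= Im_sum.
Qed.

End ComplexBasics.

(** * Complex derivatives and power series *)

Section ComplexDerivative.
Variable R : realType.
Local Notation C := R[i].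
Local Notation Re := (@complex.Re R).
Local Notation Im := (@complex.Im R).

Lemma cexp0 : cexp (0 : C) = 1.
Proof. by rewrite /cexp /= expR0 cos0 sin0 mulr0 mulr1. Qed.

Lemma cexpD (z w : C) : cexp (z + w) = cexp z * cexp w.
Proof.
by apply: eqC; rewrite ?ReM ?ImM /cexp /= ReD ImD expRD ?cosD ?sinD; ring.
Qed.

Lemma normc_cexp (z : C) : normc (cexp z) = expR (Re z).
Proof.
rewrite /cexp /= !exprMn -mulrDr cos2Dsin2 mulr1 sqrtr_sqr ger0_norm ?expR_ge0//.
Qed.

Lemma cexp_neq0 (z : C) : cexp z != 0.
Proof. by rewrite -normc_gt0 normc_cexp expR_gt0. Qed.

Lemma cexpN (z : C) : cexp (- z) = (cexp z)^-1.
Proof. by apply: (mulfI (cexp_neq0 z)); rewrite -cexpD subrr cexp0 mulfV ?cexp_neq0. Qed.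

Lemma cexp_conj (z : C) : cexp (conjc z) = conjc (cexp z).
Proof. by case: z => a b; rewrite /cexp /= cosN sinN mulrN. Qed.

(* Unlike bare complex differentiability, a quadratic remainder passes through
   termwise estimates of power series. *)
Definition sderiv (f : C -> C) (z l : C) := exists K d : R, [/\ 0 <= K, 0 < d &
  forall h, normc h <= d -> normc (f (z + h) - f z - l * h) <= K * normc h ^+ 2].

Lemma sderiv_cst (c z : C) : sderiv (fun=> c) z 0.
Proof.
exists 0, 1; split=> // h _; rewrite subrr mul0r subrr normc0 mul0r //.
Qed.

Lemma sderiv_id (z : C) : sderiv (fun w => w) z 1.
Proof.
exists 0, 1; split=> // h _; rewrite mul1r (_ : _ - _ - _ = 0) ?normc0 ?mul0r //; ring.
Qed.

Lemma sderiv_eq f z l m : sderiv f z l -> l = m -> sderiv f z m.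
Proof. by move=> + <-. Qed.

Lemma sderivD f g z l m : sderiv f z l -> sderiv g z m ->
  sderiv (fun w => f w + g w) z (l + m).
Proof.
move=> [K1 [d1 [K10 d10 h1]]] [K2 [d2 [K20 d20 h2]]].
exists (K1 + K2), (Num.min d1 d2); split; [exact: addr_ge0|by rewrite lt_min d10|].
move=> h; rewrite le_min => /andP[/h1 hf /h2 hg].
rewrite (_ : _ - _ - _ = (f (z + h) - f z - l * h) + (g (z + h) - g z - m * h)); last by ring.
by rewrite (le_trans (normcD _ _))// mulrDl lerD.
Qed.

Lemma sderiv_lip f z l : sderiv f z l -> exists K d : R, [/\ 0 < K, 0 < d &
  forall h, normc h <= d -> normc (f (z + h) - f z) <= K * normc h].
Proof.
move=> [K [d [K0 d0 hf]]]; exists (K * d + normc l + 1), d; split=> //.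
  by rewrite ltr_wpDl// addr_ge0 ?normc_ge0// mulr_ge0// ltW.
move=> h hd; rewrite -[f _ - f z](subrK (l * h)) (le_trans (normcD _ _))//.
rewrite normcM (_ : (K * d + normc l + 1) * normc h = K * d * normc h + (normc l * normc h + normc h)); last by ring.
rewrite lerD//; last by rewrite lerDl normc_ge0.
rewrite (le_trans (hf _ hd))// expr2 mulrA ler_wpM2r ?normc_ge0//.
exact: ler_wpM2l.
Qed.

Lemma sderivM f g z l m : sderiv f z l -> sderiv g z m ->
  sderiv (fun w => f w * g w) z (l * g z + f z * m).
Proof.
move=> sf sg.
have [L1 [e1 [L10 e10 hl1]]] := sderiv_lip sf.
have [L2 [e2 [L20 e20 hl2]]] := sderiv_lip sg.
move: sf sg => [K1 [d1 [K10 d10 h1]]] [K2 [d2 [K20 d20 h2]]].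
exists (K1 * normc (g z) + normc (f z) * K2 + L1 * L2).
exists (Num.min (Num.min d1 d2) (Num.min e1 e2)); split.
- by rewrite !addr_ge0// mulr_ge0 ?normc_ge0// ltW.
- by rewrite !lt_min d10 d20 e10.
move=> h; rewrite !le_min => /andP[/andP[/h1 hf /h2 hg] /andP[/hl1 hf' /hl2 hg']].
rewrite (_ : _ - _ - _ = (f (z + h) - f z - l * h) * g z +
  (f z * (g (z + h) - g z - m * h) + (f (z + h) - f z) * (g (z + h) - g z))); last by ring.
rewrite (le_trans (normcD _ _))// [leRHS]mulrDl [X in _ <= X + _]mulrDl -[leRHS]addrA lerD//.
  by rewrite normcM mulrAC ler_wpM2r ?normc_ge0.
rewrite (le_trans (normcD _ _))// lerD//.
  by rewrite normcM -mulrA ler_wpM2l ?normc_ge0.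
by rewrite normcM expr2 mulrACA ler_pM ?normc_ge0.
Qed.

Lemma sderiv_comp f g z l m : sderiv g z m -> sderiv f (g z) l ->
  sderiv (fun w => f (g w)) z (l * m).
Proof.
move=> sg; have [L [e [L0 e0 hl]]] := sderiv_lip sg.
move: sg => [K1 [d1 [K10 d10 h1]]] [K2 [d2 [K20 d20 h2]]].
exists (K2 * L ^+ 2 + normc l * K1), (Num.min (Num.min d1 e) (d2 / L)); split.
- by rewrite addr_ge0// mulr_ge0 ?normc_ge0 ?sqr_ge0.
- by rewrite !lt_min d10 e0 divr_gt0.
move=> h; rewrite !le_min => /andP[/andP[/h1 hg /hl hg']].
rewrite ler_pdivlMr// mulrC => hd.
have /h2 := le_trans hg' hd.
rewrite (addrC (g z)) subrK => hf.
rewrite (_ : _ - _ - _ = (f (g (z + h)) - f (g z) - l * (g (z + h) - g z)) +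
   l * (g (z + h) - g z - m * h)); last by ring.
rewrite (le_trans (normcD _ _))// mulrDl lerD//.
  rewrite (le_trans hf)// -mulrA ler_wpM2l// -exprMn lerXn2r// nnegrE ?mulr_ge0 ?normc_ge0//.
  exact: ltW.
by rewrite normcM -mulrA ler_wpM2l ?normc_ge0.
Qed.

Lemma normC_normc (z : C) : `|z| = (normc z)%:C.
Proof. by case: z. Qed.

Lemma sderiv_derivable f z l : sderiv f z l -> derivable (f : C^o -> C^o) z 1.
Proof.
move=> [K [d [K0 d0 hf]]]; apply/cvg_ex; exists l; apply/cvgrPdist_le => /= e e0.
have eE : e = (Re e)%:C by rewrite RRe_real// gtr0_real.
have e0' : 0 < Re e by rewrite -ltcR -eE.
near=> h.
have h0 : h != 0 by near: h; exact: (nbhs_dnbhs_neq (0 : C^o)).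
rewrite /GRing.scale /= mulr1 (addrC h z).
rewrite (_ : l - _ = - (h^-1 * (f (z + h) - f z - l * h))); last by field.
rewrite normC_normc normcN normcM normcV.
rewrite eE lecR mulrC ler_pdivrMr ?normc_gt0//.
have hd : normc h <= d.
  rewrite -lecR -normC_normc; near: h; apply: (@dnbhs0_le _ C^o); rewrite ltcR //.
rewrite (le_trans (hf _ hd))// expr2 mulrA ler_wpM2r ?normc_ge0//.
have : normc h <= Re e / (K + 1).
  rewrite -lecR -normC_normc; near: h; apply: (@dnbhs0_le _ C^o); rewrite ltcR divr_gt0//; lra.
rewrite ler_pdivlMr; last lra.
have := normc_ge0 h; nra.
Unshelve. all: by end_near. Qed.

(** Along the ray [x * z] with [x] real, each coordinate of [f] is a real function with zero
    derivative; compare [x = 0] and [x = 1]. *)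
Lemma sderiv0_cst f : (forall z, sderiv f z 0) -> forall z, f z = f 0.
Proof.
move=> f0 z.
have H (p : C -> R) : (forall a b, p (a - b) = p a - p b) -> (forall a, `|p a| <= normc a) ->
    p (f z) = p (f 0).
  move=> pB pn.
  pose u (x : R) : R := p (f (x%:C * z)).
  have du (x : R) : is_derive x (1 : R) u 0.
    have [K [d [K0 d0 hf]]] := f0 (x%:C * z).
    have uE h : `|h| * normc z <= d -> `|u (h + x) - u x| <= K * normc z ^+ 2 * `|h| ^+ 2.
      move=> hd; rewrite /u -pB (le_trans (pn _))//.
      have := hf (h%:C * z); rewrite normcM normcR => /(_ hd).
      rewrite (mul0r (h%:C * z)) subr0 -mulrDl -rmorphD (addrC x) /= => /le_trans; apply.
      by rewrite le_eqVlt; apply/orP; left; apply/eqP; ring.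
    have cu : h^-1 *: (u (h *: (1 : R) + x) - u x) @[h --> (0:R)^'] --> (0 : R).
      apply/cvgr0Pnorm_le => e e0; near=> h.
      have h0 : h != 0 by near: h; exact: nbhs_dnbhs_neq.
      rewrite /GRing.scale /= mulr1 normrM normfV mulrC ler_pdivrMr ?normr_gt0//.
      have hd : `|h| <= d / (normc z + 1).
        near: h; apply: dnbhs0_le; rewrite divr_gt0//; have := normc_ge0 z; lra.
      have hd' : `|h| * normc z <= d.
        move: hd; rewrite ler_pdivlMr; last by have := normc_ge0 z; lra.
        have := normr_ge0 h; nra.
      rewrite (le_trans (uE _ hd'))// (expr2 `|h|) mulrA ler_wpM2r//.
      have : `|h| <= e / (K * normc z ^+ 2 + 1).
        near: h; apply: dnbhs0_le; by rewrite divr_gt0// ltr_wpDl// mulr_ge0// sqr_ge0.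
      rewrite ler_pdivlMr; last by rewrite ltr_wpDl// mulr_ge0// sqr_ge0.
      have := normr_ge0 h; nra.
    split; first by apply/cvg_ex; exists 0.
    by apply/cvg_lim.
  by have := is_derive_0_is_cst 1 0 du; rewrite /u mul1r mul0r.
by apply: eqC; [apply: (H Re) => [a b|a]|apply: (H Im) => [a b|a]];
  rewrite ?ReD ?ReN ?ImD ?ImN ?normc_Re ?normc_Im.
Unshelve. all: by end_near. Qed.

End ComplexDerivative.

(** * Everywhere convergent power series and Hermite coefficients *)

Section PowerSeries.
Variable R : realType.
Local Notation C := R[i].

Lemma normr_sin_le (x : R) : `|sin x| <= `|x|.
Proof.
wlog x0 : x / 0 <= x.
  move=> H; have [|x0] := leP 0 x; first exact: H.
  by rewrite -(opprK x) sinN normrN (normrN (- x)); apply: H; lra.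
have [c _] := @MVT_segment R (fun x => sin x) (fun x => cos x) 0 x x0
   (fun x _ => is_derive_sin x) (continuous_subspaceT (@continuous_sin R)).
rewrite sin0 !subr0 => ->; rewrite normrM ler_piMl//.
exact: cos_max.
Qed.

Lemma cos_quad (x : R) : `|cos x - 1| <= x ^+ 2.
Proof.
rewrite (_ : cos x - 1 = - (2 * sin (x / 2) ^+ 2)); last first.
  have -> : cos x = cos (x / 2 + x / 2) by congr cos; lra.
  by rewrite cosD; have := cos2Dsin2 (x / 2); lra.
rewrite normrN ger0_norm; last by rewrite mulr_ge0// sqr_ge0.
have := normr_sin_le (x / 2); rewrite -(@ler_pXn2r _ 2%N) ?nnegrE//.
rewrite !real_normK ?num_real// exprMn; have := sqr_ge0 x.
lra.
Qed.

Lemma sin_quad (x : R) : `|x| <= 1 -> `|sin x - x| <= x ^+ 2.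
Proof.
wlog x0 : x / 0 <= x.
  move=> H; have [|x0] := leP 0 x; first exact: H.
  by move=> x1; have := H (- x); rewrite sinN -opprD !normrN sqrrN; apply => //; lra.
rewrite ger0_norm// => x1.
have d (y : R) : is_derive y (1:R) (fun y => sin y - y) (cos y - 1).
  by apply: is_deriveB.
have [c /andP[c0 cx]] := @MVT_segment R (fun x => sin x - x) (fun x => cos x - 1) 0 x x0
   (fun x _ => d x) (derivable_within_continuous (fun x _ => @ex_derive _ _ _ _ _ _ _ (d x))).
rewrite sin0 !subr0 => ->; rewrite normrM (ger0_norm x0) expr2 ler_wpM2r//.
rewrite (le_trans (cos_quad _))//.
move: c0 cx; rewrite !bnd_simp => c0 cx; nra.
Qed.

Lemma expR_quad (x : R) : `|x| <= 2^-1 -> `|expR x - 1 - x| <= 2 * x ^+ 2.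
Proof.
move=> /ler_normlP[x1 x2].
have h1 := expR_ge1Dx x; have h2 := expR_ge1Dx (- x).
rewrite ger0_norm; last lra.
have h3 : expR x * (1 - x) <= 1.
  by rewrite -[leRHS](expRxMexpNx_1 x) ler_wpM2l ?expR_ge0.
have := expR_ge0 x; nra.
Qed.

Lemma sderiv_cexp (z : C) : sderiv (@cexp R) z (cexp z).
Proof.
have Nz := normc_ge0 (cexp z).
(* With [h = a + i b], the real part of the remainder costs [2 a^2 + 2 b^2] and the imaginary part
   [a^2 + 3 b^2], so the factor 10 is ample. The radius [1/2] is that of [expR_quad]. *)
exists (normc (cexp z) * 10), 2^-1; split; [by rewrite mulr_ge0//|by rewrite invr_gt0|move=> h hd].
rewrite cexpD (_ : _ - _ - _ = cexp z * (cexp h - 1 - h)); last by ring.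
rewrite normcM -mulrA ler_wpM2l// (le_trans (normc_le_ReIm _))//.
move: hd; have := normc_Re h; have := normc_Im h; have := sqr_normcE h; case: h => a b.
set n := normc _; rewrite /cexp /= => n2 bn an nd.
have ha := @expR_quad a (le_trans an nd).
have hb := cos_quad b.
have hs : `|sin b - b| <= b ^+ 2 by apply: sin_quad; apply: (le_trans bn); lra.
rewrite oppr0 addr0.
have e2 : expR a <= 2.
  have := expR_ge1Dx (- a); rewrite expRN => h.
  have := expR_gt0 a; have := @divff _ (expR a).
  have : expR a * (expR a)^-1 = 1 by rewrite divff// gt_eqF// expR_gt0.
  move: h an nd => + /ler_normlP[_ ?] ? ? _ ?; nra.
have e0 := expR_ge0 a.
rewrite (_ : expR a * cos b - 1 - a = expR a * (cos b - 1) + (expR a - 1 - a)); last by ring.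
rewrite (_ : expR a * sin b - b = expR a * (sin b - b) + (expR a - 1) * b); last by ring.
have h1 : `|expR a * (cos b - 1)| <= 2 * b ^+ 2.
  by rewrite normrM ger0_norm// ler_pM.
have h2 : `|expR a * (sin b - b)| <= 2 * b ^+ 2.
  by rewrite normrM ger0_norm// ler_pM.
have h3 : `|expR a - 1| <= 2 * `|a|.
  rewrite -(subrK a (expR a - 1)) (le_trans (ler_normD _ _))//.
  have : 2 * a ^+ 2 <= `|a|.
    rewrite -(real_normK (num_real a)); have := normr_ge0 a; nra.
  lra.
have h4 : `|(expR a - 1) * b| <= a ^+ 2 + b ^+ 2.
  rewrite normrM (le_trans (ler_wpM2r (normr_ge0 b) h3))//.
  rewrite -(real_normK (num_real a)) -(real_normK (num_real b)).
  have := sqr_ge0 (`|a| - `|b|); nra.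
rewrite n2 (le_trans (lerD (ler_normD _ _) (ler_normD _ _)))//.
nra.
Qed.

Definition pser (c : nat -> C) (f : C -> C) :=
  forall z, ccvg (fun N => \sum_(k < N) c k * z ^+ k) (f z).

(** A majorant on the whole half-line: it yields absolute convergence, the growth bound and,
    shifted, the bound for the derived series. *)
Definition abs_pser_le (c : nat -> C) (E : R -> R) :=
  forall x, 0 <= x -> forall N, \sum_(k < N) normc (c k) * x ^+ k <= E x.

Definition dcoef (c : nat -> C) k := k.+1%:R * c k.+1.

Lemma pser_exists c E : abs_pser_le c E -> exists f, pser c f.
Proof.
move=> cE.
suff /choice[f fP] : forall z, exists l, ccvg (fun N => \sum_(k < N) c k * z ^+ k) l by exists f.
move=> z.
apply: (@abs_sum_cvg _ (fun k => c k * z ^+ k) (E (normc z))) => N.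
rewrite (le_trans _ (cE _ (normc_ge0 z) N))// le_eqVlt; apply/orP; left; apply/eqP.
by apply: eq_bigr => k _; rewrite normcM normcX.
Qed.

Lemma pser_norm_le c f E z : abs_pser_le c E -> pser c f -> normc (f z) <= E (normc z).
Proof.
move=> cE cf; apply: (ccvg_le (cf z)) => N.
rewrite (le_trans (normc_sum _ _))// (le_trans _ (cE _ (normc_ge0 z) N))//.
by apply: ler_sum => k _; rewrite normcM normcX.
Qed.

Lemma natr_expr_le (x : R) k : 0 <= x -> k.+1%:R * x ^+ k <= (x + 1) ^+ k.+1.
Proof.
move=> x0; elim: k => [|k ih]; first by rewrite expr0 expr1; lra.
have h1 : x ^+ k.+1 <= (x + 1) ^+ k.+1 by rewrite lerXn2r ?nnegrE ?addr_ge0//; lra.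
have h2 : k.+1%:R * x ^+ k.+1 <= x * (x + 1) ^+ k.+1.
  by rewrite exprS mulrCA ler_wpM2l.
by rewrite -natr1 (exprS (x + 1)); lra.
Qed.

(** The factor [k + 1] from differentiation is paid by moving the radius to [x + 1], since
    [(x + 1)^(k + 1)] dominates [(k + 1) x^k]. *)
Lemma abs_pser_le_dcoef c E : abs_pser_le c E ->
  abs_pser_le (dcoef c) (fun x => E (x + 1)).
Proof.
move=> cE x x0 N.
have x10 : 0 <= x + 1 by lra.
rewrite (le_trans _ (cE _ x10 N.+1))// big_ord_recl /= ler_wpDl ?mulr_ge0 ?normc_ge0//.
apply: ler_sum => k _; rewrite /dcoef normcM normc_nat mulrAC mulrC ler_wpM2l ?normc_ge0//.
exact: natr_expr_le.
Qed.

(** In the induction [|z + h|] takes one unit of the 2 in [|z| + 2], and the new cross term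
    [n z^(n-1) h^2] takes the other. *)
Lemma normc_expr_quad (z h : C) n : normc h <= 1 ->
  normc ((z + h) ^+ n - z ^+ n - n%:R * z ^+ n.-1 * h) <= normc h ^+ 2 * (normc z + 2) ^+ n.
Proof.
move=> h1; have z0 := normc_ge0 z; have h0 := normc_ge0 h.
elim: n => [|n ih].
  by rewrite !expr0 mul0r mul0r subrr subr0 normc0 mulr1 sqr_ge0.
rewrite (_ : _ - _ - _ = (z + h) * ((z + h) ^+ n - z ^+ n - n%:R * z ^+ n.-1 * h)
   + n%:R * z ^+ n.-1 * h ^+ 2); last first.
  case: n {ih} => [|n]; rewrite /= ?exprS ?expr0 -?natr1; ring.
rewrite (le_trans (normcD _ _))// normcM [X in _ + X]normcM [X in _ + X * _]normcM !normcX normc_nat.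
have e1 : normc (z + h) <= normc z + 1 by rewrite (le_trans (normcD _ _))// lerD2l.
have e2 : n%:R * normc z ^+ n.-1 <= (normc z + 2) ^+ n.
  case: n {ih} => [|n] /=; first by rewrite mul0r expr0.
  by rewrite (le_trans (natr_expr_le n z0))// lerXn2r ?nnegrE//; lra.
have e3 := ler_pM (normc_ge0 _) (normc_ge0 _) e1 ih.
have e4 := ler_wpM2r (sqr_ge0 (normc h)) e2.
rewrite (le_trans (lerD e3 e4))// (exprS (normc z + 2)) le_eqVlt; apply/orP; left; apply/eqP; ring.
Qed.

Lemma sderiv_pser c f g E z : abs_pser_le c E -> pser c f -> pser (dcoef c) g ->
  sderiv f z (g z).
Proof.
move=> cE cf cg; have z20 : 0 <= normc z + 2 by have := normc_ge0 z; lra.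
exists (E (normc z + 2)), 1; split=> //.
  by rewrite (le_trans _ (cE _ z20 0%N))// big_ord0.
move=> h h1.
(* The remainder is bounded termwise at every truncation, then in the limit. Terms of [f] up to
   degree [N] match terms of the derived series up to degree [N - 1]. *)
apply: (@ccvg_le _ (fun N => \sum_(k < N.+1) c k * ((z + h) ^+ k - z ^+ k - k%:R * z ^+ k.-1 * h))).
  apply: (@ccvg_eq _ (fun N => \sum_(k < N.+1) c k * (z + h) ^+ k +
    (-1 * (\sum_(k < N.+1) c k * z ^+ k) + - h * (\sum_(k < N) dcoef c k * z ^+ k)))).
    move=> N; rewrite mulN1r [X in - h * X](_ : _ = \sum_(k < N.+1) c k * (k%:R * z ^+ k.-1)).
      rewrite mulr_sumr -sumrN -!big_split /=.
      by apply: eq_bigr => k _; ring.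
    rewrite [RHS]big_ord_recl /= mul0r mulr0 add0r.
    by apply: eq_bigr => k _; rewrite /dcoef /bump /= add1n add0n; ring.
  rewrite (_ : f (z + h) - _ - _ = f (z + h) + (-1 * f z + - h * g z)); last by ring.
  apply: ccvgD; first exact: ccvgS (cf _).
  by apply: ccvgD; apply: ccvgZ; [exact: ccvgS (cf _)|exact: cg].
move=> N; rewrite (le_trans (normc_sum _ _))// mulrC.
rewrite (le_trans _ (ler_wpM2l (sqr_ge0 _) (cE _ z20 N.+1)))// mulr_sumr.
apply: ler_sum => k _; rewrite normcM mulrCA ler_wpM2l ?normc_ge0//.
exact: normc_expr_quad.
Qed.

(* Normalised by the generating function
   [\sum_n herm p r n * x ^+ n / n`! = exp (p * x + r * x ^+ 2 / 2)]. *)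
Fixpoint herm {T : pzRingType} (p r : T) n : T :=
  if n is n1.+1 then
    p * herm p r n1 + (if n1 is n2.+1 then r * n1%:R * herm p r n2 else 0)
  else 1.

Lemma herm1 (T : pzRingType) (p r : T) : herm p r 1 = p.
Proof. by rewrite /= mulr1 addr0. Qed.

Lemma hermSS (T : pzRingType) (p r : T) n :
  herm p r n.+2 = p * herm p r n.+1 + r * n.+1%:R * herm p r n.
Proof. by []. Qed.

Lemma nat_ind2 (P : nat -> Prop) : P 0%N -> P 1%N ->
  (forall n, P n -> P n.+1 -> P n.+2) -> forall n, P n.
Proof.
move=> P0 P1 PS n; suff : P n /\ P n.+1 by case.
by elim: n => [|n [? ?]]; split => //; exact: PS.
Qed.

Lemma normc_herm (p r : C) n : normc (herm p r n) <= herm (normc p) (normc r) n.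
Proof.
elim/nat_ind2 : n => [||n h1 h2]; rewrite ?herm1 ?normc1// !hermSS.
rewrite (le_trans (normcD _ _))// !normcM normc_nat.
by rewrite lerD// ler_wpM2l// ?mulr_ge0 ?normc_ge0.
Qed.

Definition hcoef {T : fieldType} (p r : T) n : T := herm p r n / n`!%:R.

Lemma hcoef0 (T : fieldType) (p r : T) : hcoef p r 0 = 1.
Proof. by rewrite /hcoef fact0 divr1. Qed.

Lemma hcoef1 (T : fieldType) (p r : T) : hcoef p r 1 = p.
Proof. by rewrite /hcoef factS fact0 muln1 divr1 herm1. Qed.

Lemma hcoefSS (T : numFieldType) (p r : T) n :
  n.+2%:R * hcoef p r n.+2 = p * hcoef p r n.+1 + r * hcoef p r n.
Proof.
rewrite /hcoef hermSS !factS !natrM.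
have : n.+2%:R != 0 :> T by rewrite pnatr_eq0.
have : n.+1%:R != 0 :> T by rewrite pnatr_eq0.
have : n`!%:R != 0 :> T by rewrite pnatr_eq0 -lt0n fact_gt0.
move: n.+2%:R n.+1%:R n`!%:R => a b c c0 b0 a0.
by field; rewrite a0 b0 c0.
Qed.

Lemma herm_ge0 (p r : R) n : 0 <= p -> 0 <= r -> 0 <= herm p r n.
Proof.
move=> p0 r0; elim/nat_ind2 : n => [||n h1 h2]; rewrite ?herm1 ?ler01// hermSS.
by rewrite addr_ge0// !mulr_ge0.
Qed.

Lemma hcoef_ge0 (p r : R) n : 0 <= p -> 0 <= r -> 0 <= hcoef p r n.
Proof. by move=> p0 r0; rewrite divr_ge0// herm_ge0. Qed.

Lemma normc_hcoef (p r : C) n : normc (hcoef p r n) <= hcoef (normc p) (normc r) n.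
Proof.
by rewrite /hcoef normcM normcV normc_nat ler_wpM2r ?invr_ge0// normc_herm.
Qed.

End PowerSeries.

(** * The Hermite generating function *)

Section HermiteGenerating.
Variable R : realType.
Local Notation C := R[i].

(** The truncated form of [S' = (p + r x) S]; the sum multiplied by [r x] is one term shorter, which
    is the whole truncation error. *)
Lemma dcoef_hcoef_sum (T : numFieldType) (p r x : T) N :
  \sum_(k < N.+1) k.+1%:R * hcoef p r k.+1 * x ^+ k =
  p * (\sum_(k < N.+1) hcoef p r k * x ^+ k) + r * x * (\sum_(k < N) hcoef p r k * x ^+ k).
Proof.
elim: N => [|N ih].
  by rewrite big_ord0 !big_ord1 /= !expr0 hcoef0 hcoef1; ring.
by rewrite big_ord_recr /= ih hcoefSS [in RHS]big_ord_recr /= [X in _ = _ + _ * X]big_ord_recr /= exprS; ring.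
Qed.

(** Gronwall's argument: the terms missing from the truncated equation are non-negative, so
    [S' <= (p + r x) S], and [S] divided by the exponential does not exceed its value 1 at 0. *)
Lemma hcoef_sum_le (p r x : R) N : 0 <= p -> 0 <= r -> 0 <= x ->
  \sum_(k < N) hcoef p r k * x ^+ k <= expR (p * x + r * x ^+ 2 / 2).
Proof.
move=> p0 r0 x0.
pose S N (x : R) := \sum_(k < N) hcoef p r k * x ^+ k.
have ndS y M : 0 <= y -> S M y <= S M.+1 y.
  by move=> y0; rewrite /S big_ord_recr /= lerDl mulr_ge0 ?exprn_ge0 ?hcoef_ge0.
(* Two more terms give degree at least one, the range of [dcoef_hcoef_sum]. *)
apply: (@le_trans _ _ (S N.+2 x)); first by rewrite (le_trans (ndS _ N x0))// ndS.
pose u y := S N.+2 y * expR (- (p * y + r * y ^+ 2 / 2)).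
pose dS y := \sum_(k < N.+1) k.+1%:R * hcoef p r k.+1 * y ^+ k.
have dSE y : is_derive y (1:R) (S N.+2) (dS y).
  rewrite (_ : S N.+2 = \sum_(k < N.+2) (fun y => hcoef p r k * y ^+ k)); last first.
    by apply/funext => z; rewrite fct_sumE.
  rewrite (_ : dS y = \sum_(k < N.+2) hcoef p r k * (k%:R * y ^+ k.-1)).
    apply: is_derive_sum => k.
    rewrite (_ : (fun _ => _) = hcoef p r k *: ((@id R) ^+ k)); last first.
      by apply/funext => z; rewrite /GRing.scale /= exprfctE.
    apply: is_derive_eq.
    by rewrite /GRing.scale /= !mulr1.
  rewrite [RHS]big_ord_recl /= mul0r mulr0 add0r /dS.
  by apply: eq_bigr => k _; rewrite /bump /= add1n add0n; ring.
have duE y : is_derive y (1:R) u ((dS y - (p + r * y) * S N.+2 y) * expR (- (p * y + r * y ^+ 2 / 2))).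
  rewrite /u; apply: is_derive_eq.
  have sE (a b : R) : a *: b = a * b by [].
  by rewrite !sE; field.
have [c /andP[c0 _]] := @MVT_segment R u _ 0 x x0
   (fun x _ => duE x) (derivable_within_continuous (fun x _ => @ex_derive _ _ _ _ _ _ _ (duE x))).
move: c0; rewrite bnd_simp subr0 => c0 uE.
have : u x <= u 0.
  rewrite -subr_le0 uE mulr_le0_ge0// mulr_le0_ge0 ?expR_ge0// subr_le0.
  rewrite /dS dcoef_hcoef_sum mulrDl lerD// ler_wpM2l ?mulr_ge0//; first exact: ndS.
  exact: le_trans (ndS _ N _) (ndS _ N.+1 _).
rewrite /u !expRN ler_pdivrMr ?expR_gt0// => /le_trans; apply.
rewrite !mulr0 expr0n /= mulr0 mul0r addr0 expR0 invr1 mulr1 ler_piMl ?expR_ge0//.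
rewrite /S big_ord_recl /= hcoef0 expr0 mulr1 big1 ?addr0// => i _.
by rewrite expr0n /= mulr0.
Qed.

Lemma abs_pser_le_hcoef (p r : C) :
  abs_pser_le (hcoef p r) (fun x => expR (normc p * x + normc r * x ^+ 2 / 2)).
Proof.
move=> x x0 N; apply: le_trans (hcoef_sum_le N (normc_ge0 p) (normc_ge0 r) x0).
by apply: ler_sum => k _; rewrite ler_wpM2r ?exprn_ge0// normc_hcoef.
Qed.

Lemma sderiv_poly2 (p r z : C) :
  sderiv (fun z => p * z + r * z ^+ 2 / 2) z (p + r * z).
Proof.
have -> : (fun z : C => p * z + r * z ^+ 2 / 2) = (fun z => p * z + (r / 2) * (z * z)).
  by apply/funext => w; rewrite expr2; ring.
apply: sderiv_eq; first exact: sderivD (sderivM (sderiv_cst p z) (sderiv_id z))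
  (sderivM (sderiv_cst (r / 2) z) (sderivM (sderiv_id z) (sderiv_id z))).
by rewrite /=; field.
Qed.

(** The sum [F] solves [F' = (p + r z) F] with [F 0 = 1], so its product [h] with the inverse
    exponential has zero derivative. *)
Lemma pser_hcoef (p r : C) :
  pser (hcoef p r) (fun z => cexp (p * z + r * z ^+ 2 / 2)).
Proof.
have [F hF] := pser_exists (abs_pser_le_hcoef p r).
suff FE : forall z, F z = cexp (p * z + r * z ^+ 2 / 2) by move=> z; rewrite -FE.
have dF : pser (dcoef (hcoef p r)) (fun z => p * F z + r * z * F z).
  move=> z; apply: ccvg_shiftS.
  apply: (@ccvg_eq _ (fun N => p * (\sum_(k < N.+1) hcoef p r k * z ^+ k) +
     r * z * (\sum_(k < N) hcoef p r k * z ^+ k))).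
    by move=> N; rewrite -dcoef_hcoef_sum.
  by apply: ccvgD; apply: ccvgZ; [exact: ccvgS (hF z)|exact: hF].
have sF z : sderiv F z (p * F z + r * z * F z).
  exact: (sderiv_pser z (abs_pser_le_hcoef p r) hF dF).
have F0 : F 0 = 1.
  apply: (ccvg_unique (hF 0)); apply: ccvg_shiftS.
  apply: ccvg_eq (ccvg_cst 1) => N.
  rewrite big_ord_recl /= hcoef0 expr0 mulr1 big1 ?addr0// => i _.
  by rewrite expr0n /= mulr0.
pose h z := F z * cexp (- p * z + - r * z ^+ 2 / 2).
have h0 z : sderiv h z 0.
  apply: sderiv_eq.
    apply: sderivM (sF z) (sderiv_comp (f := @cexp R) _ _).
      exact: sderiv_poly2.
    exact: sderiv_cexp.
  by rewrite /=; ring.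
move=> z; have := sderiv0_cst h0 z; rewrite /h F0 !mulr0 expr0n /= mulr0 mul0r addr0 cexp0 mul1r.
rewrite (_ : - p * z + _ = - (p * z + r * z ^+ 2 / 2)); last by ring.
rewrite cexpN => /(congr1 ( *%R^~ (cexp (p * z + r * z ^+ 2 / 2)))).
by rewrite mulfVK ?cexp_neq0// mul1r.
Qed.

End HermiteGenerating.

(** * Gaussian integrals on the plane *)

Section Measurability.
Variable R : realType.
Local Notation C := R[i].
Local Notation Re := (@complex.Re R).
Local Notation Im := (@complex.Im R).
Local Notation mR := (measurableTypeR R).

Definition pt (w : R * R) : C := w.1 +i* w.2.

Definition cmeas (f : C -> C) :=
  measurable_fun [set: mR * mR] (fun w => Re (f (pt w))) /\
  measurable_fun [set: mR * mR] (fun w => Im (f (pt w))).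

Definition ccont (f : C -> C) := forall z e, 0 < e -> exists2 d, 0 < d &
  forall h, normc h <= d -> normc (f (z + h) - f z) <= e.

Lemma entire_ccont (f : C -> C) : entire f -> ccont f.
Proof.
move=> ef z e e0.
have /derivable1_diffP/differentiable_continuous cf := ef z.
have eC : 0 < e%:C by rewrite ltcR.
move/cvgrPdist_le : cf => /(_ _ eC) /=.
rewrite nearE => -[d /= d0 hd].
have dE : d = (Re d)%:C by rewrite RRe_real// gtr0_real.
have d0' : 0 < Re d by rewrite -ltcR -dE.
exists (Re d / 2); first by rewrite divr_gt0.
move=> h hh; have := hd (z + h); rewrite /= opprD addNKr normrN.
rewrite {1}normC_normc {1}dE ltcR => H.
have /H : normc h < Re d by lra.
by rewrite normC_normc lecR -normcN opprB.
Qed.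

Lemma ccont_seq (f : C -> C) u l : ccont f -> ccvg u l -> ccvg (fun n => f (u n)) (f l).
Proof.
move=> cf ul; apply/cvgr0Pnorm_le => e e0.
have [d d0 hd] := cf l e e0.
move/cvgr0Pnorm_le : ul => /(_ _ d0); apply: filterS => n.
rewrite !ger0_norm ?normc_ge0// => h.
by have := hd _ h; rewrite (addrC l) subrK.
Qed.

(* A function of two variables continuous in the first and measurable in the second
   is the limit of its discretisations in the first variable. *)
Definition grid (n : nat) (k : int) : R := k%:~R / n.+1%:R.

Definition snap (n : nat) (x : R) : R := grid n (Num.floor (x * n.+1%:R)).

Lemma snap_dist n x : `|snap n x - x| <= n.+1%:R^-1.
Proof.
have n0 : 0 < n.+1%:R :> R by [].
rewrite /snap /grid; set m := Num.floor _.
have /andP[] := floor_itv (x * n.+1%:R); rewrite -/m intrD => h1 h2.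
rewrite -(ler_pM2r n0) -[X in _ * X <= _](ger0_norm (ltW n0)) -normrM mulrBl mulVf ?gt_eqF//.
by rewrite divfK ?gt_eqF// ler_norml; apply/andP; split; lra.
Qed.

Lemma snap_cvg x : snap ^~ x @ \oo --> x.
Proof.
apply/subr_cvg0/norm_cvg0P.
apply: (squeeze_cvgr (f := cst 0) (h := fun n => n.+1%:R^-1)); last exact: cvg_harmonic.
  by apply: nearW => n; rewrite normr_ge0 snap_dist.
exact: cvg_cst.
Qed.

Lemma measurable_snap (g : R -> R -> R) n :
  (forall x, measurable_fun [set: mR] (g x)) ->
  measurable_fun [set: mR * mR] (fun w => g (snap n w.1) w.2).
Proof.
move=> mg _ Y mY; rewrite setTI.
(* On each strip where the floor equals [k] the first variable is frozen at a grid point, so the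
   preimage is a countable union of rectangles. *)
rewrite (_ : _ @^-1` _ = \bigcup_(k : int)
  ([set x | Num.floor (x * n.+1%:R) = k] `*` (g (grid n k) @^-1` Y))); last first.
  apply/seteqP; split => [[x y] /= Yx|[x y] [k _] /= [<-]//].
  by exists (Num.floor (x * n.+1%:R)).
apply: countable_bigcupT_measurable => // k; apply: measurableX; last first.
  by rewrite -[X in measurable X]setTI; exact: mg.
rewrite (_ : [set x | _] = `[grid n k, grid n (k + 1)[%classic); first exact: measurable_itv.
have n0 : 0 < n.+1%:R :> R by [].
apply/seteqP; split => x /=; rewrite in_itv /= /grid ler_pdivrMr// ltr_pdivlMr//.
  by move=> <-; exact: floor_itv.
exact: floor_def.
Qed.

Lemma measurable_separately (g : R -> R -> R) :
  (forall x, measurable_fun [set: mR] (g x)) ->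
  (forall x y, g (snap n x) y @[n --> \oo] --> g x y) ->
  measurable_fun [set: mR * mR] (fun w => g w.1 w.2).
Proof.
move=> mg cg; apply: measurable_fun_cvg (fun n => measurable_snap n mg) _.
by move=> w _; exact: cg.
Qed.

Lemma ccont_cmeas f : ccont f -> cmeas f.
Proof.
move=> cf.
have cx x y : ccvg (fun n => f (snap n x +i* y)) (f (x +i* y)).
  apply: ccont_seq => //; apply: ReIm_ccvg => /=; [exact: snap_cvg|exact: cvg_cst].
have H (p : C -> R) : (forall a b, p (a - b) = p a - p b) -> (forall a, `|p a| <= normc a) ->
    (forall x y, p (f (snap n x +i* y)) @[n --> \oo] --> p (f (x +i* y))) ->
    measurable_fun [set: mR * mR] (fun w => p (f (pt w))).
  move=> pB pn cp; apply: (measurable_separately (g := fun x y => p (f (x +i* y)))) => // x.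
  apply: continuous_measurable_fun => y; apply/cvgrPdist_le => /= e e0.
  have [d d0 hd] := cf (x +i* y) e e0.
  exists d => // y' /= yy'.
  rewrite distrC -pB (le_trans (pn _))//.
  have := hd (0 +i* (y' - y)).
  rewrite (_ : (x +i* y) + _ = x +i* y'); last by apply: eqC; rewrite ?ReD ?ImD /=; ring.
  apply; rewrite /= expr0n add0r sqrtr_sqr distrC; exact: ltW.
split; [apply: (H Re) => [a b|a|x y]|apply: (H Im) => [a b|a|x y]];
  rewrite ?ReD ?ReN ?ImD ?ImN ?normc_Re ?normc_Im//.
- exact: ccvg_Re (cx x y).
- exact: ccvg_Im (cx x y).
Qed.

End Measurability.

(** * Real integrals against the Gaussian weight *)

Section GaussianIntegral.
Variable R : realType.
Local Notation C := R[i].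
Local Notation mR := (measurableTypeR R).
Local Notation area := (@lebesgue_measure R \x @lebesgue_measure R)%E.
Local Notation gd := (@gauss_density R).

Lemma gauss_density_gt0 w : 0 < gd w.
Proof. by rewrite mulr_gt0 ?expR_gt0 ?invr_gt0 ?pi_gt0. Qed.

Lemma gauss_density_ge0 w : 0 <= gd w.
Proof. exact/ltW/gauss_density_gt0. Qed.

Lemma measurable_gauss_density : measurable_fun [set: mR * mR] gd.
Proof.
apply: measurable_funM; first exact: measurable_cst.
apply: measurableT_comp => //; apply: measurableT_comp => //.
by apply: measurable_funD; apply: measurable_funX; [exact: measurable_fst|exact: measurable_snd].
Qed.

Definition rmeas (F : C -> R) := measurable_fun [set: mR * mR] (fun w => F (pt w)).

Definition wt (F : C -> R) (w : R * R) : R := F (pt w) * gd w.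

Definition intg (F : C -> R) := area.-integrable [set: mR * mR] (EFin \o wt F).

Definition IG (F : C -> R) : R := \int[area]_w wt F w.

Lemma measurable_wt F : rmeas F -> measurable_fun [set: mR * mR] (wt F).
Proof. by move=> mF; apply: measurable_funM => //; exact: measurable_gauss_density. Qed.

Lemma measurable_ewt F : rmeas F -> measurable_fun [set: mR * mR] (EFin \o wt F).
Proof. by move=> mF; apply/measurable_EFinP; exact: measurable_wt. Qed.

Lemma intg_rmeas F : intg F -> rmeas F.
Proof.
move=> /measurable_int/measurable_EFinP mF.
rewrite /rmeas (_ : (fun w => _) = (fun w => wt F w * (gd w)^-1)); last first.
  by apply/funext => w; rewrite /wt mulfK// gt_eqF// gauss_density_gt0.
apply: measurable_funM => //.
rewrite (_ : (fun w => _) = (fun w => pi * expR (w.1 ^+ 2 + w.2 ^+ 2))); last first.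
  by apply/funext => w; rewrite /gauss_density invfM invrK expRN invrK.
apply: measurable_funM; first exact: measurable_cst.
apply: measurableT_comp => //.
by apply: measurable_funD; apply: measurable_funX; [exact: measurable_fst|exact: measurable_snd].
Qed.

Lemma intg_le F G : rmeas F -> (forall z, `|F z| <= G z) -> intg G -> intg F.
Proof.
move=> mF FG iG; apply: le_integrable iG => //.
  exact: measurable_ewt.
move=> w _; rewrite /= lee_fin !normrM ler_wpM2r// (le_trans (FG _))// ler_norm//.
Qed.

Lemma intgD F G : intg F -> intg G -> intg (fun z => F z + G z).
Proof.
move=> iF iG; have := integrableD measurableT iF iG.
by apply: eq_integrable => // w _; rewrite /= /wt mulrDl EFinD.
Qed.

Lemma intgZ a F : intg F -> intg (fun z => a * F z).
Proof.
move=> iF; have := integrableZl measurableT a iF.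
by apply: eq_integrable => // w _; rewrite /= /wt -mulrA EFinM.
Qed.

Lemma IGD F G : intg F -> intg G -> IG (fun z => F z + G z) = IG F + IG G.
Proof.
move=> iF iG; rewrite /IG -RintegralD//.
by apply: eq_Rintegral => w _; rewrite /wt mulrDl.
Qed.

Lemma IGZ a F : intg F -> IG (fun z => a * F z) = a * IG F.
Proof.
move=> iF; rewrite /IG -RintegralZl//.
by apply: eq_Rintegral => w _; rewrite /wt mulrA.
Qed.

Lemma IG_ge0 F : (forall z, 0 <= F z) -> 0 <= IG F.
Proof. by move=> F0; apply: Rintegral_ge0 => w _; rewrite mulr_ge0 ?gauss_density_ge0. Qed.

Lemma IG_le F G : intg F -> intg G -> (forall z, F z <= G z) -> IG F <= IG G.
Proof.
move=> iF iG FG; apply: le_Rintegral => // w _.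
by rewrite /wt ler_wpM2r ?gauss_density_ge0.
Qed.

Lemma eq_IG F G : (forall z, F z = G z) -> IG F = IG G.
Proof. by move=> FG; congr IG; exact/funext. Qed.

Lemma IG_dct (Fn : nat -> C -> R) F G : (forall n, rmeas (Fn n)) ->
  (forall z, Fn ^~ z @ \oo --> F z) -> (forall n z, `|Fn n z| <= G z) -> intg G ->
  [/\ rmeas F, intg F & IG (Fn n) @[n --> \oo] --> IG F].
Proof.
move=> mFn cF FG iG.
have mF : rmeas F by apply: measurable_fun_cvg mFn _ => w _; exact: cF.
have FG' z : `|F z| <= G z.
  by apply: (cvgr_to_le (cvg_norm (cF z))); exact: nearW.
have iF := intg_le mF FG' iG.
split => //; apply: fine_cvg.
rewrite fineK; last exact: integrable_fin_num.
have [] := @dominated_convergence _ _ R area setT measurableT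
  (fun n => EFin \o wt (Fn n)) (EFin \o wt F) (EFin \o wt G) => //.
- by move=> n; exact: measurable_ewt (mFn n).
- exact: measurable_ewt.
- apply: aeW => w _ /=; apply: cvg_EFin; first by apply: nearW.
  by apply: cvgMr_tmp; exact: cF.
- by apply: aeW => w n _ /=; rewrite lee_fin normrM [X in _ * X]ger0_norm ?gauss_density_ge0// ler_wpM2r ?gauss_density_ge0.
Qed.

Lemma IG_fatou (Fn : nat -> C -> R) F (M : R) : (forall n, intg (Fn n)) ->
  (forall n z, 0 <= Fn n z) -> (forall z, Fn ^~ z @ \oo --> F z) ->
  (forall n, IG (Fn n) <= M) -> intg F /\ IG F <= M.
Proof.
move=> iFn Fn0 cF FM.
have mF : rmeas F.
  by apply: measurable_fun_cvg (fun n => intg_rmeas (iFn n)) _ => w _; exact: cF.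
have F0 z : 0 <= F z by apply: (cvgr_to_ge (cF z)); exact: nearW.
have le : (\int[area]_w (wt F w)%:E <= M%:E)%E.
  rewrite (_ : (fun w => (wt F w)%:E) = (fun w => limn_einf (fun n => (wt (Fn n) w)%:E))); last first.
    apply/funext => w.
    have cw : (wt (Fn n) w)%:E @[n --> \oo] --> (wt F w)%:E.
      apply: cvg_EFin; first exact: nearW.
      by apply: cvgMr_tmp; exact: cF.
    by have [-> _] := cvg_limn_einf_sup cw.
  apply: (le_trans (@fatou _ _ R area setT measurableT (fun n w => (wt (Fn n) w)%:E) _ _)).
  - by move=> n; exact: measurable_ewt (intg_rmeas (iFn n)).
  - by move=> n w _; rewrite lee_fin mulr_ge0 ?gauss_density_ge0.
  - rewrite limn_einf_lim; apply: lime_le; first exact: is_cvg_einfs.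
    apply: nearW => n; apply: (@le_trans _ _ (\int[area]_w (wt (Fn n) w)%:E)%E).
      by apply: ereal_inf_lbound; exists n => /=.
    rewrite -(fineK (integrable_fin_num measurableT (iFn n))) lee_fin.
    exact: FM.
have iF : intg F.
  apply/integrableP; split; first exact: measurable_ewt.
  apply: le_lt_trans (ltry M); apply: le_trans le; rewrite le_eqVlt; apply/orP; left.
  apply/eqP; apply: eq_integral => w _.
  by rewrite /= ger0_norm// mulr_ge0 ?gauss_density_ge0.
split => //; rewrite -lee_fin fineK//; exact: integrable_fin_num.
Qed.
End GaussianIntegral.

(** * Complex Gaussian integrals and the L2 pairing *)

Section SquareIntegrable.
Variable R : realType.
Local Notation C := R[i].
Local Notation Re := (@complex.Re R).
Local Notation Im := (@complex.Im R).
Implicit Types f g : C -> C.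

Lemma cmeas_cst c : cmeas (fun=> c : C).
Proof. by split; exact: measurable_cst. Qed.

Lemma cmeasD f g : cmeas f -> cmeas g -> cmeas (fun z => f z + g z).
Proof.
move=> [f1 f2] [g1 g2]; split.
  by under eq_fun do rewrite ReD; exact: measurable_funD.
by under eq_fun do rewrite ImD; exact: measurable_funD.
Qed.

Lemma cmeasM f g : cmeas f -> cmeas g -> cmeas (fun z => f z * g z).
Proof.
move=> [f1 f2] [g1 g2]; split.
  by under eq_fun do rewrite ReM; apply: measurable_funB; exact: measurable_funM.
by under eq_fun do rewrite ImM; apply: measurable_funD; exact: measurable_funM.
Qed.

Lemma cmeas_conj f : cmeas f -> cmeas (fun z => conjc (f z)).
Proof.
move=> [f1 f2]; split; first by under eq_fun do rewrite Re_conj.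
by under eq_fun do rewrite Im_conj; exact: measurable_funN.
Qed.

Lemma cmeas_cvg (u : nat -> C -> C) f : (forall n, cmeas (u n)) ->
  (forall z, ccvg (u ^~ z) (f z)) -> cmeas f.
Proof.
move=> mu cu; split.
  by apply: measurable_fun_cvg (fun n => (mu n).1) _ => w _; exact: ccvg_Re (cu _).
by apply: measurable_fun_cvg (fun n => (mu n).2) _ => w _; exact: ccvg_Im (cu _).
Qed.

Lemma cmeas_sqr_normc f : cmeas f -> rmeas (fun z => normc (f z) ^+ 2).
Proof.
move=> [f1 f2]; rewrite /rmeas; under eq_fun do rewrite sqr_normcE.
by apply: measurable_funD; exact: measurable_funX.
Qed.

Lemma cmeas_normc f : cmeas f -> rmeas (fun z => normc (f z)).
Proof.
move=> mf; rewrite /rmeas (_ : (fun w => _) = (fun w => Num.sqrt (normc (f (pt w)) ^+ 2))).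
  by apply: measurableT_comp (cmeas_sqr_normc mf); exact: continuous_measurable_fun (@sqrt_continuous R).
by apply/funext => w; rewrite sqrtr_sqr ger0_norm ?normc_ge0.
Qed.

Definition cint f := cmeas f /\ intg (fun z => normc (f z)).

Lemma cint_le f G : cmeas f -> intg G -> (forall z, normc (f z) <= G z) -> cint f.
Proof.
move=> mf iG fG; split => //; apply: intg_le iG; first exact: cmeas_normc.
by move=> z; rewrite ger0_norm ?normc_ge0.
Qed.

Lemma cint_Re f : cint f -> intg (fun z => Re (f z)).
Proof. by move=> [mf nf]; apply: intg_le nf; [exact: mf.1|move=> z; exact: normc_Re]. Qed.

Lemma cint_Im f : cint f -> intg (fun z => Im (f z)).
Proof. by move=> [mf nf]; apply: intg_le nf; [exact: mf.2|move=> z; exact: normc_Im]. Qed.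

Lemma cintZ c f : cint f -> cint (fun z => c * f z).
Proof.
move=> [mf nf]; apply: cint_le (intgZ (normc c) nf) _; last by move=> z; rewrite normcM.
by apply: cmeasM => //; exact: cmeas_cst.
Qed.

Lemma gauss_integralE f : gauss_integral f = IG (fun z => Re (f z)) +i* IG (fun z => Im (f z)).
Proof. by []. Qed.

Lemma eq_gauss_integral f g : (forall z, f z = g z) -> gauss_integral f = gauss_integral g.
Proof. by move=> fg; congr gauss_integral; exact/funext. Qed.

Lemma gauss_integralD f g : cint f -> cint g ->
  gauss_integral (fun z => f z + g z) = gauss_integral f + gauss_integral g.
Proof.
move=> cf cg; rewrite !gauss_integralE; apply: eqC; rewrite ?ReD ?ImD /=.
  by rewrite -IGD ?(cint_Re cf) ?(cint_Re cg)//; apply: eq_IG => z; rewrite ReD.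
by rewrite -IGD ?(cint_Im cf) ?(cint_Im cg)//; apply: eq_IG => z; rewrite ImD.
Qed.

Lemma gauss_integralZ c f : cint f ->
  gauss_integral (fun z => c * f z) = c * gauss_integral f.
Proof.
move=> cf; have [r i] := (cint_Re cf, cint_Im cf).
rewrite !gauss_integralE; apply: eqC; rewrite ?ReM ?ImM /=.
  rewrite -(IGZ _ r) -mulNr -(IGZ _ i) -IGD ?intgZ//.
  by apply: eq_IG => z; rewrite ReM mulNr.
rewrite -(IGZ _ r) -(IGZ _ i) -IGD ?intgZ//.
by apply: eq_IG => z; rewrite ImM.
Qed.

Lemma gauss_integral_conj f : cint f ->
  gauss_integral (fun z => conjc (f z)) = conjc (gauss_integral f).
Proof.
move=> cf; rewrite !gauss_integralE; apply: eqC => /=.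
  by apply: eq_IG => z; rewrite Re_conj.
by rewrite -mulN1r -(IGZ _ (cint_Im cf)); apply: eq_IG => z; rewrite Im_conj mulN1r.
Qed.

Lemma gauss_integral_dct (u : nat -> C -> C) f G : (forall n, cmeas (u n)) ->
  (forall z, ccvg (u ^~ z) (f z)) -> (forall n z, normc (u n z) <= G z) -> intg G ->
  ccvg (fun n => gauss_integral (u n)) (gauss_integral f).
Proof.
move=> mu cu uG iG; apply: ReIm_ccvg => /=.
  by have [_ _] := IG_dct (fun n => (mu n).1) (fun z => ccvg_Re (cu z))
    (fun n z => le_trans (normc_Re _) (uG n z)) iG.
by have [_ _] := IG_dct (fun n => (mu n).2) (fun z => ccvg_Im (cu z))
  (fun n z => le_trans (normc_Im _) (uG n z)) iG.
Qed.

Definition L2 f := cmeas f /\ intg (fun z => normc (f z) ^+ 2).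

Definition nrm2 f : R := IG (fun z => normc (f z) ^+ 2).

Lemma nrm2_ge0 f : 0 <= nrm2 f.
Proof. by apply: IG_ge0 => z; exact: sqr_ge0. Qed.

Lemma L2_le f G : cmeas f -> intg (fun z => G z ^+ 2) -> (forall z, normc (f z) <= G z) -> L2 f.
Proof.
move=> mf iG fG; split => //; apply: intg_le iG; first exact: cmeas_sqr_normc.
move=> z; rewrite ger0_norm ?sqr_ge0// lerXn2r ?nnegrE ?normc_ge0//.
exact: le_trans (normc_ge0 _) (fG z).
Qed.

Lemma sqr_normcD (a b : C) : normc (a + b) ^+ 2 <= 2 * (normc a ^+ 2 + normc b ^+ 2).
Proof.
have := normcD a b; have := normc_ge0 (a + b); have := sqr_ge0 (normc a - normc b).
nra.
Qed.

Lemma L2D f g : L2 f -> L2 g -> L2 (fun z => f z + g z).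
Proof.
move=> [mf nf] [mg ng]; split; first exact: cmeasD.
apply: intg_le (intgZ 2 (intgD nf ng)); first exact: cmeas_sqr_normc (cmeasD mf mg).
by move=> z; rewrite ger0_norm ?sqr_ge0// sqr_normcD.
Qed.

Lemma L2Z c f : L2 f -> L2 (fun z => c * f z).
Proof.
move=> [mf nf]; have mc : cmeas (fun z => c * f z) by apply: cmeasM => //; exact: cmeas_cst.
split => //; apply: intg_le (intgZ (normc c ^+ 2) nf); first exact: cmeas_sqr_normc.
by move=> z; rewrite ger0_norm ?sqr_ge0// normcM exprMn.
Qed.

Lemma L2_0 : L2 (fun=> 0 : C).
Proof.
split; first exact: cmeas_cst.
rewrite /intg (_ : _ \o _ = cst 0%E); first exact: integrable0.
by apply/funext => w; rewrite -[LHS]/((wt _ w)%:E) /wt normc0 expr0n mul0r.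
Qed.

Lemma L2_sum (I : Type) (s : seq I) (c : I -> C) (F : I -> C -> C) :
  (forall i, L2 (F i)) -> L2 (fun z => \sum_(i <- s) c i * F i z).
Proof.
move=> LF; elim: s => [|i s ih].
  by under eq_fun do rewrite big_nil; exact: L2_0.
by under eq_fun do rewrite big_cons; apply: L2D => //; exact: L2Z.
Qed.

Lemma mulnormc_le (a b : C) : normc a * normc b <= normc a ^+ 2 + normc b ^+ 2.
Proof.
have := sqr_ge0 (normc a - normc b); have := sqr_ge0 (normc a); have := sqr_ge0 (normc b); nra.
Qed.

Lemma L2_cint f g : L2 f -> L2 g -> cint (fun z => f z * conjc (g z)).
Proof.
move=> [mf nf] [mg ng]; apply: cint_le (intgD nf ng) _.
  by apply: cmeasM => //; exact: cmeas_conj.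
by move=> z; rewrite normcM normc_conj mulnormc_le.
Qed.

Lemma ipDl f g h : L2 f -> L2 g -> L2 h ->
  fock_ip (fun z => f z + g z) h = fock_ip f h + fock_ip g h.
Proof.
move=> Lf Lg Lh; rewrite /fock_ip -gauss_integralD; try exact: L2_cint.
by apply: eq_gauss_integral => z; rewrite mulrDl.
Qed.

Lemma ipZl c f h : L2 f -> L2 h -> fock_ip (fun z => c * f z) h = c * fock_ip f h.
Proof.
move=> Lf Lh; rewrite /fock_ip -gauss_integralZ; try exact: L2_cint.
by apply: eq_gauss_integral => z; rewrite mulrA.
Qed.

Lemma ip_conj f g : L2 f -> L2 g -> fock_ip g f = conjc (fock_ip f g).
Proof.
move=> Lf Lg; rewrite /fock_ip -gauss_integral_conj; try exact: L2_cint.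
by apply: eq_gauss_integral => z; rewrite rmorphM /= conjcK mulrC.
Qed.

Lemma ipDr f g h : L2 f -> L2 g -> L2 h ->
  fock_ip h (fun z => f z + g z) = fock_ip h f + fock_ip h g.
Proof.
by move=> Lf Lg Lh; rewrite (ip_conj (L2D Lf Lg) Lh) (ip_conj Lf Lh) (ip_conj Lg Lh) ipDl// rmorphD.
Qed.

Lemma ipZr c f h : L2 f -> L2 h -> fock_ip h (fun z => c * f z) = conjc c * fock_ip h f.
Proof.
by move=> Lf Lh; rewrite (ip_conj (L2Z c Lf) Lh) (ip_conj Lf Lh) ipZl// rmorphM.
Qed.

Lemma ip_suml (I : Type) (s : seq I) (c : I -> C) (F : I -> C -> C) h :
  (forall i, L2 (F i)) -> L2 h ->
  fock_ip (fun z => \sum_(i <- s) c i * F i z) h = \sum_(i <- s) c i * fock_ip (F i) h.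
Proof.
move=> LF Lh; elim: s => [|i s ih].
  rewrite big_nil; under eq_fun do rewrite big_nil.
  by have := ipZl 0 L2_0 Lh; rewrite !mul0r.
rewrite big_cons -ih -ipZl// -ipDl//; first 1 last.
- exact: L2Z.
- exact: L2_sum.
by under eq_fun do rewrite big_cons.
Qed.

Lemma ip_sumr (I : Type) (s : seq I) (c : I -> C) (F : I -> C -> C) h :
  (forall i, L2 (F i)) -> L2 h ->
  fock_ip h (fun z => \sum_(i <- s) c i * F i z) = \sum_(i <- s) conjc (c i) * fock_ip h (F i).
Proof.
move=> LF Lh; rewrite (ip_conj (L2_sum s c LF) Lh) ip_suml//.
by rewrite rmorph_sum; apply: eq_bigr => i _; rewrite rmorphM (ip_conj (LF i) Lh).
Qed.

Lemma IG0 : IG (fun=> 0 : R) = 0.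
Proof. by rewrite /IG (_ : wt _ = cst 0) ?Rintegral_cst ?mul0r//; apply/funext => w; rewrite /wt mul0r. Qed.

Lemma ip_self f : fock_ip f f = (nrm2 f)%:C.
Proof.
rewrite /fock_ip gauss_integralE; apply: eqC => /=.
  by apply: eq_IG => z; rewrite mul_conjE.
by rewrite -[RHS]IG0; apply: eq_IG => z; rewrite mul_conjE.
Qed.

Lemma nrm2Z c f : L2 f -> nrm2 (fun z => c * f z) = normc c ^+ 2 * nrm2 f.
Proof. by move=> [_ nf]; rewrite /nrm2 -IGZ//; apply: eq_IG => z; rewrite normcM exprMn. Qed.

Lemma nrm2D f g : L2 f -> L2 g ->
  nrm2 (fun z => f z + g z) = nrm2 f + nrm2 g + 2 * Re (fock_ip f g).
Proof.
move=> Lf Lg; apply: (@complexI R); rewrite -ip_self ipDl ?ipDr//; last exact: L2D.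
rewrite !ip_self (ip_conj Lf Lg); case: (fock_ip f g) => a b.
by apply: eqC => /=; ring.
Qed.

Lemma cauchy_schwarz f g : L2 f -> L2 g -> normc (fock_ip f g) ^+ 2 <= nrm2 f * nrm2 g.
Proof.
move=> Lf Lg; set a := fock_ip f g.
(* Expands the squared norm of [f - x a g] for real [x]; the factor [a] aligns the phase, which
   leaves only [|a|^2]. *)
have key (x : R) : 0 <= nrm2 f - 2 * x * normc a ^+ 2 + x ^+ 2 * normc a ^+ 2 * nrm2 g.
  have := nrm2_ge0 (fun z => f z + (- x%:C * a) * g z).
  rewrite nrm2D//; last exact: L2Z.
  rewrite nrm2Z// ipZr// -/a normcM normcN normcR.
  rewrite (_ : _ * a = - (x%:C * (a * conjc a))); last first.
    by rewrite conjcM conjcN conjc_real; ring.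
  rewrite mul_conjE -rmorphM -rmorphN /= exprMn real_normK ?num_real//; lra.
have nf := nrm2_ge0 f; have ng := nrm2_ge0 g; have na := sqr_ge0 (normc a).
have [g0|g0] := eqVneq (nrm2 g) 0.
  rewrite g0 mulr0; rewrite leNgt; apply/negP => a0.
  (* If [g] has norm 0 the expression is affine in [x]; this [x] makes it equal to -1. *)
  have := key ((nrm2 f + 1) / normc a ^+ 2 / 2); rewrite g0 mulr0 addr0.
  rewrite (_ : 2 * _ * _ = nrm2 f + 1); first lra.
  by field; rewrite gt_eqF// normc_gt0; apply: contraTneq a0 => ->; rewrite normc0 expr0n ltxx.
have := key (nrm2 g)^-1.
rewrite (_ : _ - _ + _ = nrm2 f - normc a ^+ 2 / nrm2 g); last by field.
by rewrite subr_ge0 ler_pdivrMr// lt_def g0.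
Qed.

Lemma L2_fatou (u : nat -> C -> C) f M : (forall n, L2 (u n)) ->
  (forall z, ccvg (u ^~ z) (f z)) -> (forall n, nrm2 (u n) <= M) -> L2 f /\ nrm2 f <= M.
Proof.
move=> Lu cu uM.
have cu2 z : normc (u n z) ^+ 2 @[n --> \oo] --> normc (f z) ^+ 2.
  by rewrite expr2; apply: cvgM; exact: ccvg_normc (cu z).
have [i1 i2] := IG_fatou (fun n => (Lu n).2) (fun n z => sqr_ge0 _) cu2 uM.
by split => //; split => //; exact: cmeas_cvg (fun n => (Lu n).1) cu.
Qed.

Lemma ip_cvgl (u : nat -> C -> C) f h : (forall n, L2 (u n)) -> L2 f -> L2 h ->
  nrm2 (fun z => u n z - f z) @[n --> \oo] --> 0 ->
  ccvg (fun n => fock_ip (u n) h) (fock_ip f h).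
Proof.
move=> Lu Lf Lh cu.
have LB n : L2 (fun z => u n z - f z).
  under eq_fun do rewrite -mulN1r; apply: L2D => //; exact: L2Z.
have H n : normc (fock_ip (u n) h - fock_ip f h) <= Num.sqrt (nrm2 (fun z => u n z - f z) * nrm2 h).
  rewrite -mulN1r -ipZl// -ipDl//; last exact: L2Z.
  under [X in fock_ip X h]eq_fun do rewrite mulN1r.
  rewrite -[leLHS]ger0_norm ?normc_ge0// -sqrtr_sqr ler_wsqrtr//.
  exact: cauchy_schwarz.
apply: ccvg_squeeze H _.
have -> : 0 = Num.sqrt (0 * nrm2 h) by rewrite mul0r sqrtr0.
apply: (@cvg_comp _ _ _ (fun n => nrm2 (fun z => u n z - f z) * nrm2 h) (@Num.sqrt R) _ (nbhs (0 * nrm2 h))).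
  exact: cvgMr_tmp.
exact: sqrt_continuous.
Qed.

End SquareIntegrable.

(** * One-dimensional Gaussian moments *)

Section RealGaussian.
Variable R : realType.
Local Notation mR := (measurableTypeR R).
Local Notation mu := (@lebesgue_measure R).
Local Notation area := (@lebesgue_measure R \x @lebesgue_measure R)%E.
Implicit Types (a b x y : R).

Definition rint (f : R -> R) := mu.-integrable [set: mR] (EFin \o f).

Lemma rint_gauss b : 0 < b -> rint (fun x => expR (- (b * x ^+ 2))) /\
  \int[mu]_x expR (- (b * x ^+ 2)) = Num.sqrt (pi / b).
Proof.
(* The standard deviation for which the normal density has exponent [- b x^2]; its total mass 1
   gives the integral. *)
move=> b0; pose s := Num.sqrt (2 * b)^-1.
have b2 : 0 < (2 * b)^-1 by rewrite invr_gt0 mulr_gt0.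
have s0 : s != 0 by rewrite sqrtr_eq0 -ltNge.
have s2 : s ^+ 2 = (2 * b)^-1 by rewrite sqr_sqrtr// ltW.
have E x : normal_pdf 0 s x = normal_peak s * expR (- (b * x ^+ 2)).
  rewrite normal_pdfE// /normal_fun subr0; congr (_ * expR _); rewrite s2.
  by field; rewrite gt_eqF.
have pk0 := normal_peak_gt0 s0.
have E' : (EFin \o (fun x => expR (- (b * x ^+ 2)))) =
    (fun x => (normal_peak s)^-1%:E * (normal_pdf 0 s x)%:E)%E.
  by apply/funext => x; rewrite /= E -EFinM mulKf// gt_eqF.
have i1 : rint (fun x => expR (- (b * x ^+ 2))).
  by rewrite /rint E'; apply: integrableZl => //; exact: integrable_normal_pdf.
split=> //; rewrite /Rintegral.
rewrite -[X in (\int[mu]_x X x)%E]/(EFin \o (fun x => expR (- (b * x ^+ 2)))) E'.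
rewrite integralZl//; last exact: integrable_normal_pdf.
rewrite integral_normal_pdf mule1 /= /normal_peak invrK s2; congr Num.sqrt.
by rewrite -mulr_natr; field; rewrite gt_eqF.
Qed.

Lemma rintZ c f : rint f -> rint (fun x => c * f x).
Proof. by move=> /(integrableZl measurableT c); apply: eq_integrable. Qed.

Lemma rint_le (f g : R -> R) : measurable_fun [set: mR] f -> (forall x, `|f x| <= g x) -> rint g -> rint f.
Proof.
move=> mf fg; apply: le_integrable => //; first exact/measurable_EFinP.
by move=> x _ /=; rewrite lee_fin (le_trans (fg _))// ler_norm.
Qed.

Lemma exprn_le_expR x k : 0 <= x -> x ^+ k <= k`!%:R * expR x.
Proof.
move=> x0; have f0 : 0 < k`!%:R :> R by rewrite ltr0n fact_gt0.
case: k f0 => [|k] f0; first by rewrite expr0 mul1r -expR0 ler_expR.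
have := expR_ge1Dxn k x0; rewrite -ler_pdivrMl// mulrC; lra.
Qed.

Lemma normr_exprn_le_gauss b k : 0 < b -> exists c, forall x : R, `|x| ^+ k <= c * expR (b * x ^+ 2).
Proof.
move=> b0; exists (1 + (b^-1) ^+ k * k`!%:R) => x.
have x0 := normr_ge0 x.
have E1 : 1 <= expR (b * x ^+ 2) by rewrite -expR0 ler_expR mulr_ge0 ?sqr_ge0 ?ltW.
have h : `|x| ^+ k <= 1 + (x ^+ 2) ^+ k.
  rewrite -(real_normK (num_real x)) -exprM mulnC exprM.
  have := exprn_ge0 k x0; set t := `|x| ^+ k; nra.
have bx : 0 <= b * x ^+ 2 by rewrite mulr_ge0 ?sqr_ge0 ?ltW.
have := exprn_le_expR k bx; rewrite exprMn => h2.
have h3 : (x ^+ 2) ^+ k <= b^-1 ^+ k * k`!%:R * expR (b * x ^+ 2).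
  by rewrite exprVn -mulrA ler_pdivlMl ?exprn_gt0.
by rewrite mulrDl mul1r; lra.
Qed.

Definition gmom k x : R := x ^+ k * expR (- x ^+ 2).

Lemma rint_gmom k : rint (gmom k).
Proof.
have [c hc] := @normr_exprn_le_gauss 2^-1 k ltac:(by rewrite invr_gt0).
apply: (@rint_le _ (fun x => c * expR (- (2^-1 * x ^+ 2)))).
- apply: measurable_funM; first exact: measurable_funX.
  by apply: measurableT_comp => //; apply: measurable_funN; exact: measurable_funX.
- move=> x; rewrite normrM normrX [X in _ * X]ger0_norm ?expR_ge0//.
  have -> : - (2^-1 * x ^+ 2) = 2^-1 * x ^+ 2 + - x ^+ 2 by lra.
  by rewrite expRD mulrA ler_wpM2r ?expR_ge0.
- by apply: rintZ; exact: (rint_gauss _).1.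
Qed.

(** The sign [(-1) ^+ e] treats both ends of the line at once, for the boundary terms of the
    integration by parts. *)
Lemma gmom_cvg0 k (e : bool) : gmom k ((-1) ^+ e * n%:R) @[n --> \oo] --> 0.
Proof.
have [c hc] := @normr_exprn_le_gauss 2^-1 k ltac:(by rewrite invr_gt0).
have c0 : 0 <= c.
  by have := hc 0; rewrite expr0n mulr0 expR0 mulr1; apply: le_trans; exact: exprn_ge0.
apply/norm_cvg0P.
apply: (squeeze_cvgr (f := cst 0) (h := fun n => c * expR 1 * expR (- n%:R))).
- apply: nearW => n; set x := _ * n%:R.
  rewrite normr_ge0/= normrM normrX [X in _ * X]ger0_norm ?expR_ge0//.
  have -> : - x ^+ 2 = - (2^-1 * x ^+ 2) + - (2^-1 * x ^+ 2) by lra.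
  have h : `|x| ^+ k * expR (- (2^-1 * x ^+ 2)) <= c by rewrite expRN ler_pdivrMr ?expR_gt0.
  rewrite expRD mulrA -[leRHS]mulrA -expRD ler_pM ?mulr_ge0 ?exprn_ge0 ?expR_ge0// ler_expR.
  rewrite /x exprMn -exprM mulnC exprM sqrrN expr1n expr1n mul1r.
  (* [(n - 1)^2 >= 0] bounds the remaining [exp (- n^2 / 2)] by [exp (1 - n)]. *)
  have := sqr_ge0 (n%:R - 1 : R); lra.
- exact: cvg_cst.
- by rewrite -[0](mulr0 (c * expR 1)); apply: cvgMl_tmp; exact: cvgn_expR.
Qed.

Lemma is_derive_gmom k x :
  is_derive x (1 : R) (gmom k) (k%:R * gmom k.-1 x - 2 * gmom k.+1 x).
Proof.
have -> : gmom k = ((@id R) ^+ k) * (fun x => expR (- x ^+ 2)).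
  by apply/funext => y; rewrite /gmom -[RHS]/((id ^+ k) y * _) exprfctE.
apply: is_derive_eq.
have sE (u v : R) : u *: v = u * v by [].
by rewrite !sE exprfctE /gmom /= !exprS; ring.
Qed.

(** The derivative of [gmom k] integrates to 0: fundamental theorem on [[-(n+1), n+1]], vanishing
    boundary terms, dominated convergence. For [k = 0] the factor [k%:R] cancels the term at
    [k.-1]. *)
Lemma Rintegral_derive_gmom k :
  k%:R * \int[mu]_x gmom k.-1 x = 2 * \int[mu]_x gmom k.+1 x.
Proof.
pose f x := k%:R * gmom k.-1 x + - 2 * gmom k.+1 x.
have cg j : continuous (gmom j).
  move=> x; apply: differentiable_continuous; apply/derivable1_diffP.
  by have := is_derive_gmom j x; move=> /@ex_derive.
have if1 := rintZ k%:R (rint_gmom k.-1); have if2 := rintZ (- 2) (rint_gmom k.+1).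
have if0 : rint f by have := integrableD measurableT if1 if2.
have mf : measurable_fun [set: mR] f by move/measurable_int/measurable_EFinP : if0.
have cf : continuous f.
  by move=> x; apply: cvgD; apply: cvgMl_tmp; exact: cg.
have intn n : (\int[mu]_x ((f \_ `[- n.+1%:R, n.+1%:R]) x)%:E =
    (gmom k n.+1%:R - gmom k (- n.+1%:R))%:E)%E.
  rewrite EFinB -(@continuous_FTC2 R f (gmom k)).
  - by rewrite [RHS]integral_mkcond; apply: eq_integral => x _; rewrite restrict_EFin.
  - by rewrite -subr_gt0 opprK addr_gt0.
  - exact: continuous_subspaceT.
  - split.
    + by move=> x _; have := is_derive_gmom k x; move=> /@ex_derive.
    + by apply: cvg_at_right_filter; exact: cg.
    + by apply: cvg_at_left_filter; exact: cg.
  - move=> x _; rewrite derive1E; have := is_derive_gmom k x => /@derive_val ->.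
    by rewrite /f mulNr.
have c1 : (\int[mu]_x ((f \_ `[- n.+1%:R, n.+1%:R]) x)%:E)%E @[n --> \oo] --> (\int[mu]_x (f x)%:E)%E.
  have [] := @dominated_convergence _ _ R mu setT measurableT
    (fun n => EFin \o (f \_ `[- n.+1%:R, n.+1%:R])) (EFin \o f) (EFin \o (fun x => `|f x|)) => //.
  - move=> n; apply/measurable_EFinP; apply/(measurable_restrictT _ _).1 => //.
    exact: measurable_funTS.
  - exact/measurable_EFinP.
  - apply: aeW => x _; apply: cvg_EFin; first exact: nearW.
    apply: cvg_near_cst; near=> n; rewrite /= patchE mem_set//= in_itv /= -ler_norml.
    by apply: (@le_trans _ _ n%:R); [near: n; exact: nbhs_infty_ger|rewrite ler_nat].
  - exact: (integrable_norm if0).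
  - apply: aeW => x n _; rewrite /= lee_fin patchE; case: ifP => // _.
    by rewrite normr0.
have c2 : (\int[mu]_x ((f \_ `[- n.+1%:R, n.+1%:R]) x)%:E)%E @[n --> \oo] --> 0%:E.
  under eq_fun do rewrite intn.
  apply: cvg_EFin; first exact: nearW.
  rewrite -[0](subr0 0); apply: cvgB.
    have := gmom_cvg0 k false; rewrite -(cvg_shiftS (fun n => gmom k ((-1) ^+ false * n%:R))).
    by under eq_fun do rewrite expr0 mul1r.
  have := gmom_cvg0 k true; rewrite -(cvg_shiftS (fun n => gmom k ((-1) ^+ true * n%:R))).
  by under eq_fun do rewrite expr1 mulN1r.
have : \int[mu]_x f x = 0.
  by rewrite /Rintegral (cvg_unique _ c1 c2).
rewrite (RintegralD measurableT if1 if2) (RintegralZl _ measurableT (rint_gmom _)).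
rewrite (RintegralZl _ measurableT (rint_gmom _)); lra.
Unshelve. all: by end_near. Qed.

Lemma gmom_int0 : \int[mu]_x gmom 0 x = Num.sqrt pi.
Proof.
have := (rint_gauss ltr01).2; rewrite divr1 => <-.
by apply: eq_Rintegral => x _; rewrite /gmom expr0 !mul1r.
Qed.

Lemma rint_prod (f g : R -> R) : rint f -> rint g ->
  area.-integrable [set: mR * mR] (EFin \o (fun w => f w.1 * g w.2)) /\ \int[area]_w (f w.1 * g w.2) = (\int[mu]_x f x) * (\int[mu]_x g x).
Proof.
move=> iF iG.
have mf : measurable_fun [set: mR] f by move/measurable_int/measurable_EFinP : iF.
have mg : measurable_fun [set: mR] g by move/measurable_int/measurable_EFinP : iG.
have mfg : measurable_fun [set: mR * mR] (fun w => f w.1 * g w.2).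
  apply: measurable_funM; first exact: measurableT_comp mf measurable_fst.
  exact: measurableT_comp mg measurable_snd.
have emfg := (measurable_EFinP _ _).2 mfg.
have ifg : area.-integrable [set: mR * mR] (EFin \o (fun w => f w.1 * g w.2)).
  apply/(integrable12ltyP _ _ _).2 => //=.
  under eq_integral => x _.
    under eq_integral do rewrite normrM EFinM.
    rewrite integralZl//; last exact: integrable_norm iG.
    over.
  have /integrableP[_ hg] := iG; have /integrableP[_ hf] := iF.
  have fing : (\int[mu]_y `|(g y)%:E| \is a fin_num)%E by rewrite ge0_fin_numE ?integral_ge0.
  rewrite -(fineK fing) integralZr//; last exact: integrable_norm iF.
  rewrite lte_mul_pinfty ?integral_ge0// ?fine_ge0 ?integral_ge0//.
    by rewrite ge0_fin_numE ?integral_ge0.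
  exact: ltry.
split=> //; rewrite /Rintegral -[X in fine X]integral12_prod_meas1//= /fubini_F /=.
under eq_integral => x _.
  under eq_integral do rewrite EFinM.
  rewrite integralZl// -(fineK (integrable_fin_num measurableT iG)).
  over.
by rewrite integralZr// fineM// ?integrable_fin_num.
Qed.

End RealGaussian.

(** * Mixed moments on the plane and orthogonality of monomials *)

Section Moments.
Variable R : realType.
Local Notation C := R[i].
Local Notation Re := (@complex.Re R).
Local Notation Im := (@complex.Im R).
Local Notation mu := (@lebesgue_measure R).

Lemma gauss_quad (a b : R) : a < 1 -> b < 1 ->
  intg (fun z : C => expR (a * Re z ^+ 2 + b * Im z ^+ 2)) /\
  IG (fun z : C => expR (a * Re z ^+ 2 + b * Im z ^+ 2)) =
    (Num.sqrt (1 - a) * Num.sqrt (1 - b))^-1.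
Proof.
move=> a1 b1.
have a0 : 0 < 1 - a by rewrite subr_gt0.
have b0 : 0 < 1 - b by rewrite subr_gt0.
have [ia Ia] := rint_gauss a0; have [ib Ib] := rint_gauss b0.
have [i1 I1] := rint_prod ia ib.
have E : wt (fun z : C => expR (a * Re z ^+ 2 + b * Im z ^+ 2)) =
    (fun w => pi^-1 * (expR (- ((1 - a) * w.1 ^+ 2)) * expR (- ((1 - b) * w.2 ^+ 2)))).
  apply/funext => w; rewrite /wt /gauss_density /= mulrCA -!expRD; congr (_ * expR _); ring.
split.
  rewrite /intg E; have := integrableZl measurableT pi^-1 i1.
  by apply: eq_integrable => // w _.
rewrite /IG E RintegralZl// I1 Ia Ib !sqrtrM ?pi_ge0// !sqrtrV ?ltW//.
rewrite [pi in pi^-1](_ : _ = Num.sqrt pi * Num.sqrt pi); last first.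
  by rewrite -expr2 sqr_sqrtr// pi_ge0.
field; rewrite !sqrtr_eq0 -!ltNge pi_gt0 a0 b0 //.
Qed.

Lemma intg_envelope (r : R) : r < 1 -> intg (fun z : C => expR (r * normc z ^+ 2)).
Proof.
move=> r1; have [+ _] := gauss_quad r1 r1.
by apply: eq_integrable => // w _; rewrite /= /wt sqr_normcE mulrDr.
Qed.

Lemma cmeas_id : cmeas (fun z : C => z).
Proof. by split; [exact: measurable_fst|exact: measurable_snd]. Qed.

Lemma cmeas_Re : cmeas (fun z : C => (Re z)%:C).
Proof. by split; [exact: measurable_fst|exact: measurable_cst]. Qed.

Lemma cmeas_Im : cmeas (fun z : C => (Im z)%:C).
Proof. by split; [exact: measurable_snd|exact: measurable_cst]. Qed.

Lemma cmeasX f n : cmeas f -> cmeas (fun z : C => f z ^+ n).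
Proof.
move=> mf; elim: n => [|n ih]; first by under eq_fun do rewrite expr0; exact: cmeas_cst.
by under eq_fun do rewrite exprS; exact: cmeasM.
Qed.

(** The real coordinates are carried as extra factors because integration by parts acts on them one
    at a time, while the result wanted concerns only [n] and [m]. *)
Definition cmono n m a b (z : C) : C := z ^+ n * conjc z ^+ m * (Re z)%:C ^+ a * (Im z)%:C ^+ b.

Lemma cmeas_cmono n m a b : cmeas (cmono n m a b).
Proof.
apply: cmeasM; last exact: cmeasX cmeas_Im.
apply: cmeasM; last exact: cmeasX cmeas_Re.
by apply: cmeasM; apply: cmeasX; [exact: cmeas_id|exact: cmeas_conj cmeas_id].
Qed.

Lemma cint_cmono n m a b : cint (cmono n m a b).
Proof.
have h0 : 0 < 2^-1 :> R by rewrite invr_gt0.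
have [c hc] := @normr_exprn_le_gauss R 2^-1 (n + m + a + b) h0.
apply: (@cint_le _ _ (fun z => c * expR (2^-1 * normc z ^+ 2))); first exact: cmeas_cmono.
  by apply/intgZ/intg_envelope; rewrite invf_lt1// ltr1n.
move=> z; apply: le_trans (hc (normc z)); rewrite ger0_norm ?normc_ge0//.
rewrite /cmono !normcM !normcX normc_conj !normcR !exprD.
by rewrite !ler_pM ?mulr_ge0 ?exprn_ge0 ?normc_ge0// lerXn2r ?nnegrE ?normc_ge0 ?normc_Re ?normc_Im.
Qed.

Definition cmom n m a b : C := gauss_integral (cmono n m a b).

Lemma cmomSl n m a b : cmom n.+1 m a b = cmom n m a.+1 b + 'i%C * cmom n m a b.+1.
Proof.
rewrite /cmom -(gauss_integralZ 'i%C (cint_cmono n m a b.+1)).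
rewrite -(gauss_integralD (cint_cmono n m a.+1 b) (cintZ 'i%C (cint_cmono n m a b.+1))).
apply: eq_gauss_integral => z; rewrite /cmono !exprS.
rewrite [X in X * z ^+ n](complexE z).
move: (conjc z ^+ m) (z ^+ n) ((Re z)%:C ^+ a) ((Im z)%:C ^+ b) (Re z)%:C (Im z)%:C 'i%C => *; ring.
Qed.

Lemma cmomSr n m a b : cmom n m.+1 a b = cmom n m a.+1 b - 'i%C * cmom n m a b.+1.
Proof.
rewrite -mulNr /cmom -(gauss_integralZ (- 'i%C) (cint_cmono n m a b.+1)).
rewrite -(gauss_integralD (cint_cmono n m a.+1 b) (cintZ (- 'i%C) (cint_cmono n m a b.+1))).
apply: eq_gauss_integral => z; rewrite /cmono !exprS.
have -> : conjc z = (Re z)%:C - 'i%C * (Im z)%:C.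
  by case: z => x y; apply: eqC; rewrite ?ReD ?ReN ?ReM ?ImD ?ImN ?ImM /=; ring.
move: (((Re z)%:C - 'i%C * (Im z)%:C) ^+ m) (z ^+ n) ((Re z)%:C ^+ a) ((Im z)%:C ^+ b) (Re z)%:C (Im z)%:C 'i%C => *; ring.
Qed.

Let M k := \int[mu]_x gmom k x : R.

Lemma cmom00 a b : cmom 0 0 a b = (pi^-1 * (M a * M b))%:C.
Proof.
have [i1 I1] := rint_prod (rint_gmom R a) (rint_gmom R b).
rewrite /cmom gauss_integralE; apply: eqC => /=.
  rewrite -I1 -RintegralZl//; apply: eq_Rintegral => w _.
  rewrite /wt /cmono !expr0 !mul1r -!(rmorphXn (real_complex R)) -(rmorphM (real_complex R)) /= /gmom /gauss_density.
  by rewrite opprD expRD; ring.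
rewrite -[RHS](IG0 R); apply: eq_IG => z.
by rewrite /cmono !expr0 !mul1r -!(rmorphXn (real_complex R)) -(rmorphM (real_complex R)).
Qed.

Let mulnSl n m a b :
  n%:R * cmom n.-1 m a.+1 b + 'i%C * (n%:R * cmom n.-1 m a b.+1) = n%:R * cmom n m a b.
Proof. by case: n => [|n]; rewrite ?mul0r ?mulr0 ?add0r// cmomSl /=; ring. Qed.

Let mulnSr n m a b :
  m%:R * cmom n m.-1 a.+1 b - 'i%C * (m%:R * cmom n m.-1 a b.+1) = m%:R * cmom n m a b.
Proof. by case: m => [|m]; rewrite ?mul0r ?mulr0 ?subr0// cmomSr /=; ring. Qed.

(** The integral of the x-derivative of the monomial times the Gaussian is 0. The induction trades
    each [z] and [conjc z] for real coordinates until [Rintegral_derive_gmom] applies. *)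
Lemma cmom_ibp_Re n m a b :
  n%:R * cmom n.-1 m a b + m%:R * cmom n m.-1 a b + a%:R * cmom n m a.-1 b = 2 * cmom n m a.+1 b.
Proof.
elim: n m a b => [|n ihn] m a b.
  elim: m a b => [|m ihm] a b.
    rewrite !mul0r !add0r !cmom00 -(rmorph_nat (real_complex R)) -(rmorph_nat (real_complex R) 2) -!rmorphM.
    congr (_%:C); have := Rintegral_derive_gmom R a; rewrite -/(M _) -/(M _) => h.
    by rewrite mulrCA [in RHS]mulrCA; congr (_ * _); rewrite mulrA h mulrA.
  have h1 := ihm a.+1 b; have h2 := ihm a b.+1; rewrite !mul0r !add0r in h1 h2 *.
  have e1 := mulnSr 0 m a b.
  have e2 : a%:R * cmom 0 m a b - 'i%C * (a%:R * cmom 0 m a.-1 b.+1) = a%:R * cmom 0 m.+1 a.-1 b.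
    by case: a {h1 h2 e1} => [|a]; rewrite ?mul0r ?mulr0 ?subr0// cmomSr /=; ring.
  rewrite (cmomSr 0 m a.+1 b) mulrBr (mulrCA 2) -h1 -h2 /= -e2 -(natr1 m) mulrDl -e1 -(natr1 a).
  by ring.
have h1 := ihn m a.+1 b; have h2 := ihn m a b.+1.
have e1 := mulnSl n m a b.
have e2 : a%:R * cmom n m a b + 'i%C * (a%:R * cmom n m a.-1 b.+1) = a%:R * cmom n.+1 m a.-1 b.
  by case: a {h1 h2 e1} => [|a]; rewrite ?mul0r ?mulr0 ?addr0// cmomSl /=; ring.
rewrite (cmomSl n m a.+1 b) mulrDr (mulrCA 2) -h1 -h2 /= -e2 -(natr1 n) (mulrDl n%:R) -e1 -(natr1 a) (cmomSl n m.-1).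
by ring.
Qed.

(** The same in the y-direction, where [z] and [conjc z] have derivatives [i] and [- i]. *)
Lemma cmom_ibp_Im n m a b :
  'i%C * (n%:R * cmom n.-1 m a b) - 'i%C * (m%:R * cmom n m.-1 a b) + b%:R * cmom n m a b.-1
  = 2 * cmom n m a b.+1.
Proof.
elim: n m a b => [|n ihn] m a b.
  elim: m a b => [|m ihm] a b.
    rewrite !mul0r !mulr0 subr0 !add0r !cmom00 -(rmorph_nat (real_complex R)) -(rmorph_nat (real_complex R) 2) -!rmorphM.
    congr (_%:C); have := Rintegral_derive_gmom R b; rewrite -/(M _) -/(M _) => h.
    by rewrite mulrCA [in RHS]mulrCA; congr (_ * _); rewrite mulrCA h mulrCA.
  have h1 := ihm a.+1 b; have h2 := ihm a b.+1; rewrite !mul0r !mulr0 !add0r in h1 h2 *.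
  have e1 := mulnSr 0 m a b.
  have e2 : b%:R * cmom 0 m a.+1 b.-1 - 'i%C * (b%:R * cmom 0 m a b) = b%:R * cmom 0 m.+1 a b.-1.
    by case: b {h1 h2 e1} => [|b]; rewrite ?mul0r ?mulr0 ?subr0// cmomSr /=; ring.
  rewrite (cmomSr 0 m a b.+1) mulrBr (mulrCA 2) -h1 -h2 /= -e2 -(natr1 m) mulrDl -e1 -(natr1 b).
  by ring.
have h1 := ihn m a.+1 b; have h2 := ihn m a b.+1.
have e1 := mulnSl n m a b.
have e2 : b%:R * cmom n m a.+1 b.-1 + 'i%C * (b%:R * cmom n m a b) = b%:R * cmom n.+1 m a b.-1.
  by case: b {h1 h2 e1} => [|b]; rewrite ?mul0r ?mulr0 ?addr0// cmomSl /=; ring.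
rewrite (cmomSl n m a b.+1) mulrDr (mulrCA 2) -h1 -h2 /= -e2 -(natr1 n) (mulrDl n%:R) -e1 -(natr1 b) (cmomSl n m.-1).
by ring.
Qed.

(** The x-identity plus [i] times the y-identity is integration by parts for the derivative in
    [conjc z], which annihilates [z^n]. *)
Lemma cmomS n m : cmom n.+1 m 0 0 = m%:R * cmom n m.-1 0 0.
Proof.
have h1 := cmom_ibp_Re n m 0 0; have h2 := cmom_ibp_Im n m 0 0.
apply: (@mulfI _ 2); first by rewrite pnatr_eq0.
rewrite (cmomSl n m 0 0) mulrDr (mulrCA 2) -h1 -h2 !mul0r !addr0.
have i2 := sqr_i R; rewrite mulrBr !mulrA -!expr2 i2.
by ring.
Qed.

Lemma monomial_ip n m :
  fock_ip (fun z : C => z ^+ n) (fun z => z ^+ m) = if n == m then n`!%:R else 0.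
Proof.
have E k l : fock_ip (fun z : C => z ^+ k) (fun z => z ^+ l) = cmom k l 0 0.
  by apply: eq_gauss_integral => z; rewrite /cmono !expr0 !mulr1 conjcX.
rewrite E; elim: n m => [|n ih] [|m]; rewrite ?cmomS ?mul0r//=.
- rewrite cmom00 /M gmom_int0 -expr2 sqr_sqrtr ?pi_ge0// mulVf ?gt_eqF ?pi_gt0//.
- rewrite -E (_ : fock_ip _ _ = conjc (cmom m.+1 0 0 0)).
    by rewrite cmomS mul0r conjc0.
  rewrite /cmom -(gauss_integral_conj (cint_cmono m.+1 0 0 0)); apply: eq_gauss_integral => z.
  by rewrite /cmono !expr0 !mulr1 !mul1r !conjcX.
- rewrite ih eqSS; case: eqP => [->|_]; last by rewrite mulr0.
  by rewrite factS natrM.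
Qed.

End Moments.

(** * Entire functions of Gaussian growth and the reproducing property *)

Section GaussianGrowth.
Variable R : realType.
Local Notation C := R[i].
Local Notation Re := (@complex.Re R).
Local Notation Im := (@complex.Im R).
Local Notation mR := (measurableTypeR R).
Local Notation area := (@lebesgue_measure R \x @lebesgue_measure R)%E.
Implicit Types f g h : C -> C.

Lemma fock_L2 f : fock f -> L2 f.
Proof.
move=> [/entire_ccont/ccont_cmeas mf fi]; split => //.
apply/integrableP; split; first exact: measurable_ewt (cmeas_sqr_normc mf).
apply: le_lt_trans fi; rewrite le_eqVlt; apply/orP; left; apply/eqP.
apply: eq_integral => w _.
by rewrite /= ger0_norm// mulr_ge0 ?sqr_ge0 ?gauss_density_ge0.
Qed.

Lemma L2_fock f : entire f -> L2 f -> fock f.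
Proof.
move=> ef [_ /integrableP[_ fi]]; split => //.
apply: le_lt_trans fi; rewrite le_eqVlt; apply/orP; left; apply/eqP.
apply: eq_integral => w _.
by rewrite /= ger0_norm// mulr_ge0 ?sqr_ge0 ?gauss_density_ge0.
Qed.

Lemma fock_normE f : fock_norm f = Num.sqrt (nrm2 f).
Proof. by rewrite /fock_norm ip_self. Qed.

Lemma nrm2_eq0 f : ccont f -> L2 f -> nrm2 f = 0 -> forall z, f z = 0.
Proof.
move=> cf [mf nf] f0 z; apply/eqP; rewrite -normc_eq0; apply/negPn/negP => fz.
have e0 : 0 < normc (f z) / 2 by rewrite divr_gt0// lt_def fz normc_ge0.
have [d d0 hd] := cf z _ e0.
(* A square of positive area within distance [d] of [z], on which [f] differs from [f z] by at most
   half of [|f z|]. The integrand is non-zero there, so the square would lie in a null set. *)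
pose B : set (mR * mR) := `[Re z, Re z + d / 2]%classic `*` `[Im z, Im z + d / 2]%classic.
have mB : measurable B by apply: measurableX; exact: measurable_itv.
have B0 : (0 < area B)%E.
  rewrite product_measure1E; [|exact: measurable_itv|exact: measurable_itv].
  have mI (a : R) : @lebesgue_measure R `[a, a + d / 2]%classic = (d / 2)%:E.
    by rewrite lebesgue_measure_itv /= lte_fin ltrDl divr_gt0// -EFinB addrAC subrr add0r.
  rewrite (_ : (_ * _)%E = ((d / 2)%:E * (d / 2)%:E)%E); last by congr (_ * _)%E; exact: mI.
  by rewrite -EFinM lte_fin mulr_gt0// divr_gt0.
have i0 : (\int[area]_(w in [set: mR * mR]) `|(wt (fun z => normc (f z) ^+ 2) w)%:E| = 0)%E.
  rewrite (_ : (\int[area]_(w in _) _)%E = (\int[area]_(w in [set: mR * mR]) (wt (fun z => normc (f z) ^+ 2) w)%:E)%E).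
    by rewrite -(fineK (integrable_fin_num measurableT nf)) -[X in X%:E]/(nrm2 f) f0.
  apply: eq_integral => w _; rewrite /= ger0_norm// mulr_ge0 ?sqr_ge0 ?gauss_density_ge0//.
have /(ae_eq_integral_abs _ measurableT (measurable_ewt (cmeas_sqr_normc mf))) [N [mN N0 subN]] := i0.
have BN : B `<=` N.
  move=> [x y] [/= xB yB]; apply: subN => /= /(_ I) /eqP.
  rewrite eqe mulf_eq0 (gt_eqF (gauss_density_gt0 _)) orbF sqrf_eq0 normc_eq0 => /eqP fxy.
  have := hd ((x - Re z) +i* (y - Im z)).
  rewrite (_ : z + _ = pt (x, y)); last by apply: eqC; rewrite ?ReD ?ImD /=; ring.
  rewrite fxy sub0r normcN => H.
  have /H : normc ((x - Re z) +i* (y - Im z)) <= d.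
    apply: le_trans (normc_le_ReIm _) _; rewrite /=.
    move: xB yB; rewrite !in_itv /= => /andP[x1 x2] /andP[y1 y2].
    rewrite !ger0_norm ?subr_ge0//; lra.
  by have := normc_ge0 (f z); move: e0; lra.
have := le_measure area; move=> /(_ B N); rewrite !inE => /(_ mB mN BN).
move=> h; have E : (area N <= 0)%E by rewrite le_eqVlt; apply/orP; left; apply/eqP; exact: N0.
by have := lt_le_trans B0 (le_trans h E); rewrite ltxx.
Qed.

Lemma ip_dct (u : nat -> C -> C) f h (G : C -> R) : (forall n, cmeas (u n)) ->
  (forall z, ccvg (u ^~ z) (f z)) -> (forall n z, normc (u n z) <= G z) ->
  intg (fun z => G z ^+ 2) -> L2 h ->
  [/\ L2 f, forall n, L2 (u n) & ccvg (fun n => fock_ip (u n) h) (fock_ip f h)].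
Proof.
move=> mu cu uG iG Lh.
have mf := cmeas_cvg mu cu.
have fG z : normc (f z) <= G z by apply: ccvg_le (cu z) _ => n; exact: uG.
have G0 z : 0 <= G z by rewrite (le_trans (normc_ge0 _) (fG z)).
split; [exact: L2_le mf iG fG|by move=> n; exact: L2_le (mu n) iG (uG n)|].
apply: (@gauss_integral_dct _ _ _ (fun z => G z ^+ 2 + normc (h z) ^+ 2)).
- by move=> n; apply: cmeasM => //; apply: cmeas_conj; exact: Lh.1.
- move=> z; apply: (@ccvg_eq _ (fun n => conjc (h z) * u n z)); first by move=> n; rewrite mulrC.
  by rewrite mulrC; apply: ccvgZ; exact: cu.
- move=> n z; rewrite normcM normc_conj.
  apply: le_trans (ler_wpM2r (normc_ge0 _) (uG n z)) _.
  have := sqr_ge0 (G z - normc (h z)); have := sqr_ge0 (G z); have := sqr_ge0 (normc (h z)); nra.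
- by apply: intgD => //; exact: Lh.2.
Qed.

(** Completing the square: a linear term is absorbed by any increase of the quadratic rate. This
    keeps [gfun] stable under multiplication by [z] and differentiation, with [r] moved half-way to
    1. *)
Lemma expR_quad_le (p r r' : R) : r < r' -> exists2 A, 0 < A & forall x : R,
  expR (p * x + r * x ^+ 2 / 2) <= A * expR (r' * x ^+ 2 / 2).
Proof.
move=> rr; pose d := r' - r; have d0 : 0 < d by rewrite subr_gt0.
exists (expR (p ^+ 2 / (2 * d))); first exact: expR_gt0.
move=> x; rewrite -expRD ler_expR -subr_ge0.
rewrite (_ : _ - _ = (p - d * x) ^+ 2 / (2 * d)); first by rewrite divr_ge0 ?sqr_ge0 ?mulr_ge0 ?ltW.
by rewrite /d; field; rewrite subr_eq0 gt_eqF.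
Qed.

Lemma intg_quad (p r : R) : r < 1 ->
  intg (fun z : C => expR (p * normc z + r * normc z ^+ 2 / 2) ^+ 2).
Proof.
move=> r1; have rr : r < (1 + r) / 2 by lra.
have [A A0 hA] := expR_quad_le p rr.
have r'1 : (1 + r) / 2 < 1 by lra.
apply: intg_le (intgZ (A ^+ 2) (intg_envelope r'1)).
  apply: measurable_funX; apply: measurableT_comp => //; apply: measurable_funD.
    by apply: measurable_funM; [exact: measurable_cst|exact: cmeas_normc (cmeas_id R)].
  apply: measurable_funM; last exact: measurable_cst.
  apply: measurable_funM; [exact: measurable_cst|].
  exact: cmeas_sqr_normc (cmeas_id R).
move=> z; rewrite ger0_norm ?sqr_ge0//.
have h := hA (normc z); have e0 := expR_ge0 (p * normc z + r * normc z ^+ 2 / 2).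
apply: (@le_trans _ _ ((A * expR ((1 + r) / 2 * normc z ^+ 2 / 2)) ^+ 2)).
  by rewrite lerXn2r ?nnegrE// (le_trans e0).
rewrite exprMn -expRM_natl; apply: ler_wpM2l; first exact: sqr_ge0.
by rewrite ler_expR; lra.
Qed.

(* Such a series converges in the Gaussian L2 norm, so inner products can be taken
   term by term. *)
Definition gfun (c : nat -> C) f := pser c f /\ exists A r : R,
  [/\ 0 < A, r < 1 & abs_pser_le c (fun x => A * expR (r * x ^+ 2 / 2))].

Lemma cmeas_psum (c : nat -> C) N : cmeas (fun z => \sum_(k < N) c k * z ^+ k).
Proof.
elim: N => [|N ih]; first by under eq_fun do rewrite big_ord0; exact: cmeas_cst.
under eq_fun do rewrite big_ord_recr /=; apply: cmeasD => //.
by apply: cmeasM; [exact: cmeas_cst|exact: cmeasX (cmeas_id R)].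
Qed.

Lemma gfun_ip c f h : gfun c f -> L2 h ->
  L2 f /\ ccvg (fun N => \sum_(k < N) c k * fock_ip (fun z => z ^+ k) h) (fock_ip f h).
Proof.
move=> [cf [A [r [A0 r1 cA]]]] Lh.
have uG N z : normc (\sum_(k < N) c k * z ^+ k) <= A * expR (0 * normc z + r * normc z ^+ 2 / 2).
  rewrite mul0r add0r (le_trans (normc_sum _ _))// (le_trans _ (cA _ (normc_ge0 z) N))//.
  by apply: ler_sum => k _; rewrite normcM normcX.
have iG : intg (fun z : C => (A * expR (0 * normc z + r * normc z ^+ 2 / 2)) ^+ 2).
  by under eq_fun do rewrite exprMn; exact/intgZ/intg_quad.
have [Lf _ cvg_ip] := ip_dct (cmeas_psum c) cf uG iG Lh.
split=> //; apply: ccvg_eq cvg_ip => N; rewrite ip_suml// => k.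
have [] := ip_dct (u := fun _ z => z ^+ k) (f := fun z => z ^+ k)
  (G := fun z : C => (k`!%:R * expR (1 * normc z + 0 * normc z ^+ 2 / 2))) _ _ _ _ Lh => //.
- by move=> _; exact: cmeasX (cmeas_id R).
- by move=> z; exact: ccvg_cst.
- by move=> _ z; rewrite normcX mul1r !mul0r addr0 exprn_le_expR ?normc_ge0.
- by under eq_fun do rewrite exprMn; exact/intgZ/intg_quad.
Qed.

Lemma gfun_L2 c f : gfun c f -> L2 f.
Proof. by move=> cf; have [] := gfun_ip cf (L2_0 R). Qed.

Lemma gfunD c d f g : gfun c f -> gfun d g -> gfun (fun k => c k + d k) (fun z => f z + g z).
Proof.
move=> [cf [A [r [A0 r1 cA]]]] [dg [B [s [B0 s1 dB]]]]; split.
  move=> z; apply: ccvg_eq (ccvgD (cf z) (dg z)) => N.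
  by rewrite -big_split /=; apply: eq_bigr => k _; rewrite mulrDl.
exists (A + B), (Num.max r s); split; [by rewrite addr_gt0|by rewrite gt_max r1|].
move=> x x0 N; rewrite mulrDl.
apply: (@le_trans _ _ (\sum_(k < N) normc (c k) * x ^+ k + \sum_(k < N) normc (d k) * x ^+ k)).
  rewrite -big_split /=; apply: ler_sum => k _.
  by rewrite -mulrDl ler_wpM2r ?exprn_ge0// normcD.
apply: lerD; [apply: le_trans (cA x x0 N) _|apply: le_trans (dB x x0 N) _];
  by rewrite ler_wpM2l ?(ltW A0) ?(ltW B0)// ler_expR ler_wpM2r// ler_wpM2r ?sqr_ge0// le_max lexx ?orbT.
Qed.

Lemma gfunZ a c f : gfun c f -> gfun (fun k => a * c k) (fun z => a * f z).
Proof.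
move=> [cf [A [r [A0 r1 cA]]]]; split.
  move=> z; apply: ccvg_eq (ccvgZ a (cf z)) => N.
  by rewrite mulr_sumr; apply: eq_bigr => k _; rewrite mulrA.
have a0 := normc_ge0 a.
exists ((normc a + 1) * A), r; split; [by rewrite mulr_gt0//; lra|by []|].
move=> x x0 N.
apply: (@le_trans _ _ (normc a * (\sum_(k < N) normc (c k) * x ^+ k))).
  by rewrite mulr_sumr; apply: ler_sum => k _; rewrite normcM mulrA.
apply: (@le_trans _ _ (normc a * (A * expR (r * x ^+ 2 / 2)))); first by rewrite ler_wpM2l// cA.
by rewrite mulrA ler_wpM2r ?expR_ge0// ler_wpM2r ?(ltW A0)//; lra.
Qed.

Definition shift_coef (c : nat -> C) k := if k is k1.+1 then c k1 else 0.

Lemma gfun_mulz c f : gfun c f -> gfun (shift_coef c) (fun z => z * f z).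
Proof.
move=> [cf [A [r [A0 r1 cA]]]].
have S N (x : C) : \sum_(k < N.+1) shift_coef c k * x ^+ k = x * \sum_(k < N) c k * x ^+ k.
  rewrite big_ord_recl /= mul0r add0r mulr_sumr; apply: eq_bigr => k _.
  by rewrite /bump /= add1n exprS; ring.
split; first by move=> z; apply/ccvg_shiftS/(ccvg_eq (fun N => esym (S N z))); exact: ccvgZ.
have rr : r < (1 + r) / 2 by lra.
have [B B0 hB] := expR_quad_le 1 rr.
exists (A * B), ((1 + r) / 2); split; [by rewrite mulr_gt0|lra|].
move=> x x0 N.
apply: (@le_trans _ _ (x * (\sum_(k < N) normc (c k) * x ^+ k))).
  case: N => [|N]; first by rewrite !big_ord0 mulr0.
  rewrite big_ord_recl (_ : normc (shift_coef c ord0) = 0); last exact: normc0.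
  rewrite mul0r add0r [in leRHS]big_ord_recr /= mulrDr mulr_sumr.
  rewrite ler_wpDr ?mulr_ge0 ?normc_ge0 ?exprn_ge0// le_eqVlt; apply/orP; left; apply/eqP.
  by apply: eq_bigr => k _; rewrite /bump /= add1n exprS; ring.
apply: (@le_trans _ _ (expR x * (A * expR (r * x ^+ 2 / 2)))).
  by rewrite ler_pM// ?sumr_ge0// => [k _||]; [rewrite mulr_ge0 ?normc_ge0 ?exprn_ge0|have := expR_ge1Dx x; lra|exact: cA].
rewrite mulrCA -[leRHS]mulrA ler_wpM2l ?(ltW A0)// -expRD -[X in expR (X + _)]mul1r.
exact: hB.
Qed.

Lemma sderiv_unique f z (l m : C) : sderiv f z l -> sderiv f z m -> l = m.
Proof.
move=> fl fm; apply/eqP; rewrite -subr_eq0 -normc_eq0; apply/negPn/negP => n0.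
have [K [d [K0 d0 hd]]] := sderivD fl (sderivM (sderiv_cst (-1) z) fm).
set n := normc _ in n0; have n0' : 0 < n by rewrite lt_def n0 normc_ge0.
have K1 : 0 < K + 1 by lra.
pose e := Num.min d (n / (K + 1)).
have e0 : 0 < e by rewrite lt_min d0 divr_gt0.
have ne : normc e%:C = e by rewrite normcR ger0_norm// ltW.
have := hd e%:C; rewrite ne ge_min lexx => /(_ isT).
rewrite (_ : _ - _ - _ = - (l - m) * e%:C); last by ring.
rewrite normcM normcN ne -/n => H.
have : e <= n / (K + 1) by rewrite /e ge_min lexx orbT.
rewrite ler_pdivlMr// => h; nra.
Qed.

Lemma gfun_deriv c f g : gfun c f -> (forall z, sderiv f z (g z)) -> gfun (dcoef c) g.
Proof.
move=> [cf [A [r [A0 r1 cA]]]] fg.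
have cD := abs_pser_le_dcoef cA.
have [g' hg'] := pser_exists cD.
have -> : g = g'.
  by apply/funext => z; exact: sderiv_unique (fg z) (sderiv_pser z cA cf hg').
have rr : r < (1 + r) / 2 by lra.
have [B B0 hB] := expR_quad_le r rr.
(* From [r (x + 1)^2 / 2 = r / 2 + (r x + r x^2 / 2)], the majorant of the derived series being
   taken at [x + 1]. *)
split=> //; exists (A * expR (r / 2) * B), ((1 + r) / 2); split; [by rewrite !mulr_gt0 ?expR_gt0|lra|].
move=> x x0 N; apply: le_trans (cD x x0 N) _.
rewrite -2![leRHS]mulrA ler_wpM2l ?(ltW A0)//.
apply: le_trans (ler_wpM2l (expR_ge0 _) (hB x)); rewrite -expRD ler_expR; lra.
Qed.

Lemma gfun_exp (a b : C) : normc b < 1 ->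
  gfun (hcoef a b) (fun z => cexp (a * z + b * z ^+ 2 / 2)).
Proof.
move=> b1; split; first exact: pser_hcoef.
have rr : normc b < (1 + normc b) / 2 by lra.
have [A A0 hA] := expR_quad_le (normc a) rr.
exists A, ((1 + normc b) / 2); split; [by []|lra|].
by move=> x x0 N; apply: le_trans (hA x); exact: abs_pser_le_hcoef.
Qed.

Lemma L2X k : L2 (fun z : C => z ^+ k).
Proof.
have [] := ip_dct (u := fun _ z => z ^+ k) (f := fun z => z ^+ k)
  (G := fun z : C => (k`!%:R * expR (1 * normc z + 0 * normc z ^+ 2 / 2))) _ _ _ _ (L2_0 R) => //.
- by move=> _; exact: cmeasX (cmeas_id R).
- by move=> z; exact: ccvg_cst.
- by move=> _ z; rewrite normcX mul1r !mul0r addr0 exprn_le_expR ?normc_ge0.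
- by under eq_fun do rewrite exprMn; exact/intgZ/intg_quad.
Qed.

Lemma gfun_monomial c f k : gfun c f -> fock_ip (fun z => z ^+ k) f = k`!%:R * conjc (c k).
Proof.
move=> cf; have [Lf h] := gfun_ip cf (L2X k).
rewrite (ip_conj Lf (L2X k)) -[RHS]conjcK; congr conjc.
(* The partial sums are constant for [n > k]; the comparison sequence is the error itself before
   that and 0 afterwards. *)
apply: (ccvg_unique h); apply: (@ccvg_squeeze _ _ _ (fun n => if (n <= k)%N then
  normc (\sum_(j < n) c j * fock_ip (fun z => z ^+ j) (fun z => z ^+ k) - conjc (k`!%:R * conjc (c k)))
  else 0)).
  move=> n; case: leqP => // kn.
  rewrite (bigD1 (Ordinal kn)) //= big1 ?addr0.
    rewrite monomial_ip eqxx conjcM conjcK mulrC (_ : conjc k`!%:R = k`!%:R) ?subrr ?normc0//.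
    exact: conjc_nat.
  move=> i ik; rewrite monomial_ip ifF ?mulr0//.
  by apply: contraNF ik => /eqP e; apply/eqP/val_inj.
apply: cvg_near_cst; near=> n; rewrite leqNgt ifF//; apply/negbTE; rewrite negbK.
by near: n; exact: nbhs_infty_gt.
Unshelve. all: by end_near. Qed.

(* Multiplication by [z] is the adjoint of differentiation: the only integral
   identity behind all the recursions below. *)
Lemma gfun_adjoint c d f g g' : gfun c f -> gfun d g -> (forall z, sderiv g z (g' z)) ->
  fock_ip (fun z => z * f z) g = fock_ip f g'.
Proof.
move=> cf dg gg'; have dg' := gfun_deriv dg gg'.
have [_ h1] := gfun_ip (gfun_mulz cf) (gfun_L2 dg).
have [_ h2] := gfun_ip cf (gfun_L2 dg').
apply: (ccvg_unique h1); apply: ccvg_shiftS; apply: ccvg_eq h2 => N.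
rewrite [RHS]big_ord_recl /= mul0r add0r; apply: eq_bigr => k _.
rewrite (gfun_monomial _ dg') (gfun_monomial _ dg) /bump /= add1n factS natrM conjcM.
by rewrite (_ : conjc k.+1%:R = k.+1%:R); [ring|exact: conjc_nat].
Qed.

End GaussianGrowth.

(** * Gaussian kernels, the reproducing property and orthonormal sums *)

Section Reproducing.
Variable R : realType.
Local Notation C := R[i].
Implicit Types f g h : C -> C.

Lemma conjc_sum (I : Type) (s : seq I) (F : I -> C) :
  conjc (\sum_(i <- s) F i) = \sum_(i <- s) conjc (F i).
Proof. exact: rmorph_sum. Qed.

(** [gker 0 (conjc z)] is the reproducing kernel at [z], [gker gam 0] the lowest Hermite function,
    and the kernel of the operator in [w] is, up to a factor in [z], the conjugate of some
    [gker b a]. *)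
Definition gker (b a w : C) : C := cexp (a * w + b * w ^+ 2 / 2).

Lemma normc_cexp_quad (a b w : C) :
  normc (gker b a w) <= expR (normc a * normc w + normc b * normc w ^+ 2 / 2).
Proof. exact: pser_norm_le w (abs_pser_le_hcoef a b) (pser_hcoef a b). Qed.

Lemma gfun_gker (b a : C) : normc b < 1 -> gfun (hcoef a b) (gker b a).
Proof. exact: gfun_exp. Qed.

Lemma L2_gker (b a : C) : normc b < 1 -> L2 (gker b a).
Proof. by move=> /(gfun_gker a)/gfun_L2. Qed.

Lemma cmeas_gker (b a : C) : cmeas (gker b a).
Proof. exact: cmeas_cvg (cmeas_psum (hcoef a b)) (pser_hcoef a b). Qed.

(** Only the factor [gker b a] is expanded; the Gaussian [gker q 0] stays intact. The partial sums
    are dominated by an exponential of rate [|b| + |q|], which is why this sum has to be below 1. *)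
Lemma gker_expand (a b q : C) h : normc b + normc q < 1 -> L2 h ->
  (forall k, L2 (fun w => w ^+ k * gker q 0 w)) /\
  ccvg (fun N => \sum_(k < N) hcoef a b k * fock_ip (fun w => w ^+ k * gker q 0 w) h)
    (fock_ip (gker (b + q) a) h).
Proof.
move=> bq Lh; have q1 : normc q < 1 by have := normc_ge0 b; lra.
have Lk k : L2 (fun w => w ^+ k * gker q 0 w).
  elim: k => [|k ih]; first by under eq_fun do rewrite expr0 mul1r; exact: L2_gker.
  suff [c hc] : exists c, gfun c (fun w => w ^+ k.+1 * gker q 0 w) by exact: gfun_L2 hc.
  elim: k.+1 => [|j [c hc]].
    by exists (hcoef 0 q); under eq_fun do rewrite expr0 mul1r; exact: gfun_gker.
  exists (shift_coef c); have := gfun_mulz hc.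
  by under eq_fun do rewrite mulrA -exprS.
split=> //.
pose u N w := (\sum_(k < N) hcoef a b k * w ^+ k) * gker q 0 w.
have mu N : cmeas (u N) by apply: cmeasM; [exact: cmeas_psum|exact: cmeas_gker].
have cu z : ccvg (u ^~ z) (gker (b + q) a z).
  have -> : gker (b + q) a z = gker q 0 z * gker b a z.
    by rewrite /gker -cexpD; congr cexp; ring.
  by apply: ccvg_eq (ccvgZ (gker q 0 z) (pser_hcoef a b z)) => N; rewrite mulrC.
have uG N z : normc (u N z) <= expR (normc a * normc z + (normc b + normc q) * normc z ^+ 2 / 2).
  rewrite /u normcM (_ : (_ + _ / 2) = (normc a * normc z + normc b * normc z ^+ 2 / 2) +
     (0 * normc z + normc q * normc z ^+ 2 / 2)); last by ring.
  rewrite expRD ler_pM ?normc_ge0//.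
    rewrite (le_trans (normc_sum _ _))// (le_trans _ (abs_pser_le_hcoef a b (normc_ge0 z) N))//.
    by apply: ler_sum => k _; rewrite normcM normcX.
  by have := normc_cexp_quad 0 q z; rewrite normc0.
have [_ _ cvgi] := ip_dct mu cu uG (intg_quad _ bq) Lh.
apply: ccvg_eq cvgi => N;
rewrite -(ip_suml (index_enum 'I_N) (fun k : 'I_N => hcoef a b k) (fun k : 'I_N => Lk k) Lh).
apply: eq_gauss_integral => w; congr (_ * _).
by rewrite /u mulr_suml; apply: eq_bigr => k _; rewrite mulrA.
Qed.

Lemma herm_r0 (T : comPzRingType) (p : T) k : herm p 0 k = p ^+ k.
Proof.
elim/nat_ind2 : k => [||k h1 h2]; rewrite ?expr0 ?expr1 ?herm1//.
by rewrite hermSS h2 !mul0r addr0 -exprS.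
Qed.

Lemma conjc_natr n : conjc (n%:R : C) = n%:R.
Proof. exact: conjc_nat. Qed.

Lemma conj_hcoef (p r : C) k : conjc (hcoef p r k) = hcoef (conjc p) (conjc r) k.
Proof.
rewrite /hcoef conjcM conjcV conjc_natr; congr (_ / _).
elim/nat_ind2 : k => [||k h1 h2]; [exact: conjc1|by rewrite !herm1|].
by rewrite !hermSS conjcD !conjcM h1 h2 conjc_natr.
Qed.

Lemma hcoef_r0 (p : C) k : hcoef p 0 k = p ^+ k / k`!%:R.
Proof. by rewrite /hcoef herm_r0. Qed.

(** Pairing [h] with the expanded kernel gives an explicit power series in [z], to which
    [sderiv_pser] applies. *)
Lemma gker_ip_entire (b al : C) h : normc b < 1 -> L2 h ->
  entire (fun z => fock_ip h (gker b (conjc (al * z)))).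
Proof.
move=> b1 Lh.
have b1' : normc (0 : C) + normc b < 1 by rewrite normc0 add0r.
have Lk := (gker_expand 0 b1' Lh).1.
pose kb k w := w ^+ k * gker b 0 w : C.
pose d k := al ^+ k / k`!%:R * fock_ip h (kb k).
have dF : pser d (fun z => fock_ip h (gker b (conjc (al * z)))).
  move=> z; have [_ H] := gker_expand (conjc (al * z)) b1' Lh.
  rewrite add0r in H.
  rewrite (ip_conj (L2_gker (conjc (al * z)) b1) Lh).
  apply: ccvg_eq (ccvg_conj H) => N; rewrite conjc_sum; apply: eq_bigr => k _.
  rewrite [LHS]conjcM /d (ip_conj (Lk k) Lh) conj_hcoef conjcK conjc0 hcoef_r0 exprMn.
  by rewrite /kb; ring.
(* [V x] is the squared norm of a majorant taken at twice the argument. The doubling leaves a factor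
   [2^-k] in the k-th term, and the geometric sum is the constant 2 below. *)
pose V x := IG (fun w : C => expR ((2 * normc al * x) * normc w + normc b * normc w ^+ 2 / 2) ^+ 2).
have cE : abs_pser_le d (fun x => 2 * Num.sqrt (nrm2 h * V x)).
  move=> x x0 N.
  have t0 : 0 <= 2 * normc al * x by rewrite !mulr_ge0 ?normc_ge0.
  have term k : normc (d k) * x ^+ k <= 2^-1 ^+ k * Num.sqrt (nrm2 h * V x).
    have -> : normc (d k) * x ^+ k = 2^-1 ^+ k * normc (fock_ip h (fun w => (((2 * normc al * x) ^+ k / k`!%:R)%:C * kb k w))).
      rewrite (ipZr _ (Lk k) Lh) [X in _ = _ * X]normcM normc_conj normcR ger0_norm ?divr_ge0 ?exprn_ge0//.
      rewrite /d !normcM normcV normcX normc_nat !exprMn.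
      have : (2 : R)^-1 ^+ k * 2 ^+ k = 1 by rewrite -exprMn mulVf ?expr1n.
      move: (fock_ip _ _) (2^-1 ^+ k) (2 ^+ k) => F u v uv.
      transitivity ((u * v) * (normc al ^+ k / k`!%:R * normc F * x ^+ k)); last by ring.
      by rewrite uv mul1r.
    rewrite ler_wpM2l ?exprn_ge0// -[leLHS]ger0_norm ?normc_ge0// -sqrtr_sqr ler_wsqrtr//.
    apply: le_trans (cauchy_schwarz Lh (L2Z _ (Lk k))) _.
    rewrite ler_wpM2l ?nrm2_ge0// IG_le//; [exact: (L2Z _ (Lk k)).2|exact: intg_quad|].
    move=> z; rewrite lerXn2r ?nnegrE ?normc_ge0 ?expR_ge0//.
    rewrite normcM normcR /kb normcM normcX mulrA expRD ler_pM ?mulr_ge0 ?exprn_ge0 ?normc_ge0//.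
      rewrite ger0_norm ?divr_ge0 ?exprn_ge0// mulrAC -exprMn ler_pdivrMr ?ltr0n ?fact_gt0//.
      by rewrite (mulrC (expR _)) exprn_le_expR// mulr_ge0 ?normc_ge0.
    by have := normc_cexp_quad 0 b z; rewrite normc0 mul0r add0r.
  apply: (@le_trans _ _ (\sum_(k < N) 2^-1 ^+ k * Num.sqrt (nrm2 h * V x))).
    exact: ler_sum.
  rewrite -mulr_suml ler_wpM2r ?sqrtr_ge0//.
  elim: N => [|N ih]; first by rewrite big_ord0.
  by rewrite big_ord_recl expr0; under eq_bigr do rewrite exprS; rewrite -mulr_sumr; lra.
have [g hg] := pser_exists (abs_pser_le_dcoef cE).
by move=> z; exact: sderiv_derivable (sderiv_pser z cE dF hg).
Qed.

(* Stands in for membership in the Fock space: it implies it, and it passes to L2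
   limits without Cauchy's formula. *)
Definition pf f := L2 f /\ forall z, f z = fock_ip f (gker 0 (conjc z)).

Lemma normc00 : normc (0 : C) < 1. Proof. by rewrite normc0. Qed.

Lemma pf_L2 f : pf f -> L2 f. Proof. by case. Qed.

Lemma pf_fock f : pf f -> fock f.
Proof.
move=> [Lf fE]; apply: L2_fock => //.
have -> : f = (fun z => fock_ip f (gker 0 (conjc (1 * z)))).
  by apply/funext => z; rewrite mul1r -fE.
exact: gker_ip_entire normc00 Lf.
Qed.

(** The k-th Taylor coefficient of the reproducing kernel carries the inverse factorial that cancels
    the squared norm of the monomial. *)
Lemma gfun_pf c f : gfun c f -> pf f.
Proof.
move=> cf; split; first exact: gfun_L2 cf.
move=> z; have [_ H] := gfun_ip cf (L2_gker (conjc z) normc00).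
apply: (ccvg_unique (cf.1 z)); apply: ccvg_eq H => N; apply: eq_bigr => k _.
rewrite (gfun_monomial _ (gfun_gker (conjc z) normc00)) conj_hcoef conjcK conjc0 hcoef_r0.
by congr (_ * _); rewrite mulrCA mulfV ?mulr1// pnatr_eq0 -lt0n fact_gt0.
Qed.

Lemma pf_sum (I : Type) (s : seq I) (c : I -> C) (F : I -> C -> C) :
  (forall i, pf (F i)) -> pf (fun z => \sum_(i <- s) c i * F i z).
Proof.
move=> pF; have LF i := pf_L2 (pF i); split; first exact: L2_sum.
move=> z; rewrite ip_suml//; last exact: L2_gker normc00.
by apply: eq_bigr => i _; rewrite -(pF i).2.
Qed.

Lemma pf_lim (u : nat -> C -> C) f : (forall n, pf (u n)) -> (forall z, ccvg (u ^~ z) (f z)) ->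
  L2 f -> nrm2 (fun z => u n z - f z) @[n --> \oo] --> 0 -> pf f.
Proof.
move=> pu cu Lf uf; split=> // z; apply: (ccvg_unique (cu z)).
apply: ccvg_eq (ip_cvgl (fun n => pf_L2 (pu n)) Lf (L2_gker (conjc z) normc00) uf) => n.
by rewrite -(pu n).2.
Qed.

Definition orthonormal_seq (e : nat -> C -> C) := (forall n, L2 (e n)) /\
  forall n m, fock_ip (e n) (e m) = if n == m then 1 else 0.

Lemma ip_psum (e : nat -> C -> C) (c : nat -> C) N k : orthonormal_seq e ->
  fock_ip (fun z => \sum_(n < N) c n * e n z) (e k) = if (k < N)%N then c k else 0.
Proof.
move=> [Le ee]; rewrite ip_suml//; case: ltnP => kN.
  rewrite (bigD1 (Ordinal kN)) //= ee eqxx mulr1 big1 ?addr0// => i ik.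
  by rewrite ee ifF ?mulr0//; apply: contraNF ik => /eqP e'; apply/eqP/val_inj.
rewrite big1// => i _; rewrite ee ifF ?mulr0//.
by apply/negbTE; rewrite neq_ltn (leq_trans (ltn_ord i) kN).
Qed.

Lemma nrm2_psum (e : nat -> C -> C) (c : nat -> C) M N : orthonormal_seq e ->
  nrm2 (fun z => \sum_(M <= k < N) c k * e k z) = \sum_(M <= k < N) normc (c k) ^+ 2.
Proof.
move=> [Le ee]; apply: (@complexI R); rewrite -ip_self ip_suml//; last exact: L2_sum.
rewrite rmorph_sum; apply: eq_big_nat => k /andP[Mk kN].
rewrite ip_sumr// (bigD1_seq k) ?mem_index_iota ?iota_uniq ?Mk//= big1_seq ?addr0; last first.
  by move=> i /andP[ik _]; rewrite ee ifF ?mulr0//; apply/negbTE; rewrite eq_sym.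
by rewrite ee eqxx mulr1 mul_conjE.
Qed.

Lemma nrm2_sub_psum (e : nat -> C -> C) f N : orthonormal_seq e -> L2 f ->
  nrm2 (fun z => f z - \sum_(k < N) fock_ip f (e k) * e k z) =
  nrm2 f - \sum_(k < N) normc (fock_ip f (e k)) ^+ 2.
Proof.
move=> oe Lf; have Le := oe.1.
pose s z := \sum_(k < N) fock_ip f (e k) * e k z.
have Ls : L2 s by exact: L2_sum.
have ns : nrm2 s = \sum_(k < N) normc (fock_ip f (e k)) ^+ 2.
  have := @nrm2_psum e (fun k => fock_ip f (e k)) 0 N oe; rewrite big_mkord => <-.
  by congr nrm2; apply/funext => z; rewrite big_mkord.
rewrite (_ : (fun z => _) = (fun z => f z + (-1) * s z)); last by apply/funext => z; rewrite mulN1r.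
rewrite nrm2D//; last exact: L2Z.
rewrite nrm2Z// ipZr// normcN normc1 expr1n mul1r.
have -> : fock_ip f s = (\sum_(k < N) normc (fock_ip f (e k)) ^+ 2)%:C.
  rewrite ip_sumr// rmorph_sum; apply: eq_bigr => k _; by rewrite mulrC mul_conjE.
by rewrite -ns conjcN (_ : conjc 1 = 1) ?mulN1r /=; [ring|exact: conjc1].
Qed.

Lemma bessel (e : nat -> C -> C) f N : orthonormal_seq e -> L2 f ->
  \sum_(k < N) normc (fock_ip f (e k)) ^+ 2 <= nrm2 f.
Proof. by move=> oe Lf; rewrite -subr_ge0 -nrm2_sub_psum// nrm2_ge0. Qed.

End Reproducing.

(** * Operators diagonal in two orthonormal sequences *)

Section DiagonalOperator.
Variable R : realType.
Local Notation C := R[i].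
Implicit Types f g h : C -> C.

(* Junk value [0] if the series diverges. *)
Definition csum (a : nat -> C) : C := xget 0 [set l | ccvg (fun N => \sum_(k < N) a k) l].

Lemma csumE (a : nat -> C) l : ccvg (fun N => \sum_(k < N) a k) l -> csum a = l.
Proof.
move=> al; rewrite /csum; case: xgetP => [x _ /= ax|/(_ l)//].
exact: ccvg_unique ax al.
Qed.

Lemma L2B f g : L2 f -> L2 g -> L2 (fun z => f z - g z).
Proof. by move=> Lf Lg; under eq_fun do rewrite -mulN1r; apply: L2D => //; exact: L2Z. Qed.

(* The reproducing property turns L2 convergence into pointwise convergence, so the
   sum can be taken pointwise; Fatou then controls its norm. *)
Lemma riesz_fischer (e : nat -> C -> C) (c : nat -> C) (M : R) :
  orthonormal_seq e -> (forall n, pf (e n)) ->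
  (forall N, \sum_(k < N) normc (c k) ^+ 2 <= M) ->
  let g := fun z => csum (fun k => c k * e k z) in
  [/\ pf g, forall z, ccvg (fun N => \sum_(k < N) c k * e k z) (g z),
      nrm2 g <= M &
      forall h, L2 h -> ccvg (fun N => \sum_(k < N) c k * fock_ip (e k) h) (fock_ip g h)].
Proof.
move=> oe pe cM g.
pose u N z := \sum_(k < N) c k * e k z.
have Lu N : L2 (u N) by apply: L2_sum => k; exact: oe.1.
have cu z : ccvg (u ^~ z) (g z).
  have [l hl] : exists l, ccvg (u ^~ z) l.
    (* [e k z] is the pairing of [e k] with the reproducing kernel at [z], so Bessel's inequality
       bounds the second factor. *)
    apply: (@abs_sum_cvg _ (fun k => c k * e k z) (M + nrm2 (gker 0 (conjc z)))) => N.
    apply: (@le_trans _ _ (\sum_(k < N) (normc (c k) ^+ 2 + normc (fock_ip (gker 0 (conjc z)) (e k)) ^+ 2))).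
      apply: ler_sum => k _; rewrite normcM (pe k).2 (ip_conj (L2_gker _ (normc00 R)) (oe.1 k)) normc_conj.
      exact: mulnormc_le.
    rewrite big_split; apply: lerD; first exact: cM.
    exact: bessel oe (L2_gker _ (normc00 R)).
  by rewrite /g (csumE hl).
have [S SE] := bounded_partial_sums_cvg (fun k => sqr_ge0 (normc (c k))) cM.
have SM : S <= M by apply: (cvgr_to_le SE); exact: nearW.
(* Fatou over the differences [u (N + K) - u K], whose squared norms are sums of [|c k|^2] over
   [K <= k < N + K]. *)
have tail K : L2 (fun z => g z - u K z) /\
    nrm2 (fun z => g z - u K z) <= S - \sum_(k < K) normc (c k) ^+ 2.
  apply: (@L2_fatou _ (fun N z => u (N + K)%N z - u K z)).
  - by move=> N; exact: L2B.
  - move=> z; apply: (@ccvgD _ (fun N => u (N + K)%N z) (fun=> - u K z)); last exact: ccvg_cst.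
    by have := cu z; rewrite /ccvg -(cvg_shiftn K).
  - move=> N; have -> : (fun z => u (N + K)%N z - u K z) = (fun z => \sum_(K <= k < N + K) c k * e k z).
      apply/funext => z; rewrite /u -!(big_mkord xpredT (fun k => c k * e k z)).
      by rewrite (big_cat_nat (leq0n K) (leq_addl N K)) /= addrAC subrr add0r.
    rewrite nrm2_psum// lerBrDl -!(big_mkord xpredT (fun k => normc (c k) ^+ 2)).
    rewrite -(big_cat_nat (leq0n K) (leq_addl N K)) /= big_mkord.
    apply: (cvgr_to_ge SE); near=> m.
    rewrite -!(big_mkord xpredT (fun k => normc (c k) ^+ 2)) [leRHS](big_cat_nat (leq0n (N + K)%N)) /=.
      by rewrite lerDl sumr_ge0// => k _; exact: sqr_ge0.
    by near: m; exact: nbhs_infty_ge.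
have Lg : L2 g.
  have [h _] := tail 0%N; move: h; rewrite /u; under eq_fun do rewrite big_ord0 subr0.
  exact.
have ng : nrm2 g <= M.
  have [_] := tail 0%N; rewrite /u big_ord0 subr0.
  by under [X in nrm2 X]eq_fun do rewrite big_ord0 subr0; move=> /le_trans; apply.
have nug : nrm2 (fun z => u n z - g z) @[n --> \oo] --> 0.
  apply: (squeeze_cvgr (f := cst 0) (h := fun n => S - \sum_(k < n) normc (c k) ^+ 2)).
  - apply: nearW => n; rewrite nrm2_ge0/=.
    rewrite (_ : nrm2 _ = nrm2 (fun z => g z - u n z)); first exact: (tail n).2.
    by apply: eq_IG => z; rewrite -normcN opprB.
  - exact: cvg_cst.
  - have := cvgB (cvg_cst S : cst S @ \oo --> S) SE; rewrite subrr; exact.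
split => //; first exact: pf_lim (fun n => pf_sum (index_enum 'I_n) (fun k : 'I_n => c k) (fun k : 'I_n => pe k)) cu Lg nug.
move=> h Lh; apply: ccvg_eq (ip_cvgl Lu Lg Lh nug) => N.
by rewrite ip_suml// => k; exact: oe.1.
Unshelve. all: by end_near. Qed.

(** [g] is the orthogonal projection of [h] on the closed span of [e]. *)
Lemma projection (e : nat -> C -> C) h : orthonormal_seq e -> (forall n, pf (e n)) -> L2 h ->
  exists g, [/\ pf g, forall k, fock_ip g (e k) = fock_ip h (e k) &
    forall f, L2 f -> ccvg (fun N => \sum_(k < N) fock_ip h (e k) * fock_ip (e k) f) (fock_ip g f)].
Proof.
move=> oe pe Lh; have cM N := bessel N oe Lh.
have [pg _ _ gf] := riesz_fischer (c := fun k => fock_ip h (e k)) oe pe cM.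
eexists; split; [exact: pg| |exact: gf].
move=> m; apply: (ccvg_unique (gf _ (oe.1 m))).
apply: (@ccvg_squeeze _ _ _ (fun n => if (n <= m)%N then
  normc (\sum_(k < n) fock_ip h (e k) * fock_ip (e k) (e m) - fock_ip h (e m)) else 0)).
  move=> n; case: leqP => // mn.
  by rewrite -(ip_suml (index_enum 'I_n) (fun k : 'I_n => fock_ip h (e k)) (fun k : 'I_n => oe.1 k) (oe.1 m))
    (ip_psum (fun k => fock_ip h (e k)) n m oe) mn subrr normc0.
apply: cvg_near_cst; near=> n; rewrite leqNgt ifF//; apply/negbTE; rewrite negbK.
by near: n; exact: nbhs_infty_gt.
Unshelve. all: by end_near. Qed.

Section Diagonal.
Variables (e e' : nat -> C -> C) (lam : nat -> R) (B : R).
Hypotheses (oe : orthonormal_seq e) (pe : forall n, pf (e n)).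
Hypotheses (oe' : orthonormal_seq e') (pe' : forall n, pf (e' n)).
Hypotheses (lam0 : forall n, 0 <= lam n) (lamB : forall n, lam n <= B).

(** A singular value decomposition with right vectors [e], left vectors [e'] and singular values
    [lam]. Swapping [e] and [e'] gives the adjoint; taking [e' = e] gives the modulus. *)
Definition diag f : C -> C := fun z => csum (fun k => (lam k)%:C * fock_ip f (e k) * e' k z).

Lemma diagE f z : diag f z = csum (fun k => (lam k)%:C * fock_ip f (e k) * e' k z).
Proof. by []. Qed.

Lemma diagP f : L2 f ->
  [/\ pf (diag f), forall z, ccvg (fun N => \sum_(k < N) (lam k)%:C * fock_ip f (e k) * e' k z) (diag f z),
      nrm2 (diag f) <= B ^+ 2 * nrm2 f &
      forall h, L2 h -> ccvg (fun N => \sum_(k < N) (lam k)%:C * fock_ip f (e k) * fock_ip (e' k) h)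
        (fock_ip (diag f) h)].
Proof.
move=> Lf; apply: (riesz_fischer (c := fun k => (lam k)%:C * fock_ip f (e k)) oe' pe') => N.
apply: (@le_trans _ _ (\sum_(k < N) B ^+ 2 * normc (fock_ip f (e k)) ^+ 2)).
  apply: ler_sum => k _; rewrite normcM normcR exprMn ler_wpM2r ?sqr_ge0//.
  by rewrite real_normK ?num_real// lerXn2r// nnegrE (le_trans (lam0 k)).
by rewrite -mulr_sumr ler_wpM2l ?sqr_ge0// bessel.
Qed.

Lemma diag_coef f m : L2 f -> fock_ip (diag f) (e' m) = (lam m)%:C * fock_ip f (e m).
Proof.
move=> Lf; have [_ _ _ H] := diagP Lf; apply: (ccvg_unique (H _ (oe'.1 m))).
apply: (@ccvg_squeeze _ _ _ (fun n => if (n <= m)%N then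
  normc (\sum_(k < n) (lam k)%:C * fock_ip f (e k) * fock_ip (e' k) (e' m) - (lam m)%:C * fock_ip f (e m)) else 0)).
  move=> n; case: leqP => // mn.
  by rewrite -(ip_suml (index_enum 'I_n) (fun k : 'I_n => (lam k)%:C * fock_ip f (e k)) (fun k : 'I_n => oe'.1 k) (oe'.1 m))
    (ip_psum (fun k => (lam k)%:C * fock_ip f (e k)) n m oe') mn subrr normc0.
apply: cvg_near_cst; near=> n; rewrite leqNgt ifF//; apply/negbTE; rewrite negbK.
by near: n; exact: nbhs_infty_gt.
Unshelve. all: by end_near. Qed.

Lemma diag_bounded : bounded_op diag.
Proof.
split.
- by move=> f /fock_L2/diagP[+ _ _ _]; exact: pf_fock.
- move=> c f g ff fg; have [Lf Lg] := (fock_L2 ff, fock_L2 fg).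
  apply/funext => z; apply: csumE.
  have [_ cf _ _] := diagP Lf; have [_ cg _ _] := diagP Lg.
  apply: ccvg_eq (ccvgD (ccvgZ c (cf z)) (cg z)) => N.
  rewrite mulr_sumr -big_split /=; apply: eq_bigr => k _.
  by rewrite ipDl ?ipZl//; [ring|exact: oe.1|exact: L2Z|exact: oe.1].
- exists `|B| => f /fock_L2 Lf; rewrite !fock_normE.
  have [_ _ H _] := diagP Lf.
  by rewrite -sqrtr_sqr -sqrtrM ?sqr_ge0// ler_wsqrtr.
Qed.

End Diagonal.

End DiagonalOperator.

Opaque diag.

(** * Singular values of a diagonal operator *)

Section SingularValues.
Variable R : realType.
Local Notation C := R[i].
Implicit Types f g h : C -> C.

Lemma derivable_lin (K : numFieldType) (c : K) (f g : K^o -> K^o) z :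
  derivable f z 1 -> derivable g z 1 -> derivable (fun z : K^o => c * f z + g z : K^o) z 1.
Proof.
move=> df dg.
have h : derivable (c \*: f) z 1 by apply: derivableZ.
by have := derivableD h dg.
Qed.

Lemma fock_lin (c : C) f g : fock f -> fock g -> fock (fun z => c * f z + g z).
Proof.
move=> ff fg; apply: L2_fock; last by apply: L2D; [apply: L2Z|]; exact: fock_L2.
move=> z; have [ef _] := ff; have [eg _] := fg.
exact: derivable_lin (ef z) (eg z).
Qed.

Lemma fock_scale (c : C) f : fock f -> fock (fun z => c * f z).
Proof.
move=> ff; have := fock_lin (c - 1) ff ff.
by congr fock; apply/funext => z; ring.
Qed.

Lemma fock_nrm2_eq0 f : fock f -> nrm2 f = 0 -> forall z, f z = 0.
Proof. by move=> ff; apply: nrm2_eq0 (fock_L2 ff); exact: entire_ccont ff.1. Qed.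

(** [bounded_op] states linearity for the shape [c f + g], which [(c - 1) f + f] fits. *)
Lemma op_scale (T : (C -> C) -> C -> C) c f : bounded_op T -> fock f ->
  T (fun z => c * f z) = (fun z => c * T f z).
Proof.
move=> [_ lin _] ff; have := lin (c - 1) f f ff ff.
rewrite (_ : (fun z => (c - 1) * f z + f z) = (fun z => c * f z)); last first.
  by apply/funext => z; ring.
by move=> ->; apply/funext => z; ring.
Qed.

Lemma has_dim_line (E : set (C -> C)) (v : C -> C) : v <> (fun=> 0) ->
  (forall f, E f <-> exists c : C, f = (fun z => c * v z)) -> has_dim E 1.
Proof.
move=> v0 EE; exists (fun=> v); split.
  by move=> _; apply/EE; exists 1; apply/funext => z; rewrite mul1r.
move=> f /EE[c ->]; exists [ffun=> c]; split.
  by apply/funext => z; rewrite big_ord1 ffunE.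
move=> d dE; apply/ffunP => i; rewrite ffunE ord1.
have [z vz] : exists z, v z <> 0 by apply/existsNP => H; apply: v0; exact/funext.
by have := congr1 (fun F => F z) dE; rewrite /= big_ord1 => /mulIf; apply; exact/eqP.
Qed.

(** [is_singular_values] provides some dimension [k], whose value has to be pinned down. Unique
    coordinates make the [e i] independent, and two multiples of [v] never are. *)
Lemma has_dim_line_eq (E : set (C -> C)) (v : C -> C) k : v <> (fun=> 0) ->
  (forall f, E f <-> exists c : C, f = (fun z => c * v z)) -> has_dim E k -> k = 1%N.
Proof.
move=> v0 EE [e [Ee eu]].
have E0 : E (fun=> 0) by apply/EE; exists 0; apply/funext => z; rewrite mul0r.
have free (c : {ffun 'I_k -> C}) : (forall z, \sum_(i < k) c i * e i z = 0) -> c = [ffun=> 0].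
  move=> c0; have [d [_ du]] := eu _ E0; transitivity d; last apply: du; first apply/esym/du.
    by apply/funext => z; rewrite c0.
  by apply/funext => z; rewrite big1// => i _; rewrite ffunE mul0r.
have e0 i : e i <> (fun=> 0).
  move=> ei; have := free [ffun j => (j == i)%:R] _ => H.
  have /ffunP/(_ i) : [ffun j => (j == i)%:R] = [ffun=> 0] :> {ffun 'I_k -> C}.
    apply: H => z; rewrite (bigD1 i)//= ei mulr0 add0r big1// => j /negbTE ji.
    by rewrite ffunE ji mul0r.
  by rewrite !ffunE eqxx => /eqP; rewrite oner_eq0.
case: k e Ee eu free e0 => [|[|k]] // e Ee eu free e0.
  have /eu[c [vc _]] : E v by apply/EE; exists 1; apply/funext => z; rewrite mul1r.
  by case: v0; rewrite vc; apply/funext => z; rewrite big_ord0.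
pose i1 : 'I_k.+2 := lift ord0 ord0.
have /EE[a ea] := Ee ord0; have /EE[b eb] := Ee i1.
(* With [e_0 = a v] and [e_1 = b v], the relation [b e_0 - a e_1 = 0] forces [a = 0], that is
   [e_0 = 0]. *)
have H : [ffun j => if j == ord0 then b else if j == i1 then - a else 0] = [ffun=> 0] :> {ffun 'I_k.+2 -> C}.
  apply: free => z; rewrite (bigD1 ord0)//= (bigD1 i1)//= !ffunE eqxx ea eb big1 => [|j /andP[/negbTE j0 /negbTE j1]].
    by rewrite /=; ring.
  by rewrite ffunE j0 j1 mul0r.
have /ffunP/(_ i1) := H; rewrite !ffunE /= => /eqP; rewrite oppr_eq0 => /eqP a0.
by case: (e0 ord0); rewrite ea a0; apply/funext => z; rewrite mul0r.
Qed.

Lemma has_dim_zero (E : set (C -> C)) : (forall f, E f <-> f = (fun=> 0)) -> has_dim E 0.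
Proof.
move=> EE; exists (fun _ _ => 0); split; first by case.
move=> f /EE ->; exists [ffun=> 0]; split.
  by apply/funext => z; rewrite big_ord0.
by move=> d _; apply/ffunP; case.
Qed.

Lemma has_dim_zero_eq (E : set (C -> C)) k : (forall f, E f <-> f = (fun=> 0)) ->
  has_dim E k -> k = 0%N.
Proof.
move=> EE; case: k => // k [e [Ee eu]].
have /eu[c [_ cu]] : E (fun=> 0) by apply/EE.
have e0 i : e i = (fun=> 0) by apply/EE.
have H (d : {ffun 'I_k.+1 -> C}) : c = d.
  by apply: cu; apply/funext => z; rewrite big1// => i _; rewrite e0 mulr0.
have /ffunP/(_ ord0) := etrans (esym (H [ffun=> 0])) (H [ffun=> 1]).
by rewrite !ffunE => /eqP; rewrite eq_sym oner_eq0.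
Qed.

Section Uniqueness.
Variables (e e' : nat -> C -> C) (lam : nat -> R).
Hypotheses (oe : orthonormal_seq e) (pe : forall n, pf (e n)).
Hypotheses (oe' : orthonormal_seq e') (pe' : forall n, pf (e' n)).
Hypotheses (lam_gt0 : forall n, 0 < lam n) (lam_dec : forall n, lam n.+1 < lam n).

Lemma lam_lt m n : (m < n)%N -> lam n < lam m.
Proof.
elim: n => // n ih; rewrite ltnS leq_eqVlt => /orP[/eqP ->//|/ih].
exact: lt_trans.
Qed.

Lemma lam_inj m n : lam m = lam n -> m = n.
Proof. by case: (ltngtP m n) => // /lam_lt + e0; rewrite e0 ltxx. Qed.

Lemma lam_ge0 n : 0 <= lam n. Proof. exact: ltW. Qed.

Lemma lam_leB n : lam n <= lam 0.
Proof. by case: n => // n; apply/ltW/lam_lt. Qed.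

Local Notation D := (diag e e' lam).
Local Notation DS := (diag e' e lam).
Local Notation DA := (diag e e lam).

Let DP := diagP oe oe' pe' lam_ge0 lam_leB.
Let DSP := diagP oe' oe pe lam_ge0 lam_leB.
Let DAP := diagP oe oe pe lam_ge0 lam_leB.

Lemma DA_coef f m : L2 f -> fock_ip (DA f) (e m) = (lam m)%:C * fock_ip f (e m).
Proof. exact: (diag_coef oe oe pe lam_ge0 lam_leB). Qed.

Lemma diag_adjoint f g : L2 f -> L2 g -> fock_ip (D f) g = fock_ip f (DS g).
Proof.
move=> Lf Lg; have [_ _ _ /(_ _ Lg) h1] := DP Lf.
have [/pf_L2 LS _ _ /(_ _ Lf) h2] := DSP Lg.
rewrite (ip_conj LS Lf); apply: (ccvg_unique h1); apply: ccvg_eq (ccvg_conj h2) => N.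
rewrite conjc_sum; apply: eq_bigr => k _.
rewrite !conjcM conjc_real -(ip_conj Lg (oe'.1 k)) -(ip_conj (oe.1 k) Lf).
by ring.
Qed.

Lemma diag_square f : L2 f -> DA (DA f) = DS (D f).
Proof.
move=> Lf; apply/funext => z; rewrite 2!diagE; congr csum; apply/funext => k.
by rewrite (diag_coef oe oe pe lam_ge0 lam_leB) // (diag_coef oe oe' pe' lam_ge0 lam_leB).
Qed.

Lemma diag_ge0 f : L2 f -> 0 <= fock_ip (DA f) f.
Proof.
move=> Lf; have [_ _ _ /(_ _ Lf) H] := DAP Lf.
have H' : ccvg (fun N => (\sum_(k < N) lam k * normc (fock_ip f (e k)) ^+ 2)%:C) (fock_ip (DA f) f).
  apply: ccvg_eq H => N; rewrite rmorph_sum; apply: eq_bigr => k _.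
  by rewrite (ip_conj Lf (oe.1 k)) -mulrA mul_conjE -rmorphM.
rewrite lecE; apply/andP; split.
  by rewrite (cvg_unique _ (ccvg_Im H') (cvg_cst (0 : R))) /=.
apply: (cvgr_to_ge (ccvg_Re H')); apply: nearW => N /=.
by rewrite sumr_ge0// => k _; rewrite mulr_ge0 ?sqr_ge0 ?lam_ge0.
Qed.

Variable T : (C -> C) -> C -> C.
Hypothesis TD : forall f, fock f -> T f = D f.

Lemma diag_is_adjoint : is_adjoint T DS.
Proof.
split; first exact: diag_bounded oe' oe pe lam_ge0 lam_leB.
by move=> f g ff fg; rewrite (TD ff) (diag_adjoint (fock_L2 ff) (fock_L2 fg)).
Qed.

Lemma diag_is_abs : is_abs T DA.
Proof.
split; first exact: diag_bounded oe oe pe lam_ge0 lam_leB.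
  by move=> f /fock_L2; exact: diag_ge0.
exists DS; first exact: diag_is_adjoint.
by move=> f ff; rewrite (TD ff) (diag_square (fock_L2 ff)).
Qed.

Lemma fock_T f : fock f -> fock (T f).
Proof. by move=> ff; rewrite (TD ff); have [/pf_fock] := DP (fock_L2 ff). Qed.

(** [is_abs] only provides some adjoint [S]. On [T f] it agrees with [DS], since the difference [g]
    pairs to 0 with itself by the two adjoint relations. *)
Lemma abs_square A f : is_abs T A -> fock f -> A (A f) = DA (DA f).
Proof.
move=> [_ _ [S [[Sf _ _] Sadj] AS]] ff; rewrite (AS _ ff) (diag_square (fock_L2 ff)) -(TD ff).
have fT := fock_T ff.
have fD : fock (DS (T f)) by have [/pf_fock] := DSP (fock_L2 fT).
have fS := Sf _ fT.
pose g z := (-1) * DS (T f) z + S (T f) z.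
have fg : fock g by exact: fock_lin.
have g0 : nrm2 g = 0.
  apply: (@complexI R); rewrite -ip_self {2}/g.
  rewrite ipDr; [|exact: L2Z (fock_L2 fD)|exact: fock_L2|exact: fock_L2].
  rewrite ipZr; [|exact: fock_L2|exact: fock_L2].
  rewrite -Sadj// -(diag_is_adjoint.2 _ _ fg fT) conjcN (_ : conjc 1 = 1) ?mulN1r ?addNr//.
  exact: conjc1.
apply/funext => z; have := fock_nrm2_eq0 fg g0 z.
by rewrite /g mulN1r addrC => /eqP; rewrite subr_eq0 => /eqP.
Qed.

(* Positivity makes [A + mu] injective, so the eigenvectors of [A] are those of [A^2];
   the uniqueness of the positive square root is not needed. *)
Lemma abs_eigen A f (mu : R) : is_abs T A -> 0 < mu -> fock f ->
  A f = (fun z => mu%:C * f z) <-> DA (DA f) = (fun z => (mu ^+ 2)%:C * f z).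
Proof.
move=> absA mu0 ff; have [bA Ap _] := absA; split=> [Af|].
  rewrite -(abs_square absA ff) Af op_scale// Af.
  by apply/funext => z; rewrite mulrA expr2 rmorphM.
rewrite -(abs_square absA ff) => AAf.
have fA : fock (A f) by have [Ak _ _] := bA; exact: Ak.
pose g z := - mu%:C * f z + A f z.
have fg : fock g by exact: fock_lin.
have Ag : A g = (fun z => - mu%:C * g z).
  have [_ lin _] := bA; rewrite /g lin// AAf.
  by apply/funext => z; rewrite expr2 rmorphM; ring.
have := Ap _ fg; rewrite Ag ipZl; [|exact: fock_L2|exact: fock_L2].
rewrite ip_self -rmorphN -rmorphM ler0c mulNr oppr_ge0 pmulr_rle0// => n0.
have {}n0 : nrm2 g = 0 by apply/eqP; rewrite eq_le n0 nrm2_ge0.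
apply/funext => z; have := fock_nrm2_eq0 fg n0 z.
by rewrite /g mulNr addrC => /eqP; rewrite subr_eq0 => /eqP.
Qed.

(** Pairing the equation with [e m] gives [(lam m ^ 2 - mu ^ 2) <f, e m> = 0]. *)
Lemma eigen_coef f (mu : R) m : fock f -> DA (DA f) = (fun z => (mu ^+ 2)%:C * f z) ->
  lam m ^+ 2 != mu ^+ 2 -> fock_ip f (e m) = 0.
Proof.
move=> ff E lm; have Lf := fock_L2 ff; have [/pf_L2 LA _ _ _] := DAP Lf.
have h1 := etrans (DA_coef m LA) (congr1 (fun x => (lam m)%:C * x) (DA_coef m Lf)).
have h2 := etrans (congr1 (fun F => fock_ip F (e m)) E) (ipZl _ Lf (oe.1 m)).
have := etrans (esym h1) h2; rewrite mulrA -(rmorphM (real_complex R)) -expr2.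
move/eqP; rewrite -subr_eq0 -mulrBl mulf_eq0 => /orP[|/eqP//].
by rewrite subr_eq0 (inj_eq (@complexI R)) (negbTE lm).
Qed.

Lemma DA_e n : DA (e n) = (fun z => (lam n)%:C * e n z).
Proof.
apply/funext => z; rewrite diagE; apply: csumE; apply: (@ccvg_squeeze _ _ _ (fun N => if (N <= n)%N then
  normc (\sum_(k < N) (lam k)%:C * fock_ip (e n) (e k) * e k z - (lam n)%:C * e n z) else 0)).
  move=> N; case: leqP => // nN.
  rewrite (bigD1 (Ordinal nN)) //= oe.2 eqxx mulr1 big1 ?addr0 ?subrr ?normc0//.
  move=> i ni; rewrite oe.2 ifF ?mulr0 ?mul0r//.
  by apply: contraNF ni => /eqP E; apply/eqP/val_inj.
apply: cvg_near_cst; near=> N; rewrite leqNgt ifF//; apply/negbTE; rewrite negbK.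
by near: N; exact: nbhs_infty_gt.
Unshelve. all: by end_near. Qed.

(** An eigenvector satisfies [lam n ^ 2 f = DA (DA f)], hence is the sum of a series in the [e k],
    and [eigen_coef] leaves the single term [k = n]. *)
Lemma eigenspace_lam A n f : is_abs T A ->
  fock_eigenspace A (lam n) f <-> exists c : C, f = (fun z => c * e n z).
Proof.
move=> absA; split=> [[ff]|[c ->]].
  move=> /(abs_eigen absA (lam_gt0 n) ff) E; exists (fock_ip f (e n)).
  have Lf := fock_L2 ff; have [/pf_L2 LA _ _ _] := DAP Lf.
  have l0 : (lam n ^+ 2)%:C != 0 :> C by rewrite (inj_eq (@complexI R) _ 0) expf_neq0// gt_eqF.
  apply/funext => z; apply: (mulfI l0); rewrite -[LHS]/((fun z => (lam n ^+ 2)%:C * f z) z) -E diagE.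
  apply: csumE; apply: (@ccvg_squeeze _ _ _ (fun N => if (N <= n)%N then
    normc (\sum_(k < N) (lam k)%:C * fock_ip (DA f) (e k) * e k z - (lam n ^+ 2)%:C * (fock_ip f (e n) * e n z)) else 0)).
    move=> N; case: leqP => // nN.
    rewrite (bigD1 (Ordinal nN)) //= big1 ?addr0.
      by rewrite (DA_coef n Lf) expr2 rmorphM !mulrA subrr normc0.
    move=> i ni; rewrite (DA_coef i Lf) (eigen_coef ff E) ?mulr0 ?mul0r//.
    rewrite eqrXn2 ?lam_ge0//; apply: contraNneq ni => /lam_inj E'; exact/eqP/val_inj.
  apply: cvg_near_cst; near=> N; rewrite leqNgt ifF//; apply/negbTE; rewrite negbK.
  by near: N; exact: nbhs_infty_gt.
have fe : fock (e n) by exact: pf_fock.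
have fc := fock_scale c fe.
split=> //; apply/(abs_eigen absA (lam_gt0 n) fc).
have bD := diag_bounded oe oe pe lam_ge0 lam_leB.
rewrite (op_scale c bD fe) DA_e.
rewrite (_ : (fun z => c * ((lam n)%:C * e n z)) = (fun z => (c * (lam n)%:C) * e n z)); last first.
  by apply/funext => z; rewrite mulrA.
rewrite (op_scale (c * (lam n)%:C) bD fe) DA_e; apply/funext => z.
by rewrite expr2 rmorphM; ring.
Unshelve. all: by end_near. Qed.

Lemma eigenspace_other A mu f : is_abs T A -> 0 < mu -> (forall n, lam n != mu) ->
  fock_eigenspace A mu f <-> f = (fun=> 0).
Proof.
move=> absA mu0 lmu; have m0 : (mu ^+ 2)%:C != 0 :> C.
  by rewrite (inj_eq (@complexI R) _ 0) expf_neq0// gt_eqF.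
have fock0 : fock (fun=> 0 : C).
  have := fock_scale 0 (pf_fock (pe 0)).
  by congr fock; apply/funext => z; rewrite mul0r.
split=> [[ff]|->].
  move=> /(abs_eigen absA mu0 ff) E.
  have Lf := fock_L2 ff.
  apply/funext => z; apply: (mulfI m0); rewrite -[LHS]/((fun z => (mu ^+ 2)%:C * f z) z) -E mulr0 diagE.
  apply: csumE; apply: ccvg_eq (ccvg_cst 0) => N.
  rewrite big1// => k _; rewrite (DA_coef k Lf) (eigen_coef ff E) ?mulr0 ?mul0r//.
  by rewrite eqrXn2 ?lam_ge0 ?ltW.
split=> //; apply/(abs_eigen absA mu0 fock0).
have bD := diag_bounded oe oe pe lam_ge0 lam_leB.
have D0 : DA (fun=> 0) = (fun=> 0).
  have := op_scale 0 bD fock0.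
  rewrite (_ : (fun z : C => 0 * (0 : C)) = (fun=> 0)); last by apply/funext => z; rewrite mul0r.
  by move=> ->; apply/funext => z; rewrite mul0r.
by rewrite !D0; apply/funext => z; rewrite mulr0.
Qed.

Lemma e_neq0 n : e n <> (fun=> 0).
Proof.
move=> en; have := oe.2 n n; rewrite eqxx ip_self /nrm2 en.
rewrite (_ : IG _ = 0) => [/eqP|]; first by rewrite eq_sym oner_eq0.
by rewrite -[RHS](IG0 R); apply: eq_IG => z; rewrite normc0 expr0n.
Qed.

Lemma lam_is_singular_values : is_singular_values T lam.
Proof.
exists DA; first exact: diag_is_abs.
split; [exact: lam_ge0|by apply/nonincreasing_seqP => n; exact/ltW|].
move=> mu mu0; have [[n nmu]|lmu] := pselect (exists n, lam n = mu).
  exists 1%N.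
    by apply: has_dim_line (e_neq0 (n := n)) _ => f; rewrite -nmu; exact: eigenspace_lam diag_is_abs.
  rewrite (_ : [set _ | _] = [set n]); first exact: card_set1.
  by apply/seteqP; split => m /=; [rewrite -nmu => /lam_inj|move=> ->].
have lmu' n : lam n != mu by apply/eqP => E; apply: lmu; exists n.
exists 0%N; first by apply: has_dim_zero => f; exact: eigenspace_other diag_is_abs mu0 lmu'.
rewrite II0 card_eq0; apply/eqP/seteqP; split => m //= E; exact: lmu (ex_intro _ m E).
Qed.

(** Multiplicities pin the sequence down: every [lam n] is attained by [lam'] exactly once, and
    every positive value of [lam'] is some [lam n]. Two non-increasing sequences so related agree,
    by strong induction. *)
Lemma singular_values_unique lam' : is_singular_values T lam' -> lam' = lam.
Proof.
move=> [A absA [lam'0 ni dim]].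
have hit n : exists2 i, lam' i = lam n & forall j, lam' j = lam n -> j = i.
  have [k dk ck] := dim _ (lam_gt0 n).
  have k1 := has_dim_line_eq (e_neq0 (n := n)) (fun f => eigenspace_lam n f absA) dk.
  move: ck; rewrite k1 => /eq_cardSP[i /= li]; rewrite II0 card_eq0 => /eqP/seteqP[h _].
  exists i => // j lj; apply: contrapT => ji; exact: (h j).
have range j : 0 < lam' j -> exists n, lam' j = lam n.
  move=> lj; apply: contrapT => H.
  have lmu n : lam n != lam' j by apply/eqP => E; apply: H; exists n.
  have [k dk ck] := dim _ lj.
  have k0 := has_dim_zero_eq (fun f => eigenspace_other f absA lj lmu) dk.
  by move: ck; rewrite k0 II0 card_eq0 => /eqP/seteqP[h _]; exact: (h j).
apply/funext => n; elim/ltn_ind: n => n ih.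
have [i li iu] := hit n.
(* Earlier positions hold other values, so [lam n] is attained at some [i >= n] and
   [lam' n >= lam n]; in particular [lam' n] is positive. *)
have ni_i : (n <= i)%N.
  rewrite leqNgt; apply/negP => i_n; have := ih i i_n; rewrite li => /lam_inj ni'.
  by rewrite -ni' ltnn in i_n.
have ge : lam n <= lam' n by rewrite -li; exact: ni.
have [m lm] := range n (lt_le_trans (lam_gt0 n) ge).
have [mn|nm] := ltnP m n.
  have [i' _ iu'] := hit m.
  by have := iu' n lm; rewrite -(iu' m (ih m mn)) => nm; rewrite nm ltnn in mn.
apply/eqP; rewrite eq_le ge andbT lm; case: (ltngtP n m) nm => // [/lam_lt/ltW//|->//].
Qed.

Lemma singular_valuesE : singular_values T = lam.
Proof.
rewrite /singular_values; case: xgetP => [l _ /singular_values_unique//|H].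
by case: (H lam); exact: lam_is_singular_values.
Qed.

Lemma T_bounded : bounded_op T.
Proof.
have [b1 b2 [M b3]] := diag_bounded oe oe' pe' lam_ge0 lam_leB.
split; first exact: fock_T.
  by move=> c f g ff fg; rewrite (TD (fock_lin c ff fg)) (TD ff) (TD fg); exact: b2.
by exists M => f ff; rewrite (TD ff); exact: b3.
Qed.

End Uniqueness.
End SingularValues.

(** * Compactness of diagonal operators whose entries tend to 0 *)

Section Compactness.
Variable R : realType.
Local Notation C := R[i].
Local Notation Re := (@complex.Re R).
Local Notation Im := (@complex.Im R).
Implicit Types f g h : C -> C.

(* Limits along one ultrafilter replace the extraction of successive subsequences. *)
Lemma bounded_ultra_limit (U : set_system nat) (x : nat -> R) (B : R) : UltraFilter U ->
  (forall n, `|x n| <= B) -> exists l : R, x @ U --> l.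
Proof.
move=> FU xB; have FX : UltraFilter (x @ U).
  split; first exact: fmap_proper_filter.
  move=> G FG sG; rewrite eqEsubset; split=> // A GA.
  have [//|h] := in_ultra_setVsetC (x @^-1` A) FU.
  have := @filterI _ _ FG _ _ GA (sG (~` A) h); rewrite setICr => G0.
  by have [] := @filter_ex _ _ FG _ G0.
have := @segment_compact R (- B) B; rewrite compact_ultra => /(_ _ FX).
have h : (x @ U) `[(- B), B]%classic.
  rewrite -[_ _]/(U (x @^-1` `[- B, B]%classic)); apply: filterS (@filterT _ U _) => n _.
  by rewrite /= in_itv /= -ler_norml.
by move=> /(_ h)[l [_ xl]]; exists l.
Qed.

(** The rate [1 / (j + 1)], uniform in [m <= j], is what [compact_diag] consumes. A set of the
    ultrafilter meets every tail, so each index can be taken beyond the previous one. *)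
Lemma diagonal_subsequence (x : nat -> nat -> C) (B : R) : (forall n m, normc (x n m) <= B) ->
  exists (k : nat -> nat) (c : nat -> C), {homo k : m n / (m < n)%N} /\
    forall j m, (m <= j)%N -> normc (x (k j) m - c m) <= j.+1%:R^-1.
Proof.
move=> xB; have [U [FU sU]] := ultraFilterLemma (@eventually_filter).
have hr m : exists l : R, (fun n => Re (x n m)) @ U --> l.
  by apply: bounded_ultra_limit (B) FU _ => n; exact: le_trans (normc_Re _) (xB n m).
have hi m : exists l : R, (fun n => Im (x n m)) @ U --> l.
  by apply: bounded_ultra_limit (B) FU _ => n; exact: le_trans (normc_Im _) (xB n m).
have [a ha] := choice hr; have [b hb] := choice hi.
pose c m := (a m +i* b m)%C.
have near1 (eps : R) m : 0 < eps -> U [set n | normc (x n m - c m) <= eps].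
  move=> e0; have e2 : 0 < eps / 2 by rewrite divr_gt0.
  have h1 : \forall n \near U, `|a m - Re (x n m)| < eps / 2 by have /cvgr_dist_lt := ha m; apply.
  have h2 : \forall n \near U, `|b m - Im (x n m)| < eps / 2 by have /cvgr_dist_lt := hb m; apply.
  apply: filterS2 h1 h2 => n u1 u2.
  rewrite /= (le_trans (normc_le_ReIm _))// ReD ImD ReN ImN /= distrC [X in _ + X]distrC; lra.
have nearj j : U [set n | forall m, (m <= j)%N -> normc (x n m - c m) <= j.+1%:R^-1].
  have e0 : 0 < j.+1%:R^-1 :> R by rewrite invr_gt0.
  suff h i : U [set n | forall m, (m <= i)%N -> normc (x n m - c m) <= j.+1%:R^-1] by exact: h.
  elim: i => [|i ih]; first by apply: filterS (near1 _ 0%N e0) => n + m; rewrite leqn0 => + /eqP ->.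
  apply: filterS2 ih (near1 _ i.+1 e0) => n h1 h2 m; rewrite leq_eqVlt => /orP[/eqP ->//|].
  exact: h1.
have [f hf] : exists f : nat -> nat -> nat, forall j N, (N < f j N)%N /\
    forall m, (m <= j)%N -> normc (x (f j N) m - c m) <= j.+1%:R^-1.
  have H j N : exists n, (N < n)%N /\ forall m, (m <= j)%N -> normc (x n m - c m) <= j.+1%:R^-1.
    have /(filterI (nearj j)) : U [set n | (N < n)%N] by apply: sU; exact: nbhs_infty_gt.
    by move=> /filter_ex[n [h1 h2]]; exists n.
  have [F hF] := choice (fun p : nat * nat => H p.1 p.2).
  by exists (fun j N => F (j, N)) => j N; exact: (hF (j, N)).
pose k := fix k j := if j is i.+1 then f i.+1 (k i) else f 0 0.
exists k, c; split; last by case=> [|j]; [exact: (hf 0 0).2|exact: (hf j.+1 (k j)).2].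
apply: homo_ltn => [? ? ?|j]; [exact: ltn_trans|exact: (hf j.+1 (k j)).1].
Qed.

Section CompactDiagonal.
Variables (e e' : nat -> C -> C) (lam : nat -> R).
Hypothesis oe : orthonormal_seq e.
Hypotheses (oe' : orthonormal_seq e') (pe' : forall n, pf (e' n)).
Hypotheses (lam_ge0 : forall n, 0 <= lam n) (lam_ni : nonincreasing_seq lam).
Hypothesis lam_cvg0 : lam @ \oo --> (0 : R).
Variable T : (C -> C) -> C -> C.
Hypothesis TD : forall f, fock f -> T f = diag e e' lam f.

Let lamB n : lam n <= lam 0. Proof. exact: lam_ni. Qed.

(** The [j + 1] coordinates up to [j] are within [1 / (j + 1)] of their limits; beyond [j] the
    weights are at most [lam j]. *)
Lemma compact_diag : bounded_op T -> compact_op T.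
Proof.
move=> bT; split=> // u hu.
have fu n : fock (u n) by have [] := hu n.
have Lu n : L2 (u n) by exact: fock_L2.
have nu n : nrm2 (u n) <= 1.
  have [_] := hu n; rewrite fock_normE -[leRHS]sqrtr1 ler_psqrt ?nnegrE ?nrm2_ge0//.
pose x n m := fock_ip (u n) (e m).
have xN n N : \sum_(m < N) normc (x n m) ^+ 2 <= 1.
  exact: le_trans (bessel N oe (Lu n)) (nu n).
have xB n m : normc (x n m) <= 1.
  rewrite -(ler_sqr (normc_ge0 _)) ?nnegrE// expr1n.
  apply: le_trans (xN n m.+1); rewrite big_ord_recr /= lerDr sumr_ge0// => i _; exact: sqr_ge0.
have [k [c [kmono kc]]] := diagonal_subsequence xB.
have xc m : ccvg (fun j => x (k j) m) (c m).
  apply: (@ccvg_squeeze _ _ _ (fun j => if (m <= j)%N then j.+1%:R^-1 else normc (x (k j) m - c m))).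
    by move=> j; case: leqP => // /(kc j m).
  have := @cvg_harmonic R; apply: cvg_trans; apply: near_eq_cvg.
  near=> j; rewrite ifT//; near: j; exact: nbhs_infty_ge.
have cN N : \sum_(m < N) normc (c m) ^+ 2 <= 1.
  have : (fun j => \sum_(m < N) normc (x (k j) m) ^+ 2) @ \oo --> \sum_(m < N) normc (c m) ^+ 2.
    elim: N => [|N ih]; first by rewrite big_ord0; under eq_fun do rewrite big_ord0; exact: cvg_cst.
    rewrite big_ord_recr /=; under eq_fun do rewrite big_ord_recr /=.
    have h := ccvg_normc (xc N); exact: cvgD ih (cvgM h h).
  by move=> /cvgr_to_le; apply; exact: nearW.
have lcN N : \sum_(m < N) normc ((lam m)%:C * c m) ^+ 2 <= lam 0 ^+ 2.
  apply: (@le_trans _ _ (\sum_(m < N) lam 0 ^+ 2 * normc (c m) ^+ 2)).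
    apply: ler_sum => m _; rewrite normcM normcR ger0_norm// exprMn ler_wpM2r ?sqr_ge0//.
    by rewrite lerXn2r ?nnegrE.
  by rewrite -mulr_sumr ler_piMr ?sqr_ge0.
have [pg gz _ _] := riesz_fischer (c := fun m => (lam m)%:C * c m) oe' pe' lcN.
set g := (fun z => csum _) in pg gz.
exists k, g; split=> //; first exact: pf_fock.
pose d j m := (lam m)%:C * (x (k j) m - c m).
(* The squares of [j + 1] errors [1 / (j + 1)] give the first term. For the second,
   [|x - c|^2 <= 2 |x|^2 + 2 |c|^2] with both sums at most 1 gives the factor 4. *)
have dN j N : \sum_(m < N) normc (d j m) ^+ 2 <= lam 0 ^+ 2 * j.+1%:R^-1 + 4 * lam j ^+ 2.
  have cnt M : \sum_(m < M) (if (m <= j)%N then j.+1%:R^-1 ^+ 2 else 0 : R) = (minn M j.+1)%:R * j.+1%:R^-1 ^+ 2.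
    elim: M => [|M ih]; first by rewrite big_ord0 min0n mul0r.
    rewrite big_ord_recr /= ih; case: leqP => Mj.
      by rewrite (minn_idPl (leqW Mj)) (minn_idPl (_ : (M < j.+1)%N))// -[in RHS]natr1 mulrDl mul1r.
    by rewrite addr0 (minn_idPr Mj) (minn_idPr (leqW Mj)).
  apply: (@le_trans _ _ (\sum_(m < N) (lam 0 ^+ 2 * (if (m <= j)%N then j.+1%:R^-1 ^+ 2 else 0) +
    lam j ^+ 2 * (2 * normc (x (k j) m) ^+ 2 + 2 * normc (c m) ^+ 2)))).
    apply: ler_sum => m _; rewrite normcM normcR ger0_norm// exprMn.
    have x2 := sqr_ge0 (normc (x (k j) m)); have c2 := sqr_ge0 (normc (c m)).
    case: leqP => mj.
      apply: (@le_trans _ _ (lam 0 ^+ 2 * j.+1%:R^-1 ^+ 2)); last first.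
        by rewrite lerDl mulr_ge0 ?sqr_ge0//; lra.
      by rewrite ler_pM ?sqr_ge0// lerXn2r ?nnegrE ?normc_ge0 ?invr_ge0// kc.
    rewrite mulr0 add0r ler_pM ?sqr_ge0// ?lerXn2r ?nnegrE//; first exact/lam_ni/ltnW.
    apply: (@le_trans _ _ ((normc (x (k j) m) + normc (c m)) ^+ 2)).
      by rewrite lerXn2r ?nnegrE ?normc_ge0 ?addr_ge0 ?normc_ge0// normcB.
    by have := sqr_ge0 (normc (x (k j) m) - normc (c m)); nra.
  rewrite big_split -!mulr_sumr cnt; apply: lerD.
    rewrite ler_wpM2l ?sqr_ge0// expr2 mulrA ler_piMl ?invr_ge0// ler_pdivrMr ?ltr0n// mul1r ler_nat.
    exact: geq_minr.
  rewrite mulrC ler_wpM2r ?sqr_ge0// big_split -!mulr_sumr.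
  rewrite -[leLHS]/(_ + _).
  have := xN (k j) N; have := cN N; lra.
have nj j : nrm2 (fun z => T (u (k j)) z - g z) <= lam 0 ^+ 2 * j.+1%:R^-1 + 4 * lam j ^+ 2.
  have [_ dz dM _] := riesz_fischer (c := d j) oe' pe' (dN j).
  rewrite (_ : (fun z => _) = (fun z => csum (fun m => d j m * e' m z)))//.
  apply/funext => z; apply/esym/csumE.
  have [_ /(_ z) hz _ _] := diagP oe oe' pe' lam_ge0 lamB (Lu (k j)).
  rewrite (TD (fu (k j))) -mulN1r.
  apply: ccvg_eq (ccvgD hz (ccvgZ (-1) (gz z))) => N.
  by rewrite mulr_sumr -big_split /=; apply: eq_bigr => m _; rewrite /d /x; ring.
apply: (squeeze_cvgr (f := cst 0) (h := fun j => Num.sqrt (lam 0 ^+ 2 * j.+1%:R^-1 + 4 * lam j ^+ 2))).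
- by apply: nearW => j; rewrite fock_normE sqrtr_ge0 ler_wsqrtr.
- exact: cvg_cst.
- rewrite -[X in _ --> X]sqrtr0; apply: continuous_cvg; first exact: sqrt_continuous.
  rewrite [X in _ --> X](_ : 0 = lam 0 ^+ 2 * 0 + 4 * 0 ^+ 2); last by ring.
  apply: cvgD; first by apply: cvgMl_tmp; exact: cvg_harmonic.
  by apply: cvgMl_tmp; exact: (cvgM lam_cvg0 lam_cvg0).
Unshelve. all: by end_near. Qed.

End CompactDiagonal.
End Compactness.

(** * Hermite functions *)

Section HermiteFunctions.
Variable R : realType.
Local Notation C := R[i].
Implicit Types f g h : C -> C.

Lemma sderiv_gker (b a w : C) : sderiv (gker b a) w ((a + b * w) * gker b a w).
Proof. by apply: sderiv_eq (sderiv_comp (sderiv_poly2 a b w) (sderiv_cexp _)) _; rewrite mulrC. Qed.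

(** Term by term the pairing depends on [p] and [q] only through [p * conjc q]. Both may be replaced
    by the real [y], and the integral then splits into two real Gaussians. *)
Lemma ip_gker0 (p q : C) (y : R) : normc p < 1 -> normc q < 1 -> 0 <= y -> y < 1 ->
  p * conjc q = (y ^+ 2)%:C -> fock_ip (gker p 0) (gker q 0) = (Num.sqrt (1 - y ^+ 2))^-1%:C.
Proof.
move=> p1 q1 y0 y1 pq.
have ny : normc y%:C < 1 by rewrite normcR ger0_norm.
have [_ h1] := gfun_ip (gfun_gker 0 p1) (L2_gker 0 q1).
have [_ h2] := gfun_ip (gfun_gker 0 ny) (L2_gker 0 ny).
have -> : fock_ip (gker p 0) (gker q 0) = fock_ip (gker y%:C 0) (gker y%:C 0).
  apply: (ccvg_unique h1); apply: ccvg_eq h2 => N; apply: eq_bigr => k _.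
  rewrite (gfun_monomial _ (gfun_gker 0 q1)) (gfun_monomial _ (gfun_gker 0 ny)) /hcoef.
  rewrite !conjcM.
  suff : herm 0 p k * conjc (herm 0 q k) = herm 0 y%:C k * conjc (herm 0 y%:C k).
    move=> H; rewrite ![_ / _ * _]mulrAC ![k`!%:R * (_ * _)]mulrCA ![_ * (conjc _ * _)]mulrA -H //.
  elim/nat_ind2 : (k : nat) => [||n ih _]; rewrite ?herm1// !hermSS !mul0r !add0r !conjcM.
  have -> : p * n.+1%:R * herm 0 p n * (conjc q * conjc n.+1%:R * conjc (herm 0 q n)) =
    (p * conjc q) * (n.+1%:R * conjc n.+1%:R) * (herm 0 p n * conjc (herm 0 q n)) by ring.
  by rewrite pq ih conjc_real expr2 rmorphM; ring.
rewrite ip_self /nrm2; congr (_ %:C).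
have y1' : - y < 1 by lra.
have [_ E] := gauss_quad y1 y1'.
rewrite -sqrtrM ?subr_ge0 ?(ltW y1)// in E.
rewrite (_ : 1 - y ^+ 2 = (1 - y) * (1 - - y)); last by ring.
rewrite -E; apply: eq_IG => z; rewrite /gker normc_cexp -expRM_natl; congr expR.
rewrite mul0r add0r expr2 (_ : y%:C * (z * z) / 2 = (y / 2)%:C * (z * z)); last first.
  by rewrite rmorphM fmorphV rmorph_nat; ring.
by rewrite ReM ReM /=; field.
Qed.

Lemma eq_by_sub (V : zmodType) (x y u v : V) : u = v -> x - y = u - v -> x = y.
Proof. by move=> ->; rewrite subrr => /eqP; rewrite subr_eq0 => /eqP. Qed.

Variable gam : C.
Hypothesis gam1 : normc gam < 1.
Local Notation gamb := (conjc gam).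

(** The scale of the Hermite variable that makes the [hfun] orthogonal: [hfun_ip_rec] uses its
    square [1 - |gam|^2]. *)
Definition hscale (x : R) : R := Num.sqrt (1 - x ^+ 2).

Definition hfun n w : C := herm ((hscale (normc gam))%:C * w) (- gamb) n * gker gam 0 w.

Local Notation c := ((hscale (normc gam))%:C : C).
Local Notation Q := hfun.

Lemma hscale_gt0 : 0 < hscale (normc gam).
Proof. by rewrite sqrtr_gt0 subr_gt0 expr_lt1 ?normc_ge0. Qed.

Lemma hscale_sqr : c ^+ 2 = 1 - gam * gamb.
Proof.
rewrite mul_conjE -(rmorphXn (real_complex R)) sqr_sqrtr ?rmorphB//.
by rewrite subr_ge0 expr_le1 ?normc_ge0// ltW.
Qed.

Lemma hscale_neq0 : c != 0.
Proof. by rewrite (inj_eq (@complexI R) _ 0) gt_eqF// hscale_gt0. Qed.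

Lemma hfun0 w : Q 0 w = gker gam 0 w. Proof. exact: mul1r. Qed.

(** At [n = 0] the last term vanishes through [n%:R]; with this convention the recurrences below
    hold for every [n]. *)
Lemma hfunS n w : Q n.+1 w = c * w * Q n w - gamb * n%:R * Q n.-1 w.
Proof.
case: n => [|n]; first by rewrite /Q herm1 mulr0 mul0r subr0 mul1r.
by rewrite /Q hermSS /=; ring.
Qed.

Lemma hfun_mulw n w : w * Q n w = c^-1 * Q n.+1 w + c^-1 * gamb * n%:R * Q n.-1 w.
Proof. by rewrite hfunS; field; exact: hscale_neq0. Qed.

Lemma sderiv_hfun n w : sderiv (Q n) w (c * n%:R * Q n.-1 w + gam * w * Q n w).
Proof.
have dQ0 : sderiv (Q 0) w (c * 0%:R * Q 0.-1 w + gam * w * Q 0 w).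
  rewrite (_ : Q 0 = gker gam 0); last by apply/funext => ?; exact: hfun0.
  by apply: sderiv_eq (sderiv_gker gam 0 w) _; ring.
have dS m l k : sderiv (Q m) w l -> sderiv (Q m.-1) w k ->
    sderiv (Q m.+1) w (c * (Q m w + w * l) - gamb * m%:R * k).
  move=> dm dk; rewrite (_ : Q m.+1 = (fun w => c * (w * Q m w) + (- gamb * m%:R) * Q m.-1 w)).
    have d1 := sderivM (sderiv_cst c w) (sderivM (sderiv_id w) dm).
    have d2 := sderivM (sderiv_cst (- gamb * m%:R) w) dk.
    by apply: sderiv_eq (sderivD d1 d2) _; ring.
  by apply/funext => v; rewrite hfunS; ring.
elim/nat_ind2 : n => [//||n h1 h2].
  by apply: sderiv_eq (dS 0%N _ _ dQ0 dQ0) _; rewrite (hfunS 0) /=; ring.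
apply: sderiv_eq (dS n.+1 _ _ h2 h1) _.
by rewrite /= (hfunS n.+1) (hfunS n) /= -!natr1; ring.
Qed.

Lemma gfun_hfun n : exists d, gfun d (Q n).
Proof.
have h0 : exists d, gfun d (Q 0).
  by exists (hcoef 0 gam); rewrite (_ : Q 0 = gker gam 0); [exact: gfun_gker|apply/funext => ?; exact: hfun0].
have hS m : (exists d, gfun d (Q m)) -> (exists d, gfun d (Q m.-1)) -> exists d, gfun d (Q m.+1).
  move=> [d1 g1] [d2 g2]; eexists.
  rewrite (_ : Q m.+1 = (fun w => c * (w * Q m w) + (- gamb * m%:R) * Q m.-1 w)).
    exact: gfunD (gfunZ c (gfun_mulz g1)) (gfunZ (- gamb * m%:R) g2).
  by apply/funext => v; rewrite hfunS; ring.
by elim/nat_ind2 : n => [//||n h1 h2]; [exact: hS|exact: hS].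
Qed.

Lemma L2_hfun n : L2 (Q n).
Proof. by have [d /gfun_L2] := gfun_hfun n. Qed.

Lemma gfun_mulX d f k : gfun d f -> exists d', gfun d' (fun w => w ^+ k * f w).
Proof.
move=> df; elim: k => [|k [d' h]].
  by exists d; rewrite (_ : (fun w => _) = f)//; apply/funext => w; rewrite mul1r.
exists (shift_coef d'); have := gfun_mulz h.
by rewrite (_ : (fun z => z * _) = (fun w => w ^+ k.+1 * f w))//; apply/funext => w; rewrite mulrA -exprS.
Qed.

Lemma L2_mulX_hfun k n : L2 (fun w => w ^+ k * Q n w).
Proof. by have [d /(gfun_mulX k)[d' /gfun_L2]] := gfun_hfun n. Qed.

Lemma L2_mulw_hfun n : L2 (fun w => w * Q n w).
Proof. exact: (L2_mulX_hfun 1). Qed.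

Lemma ip_hfun_mulw n h : L2 h ->
  fock_ip (fun w => w * Q n w) h = c^-1 * fock_ip (Q n.+1) h + c^-1 * gamb * n%:R * fock_ip (Q n.-1) h.
Proof.
move=> Lh; rewrite (_ : (fun w => _) = (fun w => c^-1 * Q n.+1 w + (c^-1 * gamb * n%:R) * Q n.-1 w)).
  have LQ := L2_hfun.
  by rewrite (ipDl (L2Z _ (LQ _)) (L2Z _ (LQ _)) Lh) (ipZl _ (LQ _) Lh) (ipZl _ (LQ _) Lh).
by apply/funext => w; rewrite hfun_mulw.
Qed.

Lemma ip_mul_hfun d f m : gfun d f ->
  fock_ip (fun w => w * f w) (Q m) = c * m%:R * fock_ip f (Q m.-1) + gamb * fock_ip f (fun w => w * Q m w).
Proof.
move=> df; have [dm hm] := gfun_hfun m; have Lf := gfun_L2 df.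
rewrite (gfun_adjoint df hm (fun z => sderiv_hfun m z)).
rewrite (_ : (fun z => _) = (fun w => (c * m%:R) * Q m.-1 w + gam * (w * Q m w))); last first.
  by apply/funext => w; ring.
have LQ := L2_hfun; have LW := L2_mulw_hfun.
rewrite (ipDr (L2Z _ (LQ _)) (L2Z _ (LW _)) Lf) (ipZr _ (LQ _) Lf) (ipZr _ (LW _) Lf).
by rewrite conjcM conjc_real conjc_natr.
Qed.

Local Notation a n m := (fock_ip (Q n) (Q m)).

(* Writing [<w Q_n, Q_m>] by the three-term recurrence and by the adjunction shows that
   the defect [E n m] satisfies [E n m = conj gam * conj (E m n)], hence vanishes
   since [|gam| < 1]. *)
Lemma hfun_ip_rec n m : a n.+1 m = m%:R * a n m.-1.
Proof.
have sym i j : a i j = conjc (a j i) by exact: ip_conj (L2_hfun j) (L2_hfun i).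
pose E n m := a n.+1 m - m%:R * a n m.-1.
have ER i j : E i j = gamb * conjc (E j i).
  have [di hi] := gfun_hfun i; have := ip_mul_hfun j hi.
  rewrite (ip_hfun_mulw i (L2_hfun j)) (ip_conj (L2_mulw_hfun j) (L2_hfun i)) (ip_hfun_mulw j (L2_hfun i)).
  rewrite /E !conjcD !conjcN !conjcM conjcV conjc_real !conjc_natr conjcK -!sym.
  move=> /(congr1 (fun x => c * x)); have := hscale_sqr; have := hscale_neq0.
  move: (a i.+1 j) (a i.-1 j) (a i j.-1) (a i j.+1) c => A1 A2 A3 A4 c c0 c2 H.
  have : c * (c * j%:R * A3 + gamb * (c^-1 * A4 + c^-1 * gam * j%:R * A3)) = (c ^+ 2 + gam * gamb) * j%:R * A3 + gamb * A4.
    by field.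
  rewrite c2 -H; have -> : c * (c^-1 * A1 + c^-1 * gamb * i%:R * A2) = A1 + gamb * i%:R * A2 by field.
  by move=> HH; apply: (eq_by_sub HH); ring.
apply/eqP; rewrite -subr_eq0 -[X in X == _]/(E n m) -normc_eq0.
have h1 : normc (E n m) = normc gam * normc (E m n) by rewrite ER normcM !normc_conj.
have h2 : normc (E m n) = normc gam * normc (E n m) by rewrite ER normcM !normc_conj.
rewrite eq_le normc_ge0 andbT leNgt; apply/negP => E0.
have g0 := normc_ge0 gam; have l1 : normc (E m n) <= normc (E n m).
  by rewrite h2 ler_piMl ?normc_ge0// ltW.
move: h1 l1 E0 g0; move: (normc (E n m)) (normc (E m n)) (normc gam) gam1 => x y g g1; nra.
Qed.

Lemma ip_hfun n m : a n m = if n == m then n`!%:R * a 0%N 0%N else 0.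
Proof.
have h0 k : a k.+1 0%N = 0 by rewrite hfun_ip_rec mul0r.
have h0' k : a 0%N k.+1 = 0 by rewrite (ip_conj (L2_hfun k.+1) (L2_hfun 0)) h0 ?conjc0.
elim: n m => [|n ih] [|m]; [by rewrite mul1r|exact: h0'|exact: h0|].
rewrite hfun_ip_rec ih eqSS; case: eqP => [->|_]; last by rewrite mulr0.
by rewrite factS natrM mulrA.
Qed.

Lemma ip_hfun00 : a 0%N 0%N = (hscale (normc gam))^-1%:C.
Proof.
rewrite (_ : Q 0 = gker gam 0); last by apply/funext => ?; exact: hfun0.
by apply: ip_gker0; rewrite ?normc_ge0// mul_conjE.
Qed.

Definition hnorm n : R := Num.sqrt (n`!%:R / hscale (normc gam)).

Definition horth n w : C := (hnorm n)^-1%:C * Q n w.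

Lemma hnorm_gt0 n : 0 < hnorm n.
Proof. by rewrite sqrtr_gt0 divr_gt0 ?hscale_gt0// ltr0n fact_gt0. Qed.

Lemma horth_orthonormal : orthonormal_seq horth.
Proof.
split=> [n|n m]; first exact/L2Z/L2_hfun.
rewrite (ipZl _ (L2_hfun n) (L2Z _ (L2_hfun m))) (ipZr _ (L2_hfun m) (L2_hfun n)) conjc_real ip_hfun.
case: eqP => [->|_]; last by rewrite !mulr0.
have n0 : (0 : R) <= m`!%:R / hscale (normc gam) by rewrite divr_ge0// ltW// hscale_gt0.
rewrite ip_hfun00 -(rmorph_nat (real_complex R)) -!rmorphM.
have -> : (hnorm m)^-1 * ((hnorm m)^-1 * (m`!%:R * (hscale (normc gam))^-1)) = 1.
  by rewrite -[X in _ * (_ * X)](sqr_sqrtr n0) -/(hnorm m); field; rewrite gt_eqF// hnorm_gt0.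
exact: rmorph1.
Qed.

Lemma pf_horth n : pf (horth n).
Proof. by have [d /(gfunZ (hnorm n)^-1%:C)/gfun_pf] := gfun_hfun n. Qed.

Section Coefficients.
Variables a b : C.
Hypothesis b1 : normc b < 1.
Local Notation K := (gker b a).
Local Notation t n := (fock_ip (Q n) K).

(** [W1] comes from the recurrence of [hfun], [W2] and [W3] from moving [w] across as a derivative
    of [K] and of [hfun n]. Eliminating the two pairings that contain [w] leaves a recurrence for
    [t]. *)
Lemma hfun_gker_rec n : (1 - conjc b * gam) * t n.+1 =
  c * conjc a * t n + n%:R * (conjc b - gamb) * t n.-1.
Proof.
have [dn hn] := gfun_hfun n; have hK := gfun_gker a b1; have LK := L2_gker a b1.
have LwK : L2 (fun w => w * K w) := gfun_L2 (gfun_mulz hK).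
have LQ := L2_hfun; have LwQ := L2_mulw_hfun.
have W1 := ip_hfun_mulw n LK.
have W2 : fock_ip (fun w => w * Q n w) K = conjc a * t n + conjc b * fock_ip (Q n) (fun w => w * K w).
  rewrite (gfun_adjoint hn hK (fun z => sderiv_gker b a z)).
  rewrite (_ : (fun z => _) = (fun w => a * K w + b * (w * K w))); last by apply/funext => w; ring.
  by rewrite (ipDr (L2Z a LK) (L2Z b LwK) (LQ n)) (ipZr _ LK (LQ n)) (ipZr _ LwK (LQ n)).
have W3 : fock_ip (Q n) (fun w => w * K w) = c * n%:R * t n.-1 + gam * fock_ip (fun w => w * Q n w) K.
  rewrite (ip_conj LwK (LQ n)) (ip_mul_hfun n hK) conjcD !conjcM conjc_real conjc_natr conjcK.
  by rewrite -(ip_conj LK (LQ _)) -(ip_conj LK (LwQ n)).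
rewrite W3 W1 in W2.
have := hscale_sqr; have := hscale_neq0; move: W2.
move: (t n.+1) (t n) (t n.-1) c => t1 t0 tm c W2 c0 c2.
have : c * (c^-1 * t1 + c^-1 * gamb * n%:R * tm) = t1 + gamb * n%:R * tm by field.
rewrite W2.
have -> : c * (conjc a * t0 + conjc b * (c * n%:R * tm + gam * (c^-1 * t1 + c^-1 * gamb * n%:R * tm))) =
  c * conjc a * t0 + conjc b * (c ^+ 2 * n%:R * tm + gam * (t1 + gamb * n%:R * tm)) by field.
by rewrite c2 => H; apply: (eq_by_sub (esym H)); ring.
Qed.

End Coefficients.
End HermiteFunctions.

(** * Pairings of Gaussian kernels with Hermite functions *)

Section HermiteExpansion.
Variable R : realType.
Local Notation C := R[i].
Implicit Types f g h : C -> C.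

Lemma eq_ipl f g h : (forall w, f w = g w) -> fock_ip f h = fock_ip g h.
Proof. by move=> /funext ->. Qed.

(* This replaces the completeness of the Hermite functions: [gker b a] is
   [gker gam 0] times a power series, dominated termwise since
   [|b - gam| + |gam| < 1], and [w ^+ k * gker gam 0] is a combination of the [hfun]. *)
Lemma gker_orthogonal (gam b a : C) h : normc gam < 1 -> normc (b - gam) + normc gam < 1 -> L2 h ->
  (forall n, fock_ip (hfun gam n) h = 0) -> fock_ip (gker b a) h = 0.
Proof.
move=> g1 bg Lh h0.
have H k n : fock_ip (fun w => w ^+ k * hfun gam n w) h = 0.
  elim: k n => [|k ih] n.
    by rewrite (@eq_ipl _ (hfun gam n))// => w; rewrite mul1r.
  have LX := L2_mulX_hfun g1.
  rewrite (_ : (fun w => _) = (fun w => (hscale (normc gam))%:C^-1 * (w ^+ k * hfun gam n.+1 w) +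
     ((hscale (normc gam))%:C^-1 * conjc gam * n%:R) * (w ^+ k * hfun gam n.-1 w))).
    by rewrite (ipDl (L2Z _ (LX _ _)) (L2Z _ (LX _ _)) Lh) (ipZl _ (LX _ _) Lh) (ipZl _ (LX _ _) Lh) !ih !mulr0 addr0.
  by apply/funext => w; rewrite exprSr -mulrA hfun_mulw//; ring.
have [_ E] := gker_expand a bg Lh; rewrite subrK in E.
apply: (ccvg_unique E); apply: ccvg_eq (ccvg_cst 0) => N; rewrite big1// => k _.
by rewrite (@eq_ipl _ (fun w => w ^+ k * hfun gam 0 w)) ?H ?mulr0// => w; rewrite hfun0.
Qed.

(** [f] minus its projection on the closed span of the [horth gam k] is orthogonal to the kernel by
    [gker_orthogonal], so [f] can be replaced by the projection. *)
Lemma ip_gker_series (gam b a : C) f : normc gam < 1 -> normc (b - gam) + normc gam < 1 -> L2 f ->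
  ccvg (fun N => \sum_(k < N) fock_ip f (horth gam k) * fock_ip (horth gam k) (gker b a))
    (fock_ip f (gker b a)).
Proof.
move=> g1 bg Lf; have oe := horth_orthonormal g1; have pe := pf_horth g1.
have [g [/pf_L2 Lg gE gc]] := projection oe pe Lf.
have b1 : normc b < 1.
  by apply: le_lt_trans bg; rewrite -{1}(subrK gam b) normcD.
have LK := L2_gker a b1; have Lh := L2B Lf Lg.
have LN : L2 (fun z => (-1) * g z) by exact: L2Z.
have hE : (fun z => f z - g z) = (fun z => f z + (-1) * g z) by apply/funext => z; rewrite mulN1r.
have K0 : fock_ip (gker b a) (fun z => f z - g z) = 0.
  apply: (gker_orthogonal a g1 bg Lh) => n.
  have : fock_ip (fun z => f z - g z) (horth gam n) = 0.
    by rewrite hE (ipDl Lf LN (oe.1 n)) (ipZl _ Lg (oe.1 n)) gE mulN1r subrr.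
  rewrite (ipZr _ (L2_hfun g1 n) Lh) => /eqP; rewrite mulf_eq0 conjc_real.
  rewrite (inj_eq (@complexI R) _ 0) invr_eq0 gt_eqF ?hnorm_gt0//= => /eqP h0.
  by rewrite (ip_conj Lh (L2_hfun g1 n)) h0 conjc0.
have E : fock_ip f (gker b a) = fock_ip g (gker b a).
  have := ip_conj LK Lh; rewrite K0 conjc0 hE (ipDl Lf LN LK) (ipZl _ Lg LK) mulN1r.
  by move=> /eqP; rewrite subr_eq0 => /eqP.
by rewrite E; exact: gc.
Qed.

(** Expand [cexp (a w)] and let [M k] be the moments of [w^k B] against [G]. Moving one [w] across
    as a derivative gives [M (k+1) = rho k M (k-1)], the Hermite recurrence with [p = 0], whose
    series is again an exponential. *)
Lemma ip_gker0_gker (gam b a : C) : normc gam < 1 -> normc b < 1 ->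
  fock_ip (gker gam 0) (gker b a) =
  fock_ip (gker gam 0) (gker b 0) * cexp (gam / (1 - gam * conjc b) * conjc a ^+ 2 / 2).
Proof.
move=> g1 b1; set G := gker gam 0; set B := gker b 0.
have gG : gfun (hcoef 0 gam) G := gfun_gker 0 g1.
have LG := gfun_L2 gG; have gB : gfun (hcoef 0 b) B := gfun_gker 0 b1.
have LB k : L2 (fun w => w ^+ k * B w) by have [d /gfun_L2] := gfun_mulX k gB.
pose M k := fock_ip (fun w => w ^+ k * B w) G.
have gb : 1 - conjc gam * b != 0.
  rewrite subr_eq0; apply/eqP => /(congr1 (@normc R)); rewrite normc1 normcM normc_conj => H.
  have := normc_ge0 gam; have := normc_ge0 b; nra.
set rho := conjc gam / (1 - conjc gam * b).
have M1 k : M k.+1 = conjc gam * (k%:R * M k.-1 + b * M k.+1).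
  have [d hd] := gfun_mulX k gB; have LwG := gfun_L2 (gfun_mulz gG).
  transitivity (fock_ip (fun w => w * (w ^+ k * B w)) G).
    by apply: eq_ipl => w; rewrite exprS mulrA.
  rewrite (gfun_adjoint hd gG (fun z => sderiv_gker gam 0 z)).
  rewrite (_ : (fun z => _ * gker gam 0 z) = (fun w => gam * (w * G w))); last first.
    by apply/funext => w; rewrite /G; ring.
  rewrite (ipZr _ LwG (LB k)) (ip_conj LwG (LB k)); congr (_ * _).
  have dB z : sderiv (fun w => w ^+ k * B w) z (k%:R * (z ^+ k.-1 * B z) + b * (z ^+ k.+1 * B z)).
    have dX : sderiv (fun w : C => w ^+ k) z (k%:R * z ^+ k.-1).
      elim: (k) => [|j ih].
        by rewrite mul0r; exact: sderiv_cst.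
      rewrite (_ : (fun w => _) = (fun w => w * w ^+ j)); last by apply/funext => w; rewrite exprS.
      apply: sderiv_eq (sderivM (sderiv_id z) ih) _.
      by case: j {ih} => [|j]; rewrite /= ?mul0r ?mulr0 ?mul1r ?addr0// -[in RHS]natr1 exprS; ring.
    apply: sderiv_eq (sderivM dX (sderiv_gker b 0 z)) _.
    by rewrite exprS /B; ring.
  rewrite (gfun_adjoint gG hd dB) (ipDr (L2Z _ (LB _)) (L2Z _ (LB _)) LG) (ipZr _ (LB _) LG) (ipZr _ (LB _) LG).
  by rewrite conjcD !conjcM !conjcK -!(ip_conj LG (LB _)).
have M2 k : M k = herm 0 rho k * M 0%N.
  have MS k' : M k'.+1 = rho * k'%:R * M k'.-1.
    have := M1 k'; move: (M k'.+1) (M k'.-1) => x y E.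
    by apply: (mulfI gb); rewrite {1}mulrBl mul1r {1}E /rho; field.
  elim/nat_ind2 : k => [||k h1 h2]; first by rewrite mul1r.
    by rewrite MS herm1 !mulr0 !mul0r.
  by rewrite MS [k.+1.-1]/= h1 hermSS mul0r add0r; ring.
have b1' : normc (0 : C) + normc b < 1 by rewrite normc0 add0r.
have [_ E] := gker_expand a b1' LG; rewrite add0r in E.
have E' : fock_ip (gker b a) G = M 0%N * cexp (0 * a + rho * a ^+ 2 / 2).
  apply: (ccvg_unique E); apply: ccvg_eq (ccvgZ (M 0%N) (pser_hcoef 0 rho a)) => N.
  rewrite mulr_sumr; apply: eq_bigr => k _; rewrite -/(M k) (M2 k) hcoef_r0 /hcoef; ring.
rewrite (ip_conj (L2_gker a b1) LG) E' conjcM; congr (_ * _).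
  rewrite (ip_conj (L2_gker 0 b1) LG); congr conjc.
  by apply: eq_ipl => w; rewrite mul1r.
rewrite -cexp_conj; congr cexp.
by rewrite /rho mul0r add0r !conjcM !conjcV conjcD conjc1 conjcN conjcM conjcK conjc_natr.
Qed.

End HermiteExpansion.

(** * Diagonalisation of the integral operators *)

Section GaussianOperator.
Variable R : realType.
Local Notation C := R[i].
Implicit Types f g h : C -> C.

(** The exponent of the kernel splits into a part in [z] alone and the conjugate of a Gaussian
    exponent in [w]. *)
Lemma opSTE (s t z : C) h : s != 0 -> normc (- t / conjc s) < 1 -> L2 h ->
  opST s t h z = (sqrtc s)^-1 * cexp (t * z ^+ 2 / (2 * s)) *
    fock_ip h (gker (- t / conjc s) (conjc (z / s))).
Proof.
move=> s0 b1 Lh; have LK := L2_gker (conjc (z / s)) b1.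
rewrite /fock_ip -gauss_integralZ; last exact: L2_cint.
apply: eq_gauss_integral => w; rewrite /kernelST /gker -cexp_conj.
rewrite (_ : (_ - _ + _) / _ = t * z ^+ 2 / (2 * s) +
    conjc (conjc (z / s) * w + - t / conjc s * w ^+ 2 / 2)); first by rewrite cexpD; ring.
by rewrite conjcD !conjcM !conjcV !conjcN !conjcK conjc_natr; field.
Qed.

Lemma mulf_cancel_div (F : fieldType) (x y z w v : F) : v != 0 ->
  x * y * (z * w) = v * x * (z / v * (y * w)).
Proof. by move=> v0; field. Qed.

Lemma normc_unimodular (x : C) : x != 0 -> normc (x / (normc x)%:C) = 1.
Proof.
move=> x0; have n0 : 0 < normc x by rewrite normc_gt0.
by rewrite normcM normcV normcR ger0_norm ?ltW// divff// gt_eqF.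
Qed.

(** Absorbs the phases of the [kap n] into the left system, which makes the diagonal entries
    positive. *)
Lemma orthonormal_phase (e : nat -> C -> C) (w : nat -> C) : orthonormal_seq e ->
  (forall n, normc (w n) = 1) -> orthonormal_seq (fun n z => w n * e n z).
Proof.
move=> [Le ee] w1; split=> [n|n m]; first exact: L2Z.
rewrite (ipZl _ (Le n) (L2Z _ (Le m))) (ipZr _ (Le m) (Le n)) ee.
case: eqP => [->|_]; last by rewrite !mulr0.
by rewrite mulr1 mul_conjE w1 expr1n.
Qed.

Lemma pf_scale (c : C) f : pf f -> pf (fun z => c * f z).
Proof.
move=> pf_f; have := pf_sum [:: tt] (fun _ => c) (fun _ : unit => pf_f).
by congr pf; apply/funext => z; rewrite big_cons big_nil addr0.
Qed.

Section HermiteToHermite.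
Variables (s t : C) (X : R).
Hypotheses (hst : normc t ^+ 2 + 1 < normc s ^+ 2) (X0 : 0 < X).
Hypothesis hX : X ^+ 2 = (normc s ^+ 2 - normc t ^+ 2 - 1) * X + normc s ^+ 2.

(* The quadratic equation for [X] is what makes the Hermite functions of [gam] map to
   multiples of those of [gam']. *)
Let g := X / (1 + X).
Let gam : C := - g%:C * t / conjc s.
Let gam' : C := g%:C * t / s.
Let b : C := - t / conjc s.
Let c := (hscale (normc gam))%:C : C.
(** The pairing of [gker gam 0] with [gker b 0], computed in [ip_gker00]. *)
Let m0 : R := Num.sqrt (normc s ^+ 2 / X).
Let kap n : C := (sqrtc s)^-1 * m0%:C * (conjc s / X%:C) ^+ n.

Let ns_gt0 : 0 < normc s.
Proof.
rewrite lt_def normc_ge0 andbT; apply/eqP => s0; move: hst; rewrite s0.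
by have := sqr_ge0 (normc t); lra.
Qed.

Let s_neq0 : s != 0. Proof. by rewrite -normc_gt0. Qed.
Let cs_neq0 : conjc s != 0. Proof. by rewrite -normc_eq0 normc_conj gt_eqF. Qed.
Let XC_neq0 : X%:C != 0 :> C. Proof. by rewrite (inj_eq (@complexI R) _ 0) gt_eqF. Qed.

Let g01 : 0 < g < 1.
Proof.
have x1 : 0 < 1 + X by rewrite addr_gt0.
by rewrite divr_gt0//= ltr_pdivrMr// mul1r ltrDr.
Qed.

Let gX : (1 - g) * X = g.
Proof. by rewrite /g; field; rewrite gt_eqF// addr_gt0. Qed.

(** The quadratic equation for [X] in the form in which it is used: through [key] it makes
    [1 - gam * conjc b] equal to [X / |s|^2] in [denE]. *)
Let keyR : normc s ^+ 2 - g * normc t ^+ 2 = X.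
Proof.
have x1 : 1 + X != 0 by rewrite gt_eqF// addr_gt0.
apply: (mulfI x1); rewrite mulrBr /g mulrCA mulrA mulrAC.
rewrite (_ : (1 + X) * (_ / _ * _) = X * normc t ^+ 2); last by field.
by apply: (eq_by_sub (esym hX)); ring.
Qed.

Let key : s * conjc s - g%:C * (t * conjc t) = X%:C.
Proof. by rewrite !mul_conjE -rmorphM -rmorphB keyR. Qed.

Let normc_gam : normc gam = g * normc t / normc s.
Proof.
have [g0 _] := andP g01.
by rewrite normcM normcM normcN normcV normc_conj normcR ger0_norm ?ltW.
Qed.

Let normc_gam' : normc gam' = normc gam.
Proof.
have [g0 _] := andP g01.
by rewrite normc_gam normcM normcM normcV normcR ger0_norm ?ltW.
Qed.

Let normc_b : normc b = normc t / normc s.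
Proof. by rewrite normcM normcN normcV normc_conj. Qed.

Let b1 : normc b < 1.
Proof.
rewrite normc_b ltr_pdivrMr// mul1r -(ltr_pXn2r (n := 2)) ?nnegrE ?normc_ge0//.
by apply: lt_trans hst; rewrite ltrDl.
Qed.

Let gam1 : normc gam < 1.
Proof.
have [g0 g1] := andP g01; rewrite normc_gam -mulrA -normc_b.
by rewrite mulr_ilt1 ?normc_ge0 ?b1// ltW.
Qed.

Let gam'1 : normc gam' < 1. Proof. by rewrite normc_gam'. Qed.

(** Since [gam = g b] with [0 < g < 1], the two moduli add up to [|b|]; this is the domination
    condition of [gker_orthogonal]. *)
Let bgam1 : normc (b - gam) + normc gam < 1.
Proof.
have [g0 g1] := andP g01.
rewrite (_ : b - gam = (1 - g)%:C * b); last by rewrite /b /gam rmorphB rmorph1; ring.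
rewrite normcM normcR ger0_norm ?subr_ge0 ?ltW// normc_gam -mulrA -normc_b -mulrDl subrK mul1r.
exact: b1.
Qed.

Let conj_gam : conjc gam = - g%:C * conjc t / s.
Proof. by rewrite !conjcM conjcN conjcV conjcK conjc_real. Qed.

Let conj_gam' : conjc gam' = g%:C * conjc t / conjc s.
Proof. by rewrite !conjcM conjcV conjc_real. Qed.

Let conj_b : conjc b = - conjc t / s.
Proof. by rewrite conjcM conjcN conjcV conjcK. Qed.

Let denE : 1 - gam * conjc b = X%:C / (s * conjc s).
Proof. by rewrite conj_b -key /gam; field; rewrite ?s_neq0 ?cs_neq0 ?XC_neq0. Qed.

Let den_neq0 : 1 - gam * conjc b != 0.
Proof. by rewrite denE mulf_neq0 ?invr_eq0 ?mulf_neq0. Qed.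

Let gCX : (1 - g%:C) * X%:C = g%:C :> C.
Proof. by rewrite -(rmorph1 (real_complex R)) -rmorphB -rmorphM gX. Qed.

Let ip_gker00 : fock_ip (gker gam 0) (gker b 0) = m0%:C.
Proof.
have [g0 g1] := andP g01.
have y0 : 0 <= g * normc t ^+ 2 / normc s ^+ 2
  := divr_ge0 (mulr_ge0 (ltW g0) (sqr_ge0 _)) (sqr_ge0 _).
have yE : 1 - g * normc t ^+ 2 / normc s ^+ 2 = (normc s ^+ 2 / X)^-1.
  by rewrite -keyR; field; rewrite gt_eqF ?keyR// gt_eqF.
rewrite (ip_gker0 (y := Num.sqrt (g * normc t ^+ 2 / normc s ^+ 2))) ?sqrtr_ge0//.
- by rewrite (sqr_sqrtr y0) yE sqrtrV ?invrK// divr_ge0 ?sqr_ge0 ?ltW.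
- rewrite -sqrtr1 ltr_sqrt// -subr_gt0 yE invr_gt0 divr_gt0// exprn_gt0//.
- rewrite (sqr_sqrtr y0) conj_b.
  have -> : (g * normc t ^+ 2 / normc s ^+ 2)%:C = g%:C * (t * conjc t) / (s * conjc s).
    by rewrite !mul_conjE -[in RHS]fmorphV -!rmorphM.
  rewrite /gam; field.
  by rewrite ?s_neq0 ?cs_neq0.
Qed.

Lemma opST_hfun n z : opST s t (hfun gam n) z = kap n * hfun gam' n z.
Proof.
have Lh := L2_hfun gam1 n; rewrite (opSTE _ s_neq0 b1 Lh) -/b.
set a := conjc (z / s); have ca : conjc a = z / s by rewrite conjcK.
pose T n := fock_ip (hfun gam n) (gker b a).
have T0 : T 0%N = m0%:C * cexp (gam / (1 - gam * conjc b) * (z / s) ^+ 2 / 2).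
  by rewrite /T (eq_ipl (gker b a) (hfun0 gam)) (ip_gker0_gker a gam1 b1) ip_gker00 ca.
have TS m : T m.+1 = (1 - gam * conjc b)^-1 * (c * (z / s) * T m + m%:R * (conjc b - conjc gam) * T m.-1).
  have := hfun_gker_rec gam1 a b1 m; rewrite ca [conjc b * gam]mulrC => <-.
  by rewrite mulKf.
(* Dividing by the m-th power of [conjc s / X] turns the recurrence [TS] into that of
   [herm (c z) (- conjc gam')]; the last coefficient matches because [(1 - g) X = g]. *)
have TE m : T m = (conjc s / X%:C) ^+ m * herm (c * z) (- conjc gam') m * T 0%N.
  elim/nat_ind2 : m => [||m h1 h2]; first by rewrite expr0 !mul1r.
    by rewrite TS denE mul0r mul0r addr0 herm1 expr1; field; rewrite ?s_neq0 ?cs_neq0 ?XC_neq0.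
  rewrite TS [m.+1.-1]/= h1 h2 denE conj_b conj_gam conj_gam' hermSS !exprS.
  have -> : - conjc t / s - - g%:C * conjc t / s = - (g%:C / X%:C) * conjc t / s.
    by rewrite -{2}gCX; field; rewrite ?s_neq0 ?cs_neq0 ?XC_neq0.
  by field; rewrite ?s_neq0 ?cs_neq0 ?XC_neq0.
rewrite -/(T n) TE T0 /hfun normc_gam' -/c /kap /gker.
(* The prefactor of the operator contributes [t / s] and the lowest pairing [T 0] the rest; by [gCX]
   the two add up to [gam']. *)
rewrite (_ : 0 * z + gam' * z ^+ 2 / 2 = t * z ^+ 2 / (2 * s) +
    gam / (1 - gam * conjc b) * (z / s) ^+ 2 / 2); first by rewrite cexpD; ring.
rewrite denE /gam' /gam (_ : g%:C * t / s = t / s - g%:C / X%:C * t / s).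
  by field; rewrite ?s_neq0 ?cs_neq0 ?XC_neq0.
by rewrite -{2}gCX; field; rewrite ?s_neq0 ?cs_neq0 ?XC_neq0.
Qed.

Let q := normc s / X.

Let normc_kap n : normc (kap n) = q ^+ n * Num.sqrt q.
Proof.
have ss : normc (sqrtc s) = Num.sqrt (normc s).
  rewrite -[RHS](_ : Num.sqrt (normc (sqrtc s) ^+ 2) = _); first by rewrite sqrtr_sqr ger0_norm ?normc_ge0.
  by rewrite -normcX sqr_sqrtc.
have sr0 : Num.sqrt (normc s) != 0 by rewrite gt_eqF// sqrtr_gt0.
rewrite normcM normcX normcM normcM !normcV normc_conj !normcR ss !ger0_norm ?sqrtr_ge0 ?ltW//.
rewrite mulrC; congr (_ * _); apply: (mulfI sr0); rewrite mulVKf// -sqrtrM ?normc_ge0//.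
by rewrite /m0 /q expr2 mulrA.
Qed.

Let kap_neq0 n : kap n != 0.
Proof.
by rewrite -normc_gt0 normc_kap mulr_gt0 ?exprn_gt0 ?sqrtr_gt0// divr_gt0.
Qed.

(** Each term of the expanded pairing is, up to the coefficient of [h], the image of one Hermite
    function at [z], which [opST_hfun] computes. *)
Lemma opST_diag : exists e f : nat -> C -> C,
  [/\ orthonormal_seq e, forall n, pf (e n), orthonormal_seq f, forall n, pf (f n) &
      forall h, fock h -> opST s t h = diag e f (fun n => q ^+ n * Num.sqrt q) h].
Proof.
exists (horth gam), (fun n z => kap n / (normc (kap n))%:C * horth gam' n z).
split; [exact: horth_orthonormal|exact: pf_horth| |by move=> n; apply/pf_scale/pf_horth|].
  by apply: orthonormal_phase (horth_orthonormal gam'1) _ => n; exact: normc_unimodular.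
move=> h /fock_L2 Lh; apply/funext => z; rewrite diagE; apply/esym/csumE.
rewrite (opSTE _ s_neq0 b1 Lh) -/b.
apply: ccvg_eq (ccvgZ _ (ip_gker_series (conjc (z / s)) gam1 bgam1 Lh)) => N.
rewrite mulr_sumr; apply: eq_bigr => k _.
have LQ := L2_hfun gam1 k.
have := opST_hfun k z; rewrite (opSTE _ s_neq0 b1 LQ) -/b => E.
rewrite /horth (ipZl _ LQ (L2_gker (conjc (z / s)) b1)) {2}/hnorm -normc_kap.
rewrite (_ : hnorm gam' k = hnorm gam k); last by rewrite /hnorm normc_gam'.
have k0 : (normc (kap k))%:C != 0 :> C by rewrite (inj_eq (@complexI R) _ 0) normc_eq0 kap_neq0.
move: E; move: (fock_ip _ _) (fock_ip _ _) (cexp _) => x y v E.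
transitivity (x * (hnorm gam k)^-1%:C * ((sqrtc s)^-1 * v * y)); first by ring.
by rewrite E; exact: mulf_cancel_div.
Qed.

End HermiteToHermite.
End GaussianOperator.

(** * Schatten norms *)

Section SchattenNorm.
Variable R : realType.
Local Notation C := R[i].

(** The sum of [1 + x <= expR x] at [ln w - m] and at [- m] with weights [u] and [1 - u]; since
    [m = u * ln w] the linear terms cancel. *)
Lemma bernoulli_powR_le (w u : R) : 0 < w -> 0 <= u <= 1 -> w `^ u <= 1 + u * (w - 1).
Proof.
move=> w0 /andP[u0 u1]; rewrite /powR gt_eqF//; set m := u * ln w.
have h1 := expR_ge1Dx (ln w - m); have h2 := expR_ge1Dx (- m).
rewrite expRD lnK// in h1; have mN : expR (- m) * expR m = 1 by rewrite -expRD addNr expR0.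
have {}h1 := ler_wpM2l u0 h1; have u1' : 0 <= 1 - u by rewrite subr_ge0.
have {}h2 := ler_wpM2l u1' h2.
have h3 : 1 <= (1 + u * (w - 1)) * expR (- m).
  rewrite [leLHS](_ : 1 = u * (1 + (ln w - m)) + (1 - u) * (1 - m)); last by rewrite /m; ring.
  have -> : (1 + u * (w - 1)) * expR (- m) = u * (w * expR (- m)) + (1 - u) * expR (- m) by ring.
  exact: lerD.
by have := ler_wpM2r (expR_ge0 m) h3; rewrite mul1r -mulrA mN mulr1.
Qed.

(** The previous inequality for the base [powR w u] and the exponent [u^-1]. *)
Lemma bernoulli_powR_ge (w u : R) : 0 < w -> 1 <= u -> 1 + u * (w - 1) <= w `^ u.
Proof.
move=> w0 u1; have u0 : 0 < u by lra.
have := @bernoulli_powR_le (w `^ u) u^-1 (powR_gt0 _ w0) _.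
rewrite invr_ge0 (ltW u0) invf_le1// u1 -powRrM divff ?gt_eqF// powRr1 ?(ltW w0)// => /(_ isT) H.
have := ler_wpM2l (ltW u0) H; rewrite mulrDr mulrA divff ?gt_eqF//; lra.
Qed.

Section Bounds.
Variables (n D q p : R).
Hypotheses (n0 : 0 < n) (D1 : 1 < D) (Dn : D <= n ^+ 2) (q01 : 0 < q < 1) (p0 : 0 < p).
Hypothesis qE : q^-1 - q = (D - 1) / n.

Let q0 : 0 < q. Proof. by case/andP: q01. Qed.
Let q1 : q < 1. Proof. by case/andP: q01. Qed.

(* [q^-1 - q <= sqrt D - (sqrt D)^-1], and [x - x^-1] increases. *)
Let inv_sqr_le : (q ^+ 2)^-1 <= D.
Proof.
have Q1 : 1 < q^-1 by rewrite invf_gt1.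
set W := (_)^-1; have WE : W = q^-1 ^+ 2 by rewrite exprVn.
have W1 : 1 < W by rewrite WE expr_gt1// ltW// invr_gt0.
have E : (W - 1) ^+ 2 * n ^+ 2 = (D - 1) ^+ 2 * W.
  have -> : W - 1 = q^-1 * (q^-1 - q) by rewrite WE; field; rewrite gt_eqF.
  by rewrite qE WE; field; rewrite !gt_eqF.
have h : (W - 1) ^+ 2 * D <= (D - 1) ^+ 2 * W by rewrite -E ler_wpM2l ?sqr_ge0.
rewrite leNgt; apply/negP => DW.
(* If [D < W] both factors are positive, whereas [h] makes their product non-positive. *)
have : 0 < (W * D - 1) * (W - D) by rewrite mulr_gt0 ?subr_gt0// mulr_egt1.
have -> : (W * D - 1) * (W - D) = (W - 1) ^+ 2 * D - (D - 1) ^+ 2 * W by ring.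
by rewrite subr_gt0 ltNge h.
Qed.

(** [V] is the inverse of [Z], and the factor [E] of the stated bound is [V] with [q^-2] replaced by
    the larger [D]. *)
Let Z := q `^ (p / 2 - 1).
Let E := D `^ ((p - 2) / 4).
Let V := (q ^+ 2)^-1 `^ ((p - 2) / 4).

Let ZV : Z * V = 1.
Proof.
have -> : V = q `^ (- (p / 2 - 1)).
  rewrite (_ : - (p / 2 - 1) = (- 2%:R) * ((p - 2) / 4)); last by field.
  by rewrite powRrM powR_invn ?ltW.
by rewrite powRN divff// powR_eq0 gt_eqF.
Qed.

Let Z0 : 0 < Z. Proof. exact: powR_gt0. Qed.
Let E0 : 0 < E. Proof. exact: powR_gt0 (lt_trans ltr01 D1). Qed.

Let numE : q `^ (p / 2) = q * Z.
Proof. by rewrite -[X in X * Z]powRr1 ?ltW// -powRD ?(gt_eqF q0) ?implybT// addrC subrK. Qed.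

Let q2_lt1 : 0 < 1 - q ^+ 2. Proof. by rewrite subr_gt0 expr_lt1// ltW. Qed.

Let q2E : (q ^+ 2) `^ (p / 2) = q `^ p.
Proof. by rewrite -powR_mulrn ?ltW// -powRrM; congr powR; field. Qed.

Let den0 : 0 < 1 - q `^ p.
Proof.
have := @gt0_ltr_powR R p p0 q 1; rewrite powR1 !nnegrE subr_gt0; apply=> //; exact: ltW.
Qed.

Let boundE : 2 * n / (p * (D - 1) * E) = q / ((p / 2 * (1 - q ^+ 2)) * E).
Proof.
have -> : D - 1 = (q^-1 - q) * n by rewrite qE divfK// gt_eqF.
have -> : q^-1 - q = (1 - q ^+ 2) / q by field; rewrite gt_eqF.
by field; rewrite !gt_eqF.
Qed.

Let A := p / 2 * (1 - q ^+ 2).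

Let A0 : 0 < A. Proof. by rewrite mulr_gt0// divr_gt0. Qed.

(** Isolates the stated bound [q / (A E)]: what remains is to compare [Z E A] with [1 - q^p], using
    [E] against [V = 1 / Z] and Bernoulli for [A]. *)
Let splitE : q * Z = q / (A * E) * (Z * E * A).
Proof. by field; rewrite !gt_eqF. Qed.

Let quot0 : 0 <= q / (A * E). Proof. by rewrite divr_ge0 ?mulr_ge0 ?ltW. Qed.

Lemma schatten_upper : p <= 2 -> q `^ (p / 2) / (1 - q `^ p) <= 2 * n / (p * (D - 1) * E).
Proof.
move=> p2; rewrite boundE numE -/A.
have u1 : 0 <= p / 2 <= 1 by rewrite divr_ge0 ?(ltW p0)//= ler_pdivrMr// mul1r.
have B : A <= 1 - q `^ p.
  have := bernoulli_powR_le (exprn_gt0 2 q0) u1; rewrite q2E lerBrDl -lerBrDr => /le_trans; apply.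
  by rewrite le_eqVlt /A; apply/orP; left; apply/eqP; ring.
have EV : E <= V.
  have D0 := lt_trans ltr01 D1.
  rewrite /E /V (_ : (p - 2) / 4 = - ((2 - p) / 4)); last by field.
  rewrite powRN [leRHS]powRN lef_pV2 ?posrE ?powR_gt0 ?invr_gt0 ?exprn_gt0//.
  rewrite ge0_ler_powR ?nnegrE ?invr_ge0 ?sqr_ge0 ?(ltW D0)//.
  by rewrite divr_ge0// subr_ge0.
rewrite ler_pdivrMr// splitE ler_wpM2l//; apply: le_trans B.
by rewrite ler_piMl ?(ltW A0)// -ZV ler_wpM2l// ltW.
Qed.

Lemma schatten_lower : 2 <= p -> 2 * n / (p * (D - 1) * E) <= q `^ (p / 2) / (1 - q `^ p).
Proof.
move=> p2; rewrite boundE numE -/A.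
have u1 : 1 <= p / 2 by rewrite ler_pdivlMr// mul1r.
have B : 1 - q `^ p <= A.
  have := bernoulli_powR_ge (exprn_gt0 2 q0) u1; rewrite q2E /A => H.
  by rewrite lerBlDl -lerBlDr; apply: le_trans H; rewrite le_eqVlt; apply/orP; left; apply/eqP; ring.
have EV : V <= E.
  rewrite ge0_ler_powR ?nnegrE ?invr_ge0 ?sqr_ge0 ?(le_trans ler01 (ltW D1))//.
  by rewrite divr_ge0// subr_ge0.
rewrite ler_pdivlMr// splitE ler_wpM2l//; apply: (le_trans B).
by rewrite ler_peMl ?(ltW A0)// -ZV ler_wpM2l// ltW.
Qed.

End Bounds.
Lemma geometric_powR_sum (q p : R) : 0 < q < 1 -> 0 < p ->
  (\sum_(0 <= k <oo) ((q ^+ k * Num.sqrt q) `^ p)%:E = (q `^ (p / 2) / (1 - q `^ p))%:E)%E.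
Proof.
move=> /andP[q0 q1] p0.
have z1 : `|q `^ p| < 1.
  rewrite ger0_norm ?powR_ge0//.
  by have := @gt0_ltr_powR R p p0 q 1; rewrite powR1 !nnegrE; apply=> //; exact: ltW.
have H := cvg_geometric_series (a := q `^ (p / 2)) z1.
have E k : (q ^+ k * Num.sqrt q) `^ p = geometric (q `^ (p / 2)) (q `^ p) k.
  rewrite /= powRM ?exprn_ge0 ?sqrtr_ge0 ?(ltW q0)// mulrC -powR12_sqrt ?(ltW q0)// -powRrM mulrC.
  rewrite [p / 2]mulrC -powR_mulrn ?(ltW q0)// -powRrM mulrC -powR_mulrn ?powR_ge0// -powRrM.
  by rewrite [k%:R * p]mulrC.
rewrite -(cvg_lim _ H)// -EFin_lim; last exact: cvgP H.
congr (lim (_ @ \oo)); apply/funext => N /=.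
by rewrite -sumEFin; apply: eq_bigr => k _; rewrite E.
Qed.

Lemma positive_quadratic_root (B S : R) : 0 < B -> 0 < S -> exists2 X : R, 0 < X & X ^+ 2 = B * X + S.
Proof.
move=> B0 S0; have d0 : 0 <= B ^+ 2 + 4 * S by rewrite addr_ge0 ?sqr_ge0 ?mulr_ge0 ?ltW.
exists ((B + Num.sqrt (B ^+ 2 + 4 * S)) / 2).
  by rewrite divr_gt0// ltr_wpDr ?sqrtr_ge0.
have := sqr_sqrtr d0; move: (Num.sqrt _) => r rE.
by apply: (eq_by_sub (u := r ^+ 2 / 4) (v := (B ^+ 2 + 4 * S) / 4)); [rewrite rE|field].
Qed.

Lemma opST_schatten (s t : C) : normc t ^+ 2 + 1 < normc s ^+ 2 -> exists q : R,
  [/\ 0 < q < 1, q^-1 - q = (normc s ^+ 2 - normc t ^+ 2 - 1) / normc s,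
      compact_op (opST s t), is_singular_values (opST s t) (singular_values (opST s t)) &
      forall p : R, 0 < p -> schatten_sum (opST s t) p = (q `^ (p / 2) / (1 - q `^ p))%:E].
Proof.
move=> hst; have B0 : 0 < normc s ^+ 2 - normc t ^+ 2 - 1 by lra.
have t0 := sqr_ge0 (normc t).
have s20 : 0 < normc s ^+ 2 by lra.
have s0 : 0 < normc s by rewrite lt_def normc_ge0 -sqrf_eq0 gt_eqF.
have [X X0 hX] := positive_quadratic_root B0 s20.
have [e [f [oe pe of_ pf_ TD]]] := opST_diag hst X0 hX.
set q := normc s / X in TD.
have q0 : 0 < q by rewrite divr_gt0.
(* The quadratic equation gives [X^2 > |s|^2]. *)
have q1 : q < 1.
  rewrite ltr_pdivrMr// mul1r -(ltr_pXn2r (n := 2)) ?nnegrE ?ltW// hX ltrDr mulr_gt0//.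
pose lam n := q ^+ n * Num.sqrt q.
have lam_gt0 n : 0 < lam n by rewrite mulr_gt0 ?exprn_gt0 ?sqrtr_gt0.
have lam_dec n : lam n.+1 < lam n.
  by rewrite ltr_pM2r ?sqrtr_gt0// exprS gtr_pMl ?exprn_gt0.
have lam_ge0 n : 0 <= lam n := ltW (lam_gt0 n).
have lam_ni : nonincreasing_seq lam by apply/nonincreasing_seqP => n; exact/ltW.
have lam0 : lam @ \oo --> (0 : R).
  have := @cvg_geometric _ (Num.sqrt q) q; rewrite ger0_norm ?ltW// => /(_ q1).
  by rewrite /geometric /lam; under eq_fun do rewrite mulrC.
have bT := T_bounded oe of_ pf_ lam_gt0 lam_dec TD.
have sv := singular_valuesE oe pe of_ pf_ lam_gt0 lam_dec TD.
exists q; split.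
- by rewrite q0.
- have -> : normc s ^+ 2 - normc t ^+ 2 - 1 = (X ^+ 2 - normc s ^+ 2) / X.
    by rewrite hX addrK mulfK// gt_eqF.
  by rewrite /q; field; rewrite !gt_eqF.
- exact: (compact_diag oe of_ pf_ lam_ge0 lam_ni lam0 TD bT).
- by rewrite sv; exact: (lam_is_singular_values oe pe of_ pf_ lam_gt0 lam_dec TD).
- by move=> p p0; rewrite /schatten_sum sv geometric_powR_sum// q0.
Qed.

End SchattenNorm.

Theorem theorem10 (R : realType) (s t : R[i])
    (hst : normc t ^+ 2 + 1 < normc s ^+ 2) :
  [/\ forall p : R, 0 < p -> schatten_class (opST s t) p,
      forall p : R, 0 < p -> p <= 2 ->
        (schatten_norm (opST s t) p `^ p <=
         (2 * normc s /
          (p * (normc s ^+ 2 - normc t ^+ 2 - 1) *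
           (normc s ^+ 2 - normc t ^+ 2) `^ ((p - 2) / 4)))%:E)%E &
      forall p : R, 2 <= p ->
        ((2 * normc s /
          (p * (normc s ^+ 2 - normc t ^+ 2 - 1) *
           (normc s ^+ 2 - normc t ^+ 2) `^ ((p - 2) / 4)))%:E <=
         schatten_norm (opST s t) p `^ p)%E].
Proof.
have [q [q01 qE cT svT sum]] := opST_schatten hst.
have t0 := sqr_ge0 (normc t).
have s0 : 0 < normc s by rewrite lt_def normc_ge0 -sqrf_eq0 gt_eqF//; lra.
have D1 : 1 < normc s ^+ 2 - normc t ^+ 2 by lra.
have Dn : normc s ^+ 2 - normc t ^+ 2 <= normc s ^+ 2 by lra.
have normE p : 0 < p -> (schatten_norm (opST s t) p `^ p)%E = (q `^ (p / 2) / (1 - q `^ p))%:E.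
  move=> p0; rewrite /schatten_norm -poweRrM mulVf ?gt_eqF// poweRe1 ?sum//.
  by rewrite -sum//; apply: nneseries_ge0 => k _ _; rewrite lee_fin powR_ge0.
split=> [p p0|p p0 p2|p p2].
- by split=> //; rewrite sum// ltry.
- by rewrite normE// lee_fin; exact: schatten_upper.
- have p0 : 0 < p by exact: lt_le_trans p2.
  by rewrite normE// lee_fin; exact: schatten_lower.
Qed.
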